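(* Let $\Omega=\mathbb{T}\times\mathbb{R}$ and let $\rho_s:\mathbb{R}\to\mathbb{R}$ satisfy $\rho_s'\in W^{\infty,\infty}(\mathbb{R})$ and $$\sup_{\mathbb{R}}\rho_s'>\max\Big\{0,\limsup_{|y|\to\infty}\rho_s'(y)\Big\}.$$ Then there exists $k_*\in\mathbb{N}$ depending only on $\rho_s'$ such that the operator $L=\rho_s'(y)\,\partial_1\Delta^{-1}\partial_1$ has a strictly increasing sequence of positive eigenvalues $\{\lambda_k\}_{k=k_*}^\infty$ converging to $\sup_{\mathbb{R}}\rho_s'$. Moreover, for each $k\ge k_*$, $\lambda_k$ has a real eigenfunction of the form $w_k(x,y)=\cos(kx)\tilde w_k(y)\in H^\infty(\Omega)$.
   Context: $\mathbb{T}=\mathbb{R}/2\pi\mathbb{Z}$; coordinates $(x,y)$, $\partial_1=\partial_x$. The operator $\partial_1\Delta^{-1}\partial_1$ is the Fourier multiplier on $\mathbb{T}\times\mathbb{R}$ with symbol $\frac{k^2}{k^2+\xi^2}$ for $k\in\mathbb{Z}\setminus\{0\}$, $\xi\in\mathbb{R}$, and $0$ for $k=0$. $W^{\infty,\infty}$ denotes the functions all of whose derivatives of every order $\ge0$ are bounded; $H^\infty(\Omega)=\bigcap_nH^n(\Omega)$. $L$ is a bounded operator on $H^m(\Omega)$ for every $m\ge0$. *)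

(* Defs.v *)
From HB Require Import structures.
From mathcomp Require Import all_boot all_order all_algebra.
From mathcomp Require Import all_classical all_reals all_analysis.
From mathcomp Require Export complex.

Set Implicit Arguments.
Unset Strict Implicit.
Unset Printing Implicit Defensive.

Import Order.TTheory GRing.Theory Num.Theory.
Import numFieldNormedType.Exports.

Local Open Scope classical_set_scope.
Local Open Scope ring_scope.
Local Open Scope complex_scope.

Section Defs.
Context {R : realType}.

Definition W_infty_infty (g : R -> R) : Prop :=
  forall n : nat,
    (forall y, derivable (derive1n n g) y 1) /\
    (exists M : R, forall y, `|derive1n n g y| <= M).

(* Neighbourhoods of |y| -> oo. *)
Definition abs_infty : set_system R :=
  filter_from setT (fun M : R => [set y | M < `|y|]).

(** Functions on [T x R] are functions on [R * R] that are [2 pi]-periodic in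
    the first variable; integrals over [T x R] are integrals over the
    fundamental domain [Omega]. *)

Definition periodic1 {V : Type} (w : R * R -> V) : Prop :=
  forall x y : R, w (x + 2 * pi, y) = w (x, y).

Definition Omega : set (R * R) := `[0, 2 * pi] `*` setT.

Definition mu2 := (@lebesgue_measure R \x @lebesgue_measure R)%E.

Definition normsq (z : R[i]) : R := complex.Re z ^+ 2 + complex.Im z ^+ 2.

Definition measurable_C d (T : measurableType d) (D : set T) (f : T -> R[i]) :
    Prop :=
  measurable_fun D (fun t => complex.Re (f t)) /\
  measurable_fun D (fun t => complex.Im (f t)).

Definition integral_C (D : set (R * R)) (f : R * R -> R[i]) : R[i] :=
  Rintegral mu2 D (fun p => complex.Re (f p)) +i*
  Rintegral mu2 D (fun p => complex.Im (f p)).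

Definition L2 (w : R * R -> R[i]) : Prop :=
  [/\ periodic1 w, measurable_C Omega w &
      (\int[mu2]_(p in Omega) (normsq (w p))%:E < +oo)%E].

Definition dx (phi : R * R -> R) : R * R -> R :=
  fun p => derive1 (fun x => phi (x, p.2)) p.1.

Definition dy (phi : R * R -> R) : R * R -> R :=
  fun p => derive1 (fun y => phi (p.1, y)) p.2.

Definition dxy (a b : nat) (phi : R * R -> R) : R * R -> R :=
  iter a dx (iter b dy phi).

(* Existence and continuity of all d_x^a d_y^b phi already gives C^infty, so no
   other order of differentiation is needed. *)
Definition smooth (phi : R * R -> R) : Prop :=
  (forall b x y, derivable (fun t => iter b dy phi (x, t)) y 1) /\
  (forall a b, (forall x y, derivable (fun t => dxy a b phi (t, y)) x 1) /\
               continuous (dxy a b phi)).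

(* Compact support on T x R only constrains y, as T is compact. *)
Definition test_function (phi : R * R -> R) : Prop :=
  [/\ periodic1 phi, smooth phi &
      exists M : R, forall x y, M < `|y| -> phi (x, y) = 0].

Definition weak_derivative (a b : nat) (w g : R * R -> R[i]) : Prop :=
  forall phi, test_function phi ->
    integral_C Omega (fun p => w p * (dxy a b phi p)%:C) =
    (-1) ^+ (a + b) * integral_C Omega (fun p => g p * (phi p)%:C).

Definition sobolev_H (n : nat) (w : R * R -> R[i]) : Prop :=
  L2 w /\
  forall a b, (a + b <= n)%N -> exists g, L2 g /\ weak_derivative a b w g.

Definition sobolev_H_infty (w : R * R -> R[i]) : Prop :=
  forall n, sobolev_H n w.

Definition expNi (t : R) : R[i] := cos t -i* sin t.

Definition fourier_trunc (N : nat) (w : R * R -> R[i]) (k : int) (xi : R) :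
    R[i] :=
  ((2 * pi)^-1)%:C *
  integral_C (`[0, 2 * pi] `*` `[- N%:R, N%:R])
    (fun p => w p * expNi (k%:~R * p.1 + xi * p.2)).

Definition sq_norm_dual (F : int -> R -> R[i]) : \bar R :=
  esum [set: int] (fun k =>
    \int[@lebesgue_measure R]_(xi in setT) (normsq (F k xi))%:E)%E.

Definition L2_dual (F : int -> R -> R[i]) : Prop :=
  (forall k, measurable_C setT (F k)) /\ (sq_norm_dual F < +oo)%E.

(* F is the Fourier transform of w in L^2(T x R): the limit in L^2(Z x R) of
   the transforms of the truncations of w to |y| <= N, which are integrable. *)
Definition is_fourier (w : R * R -> R[i]) (F : int -> R -> R[i]) : Prop :=
  [/\ L2 w, L2_dual F &
      sq_norm_dual (fun k xi => F k xi - fourier_trunc N w k xi)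
        @[N --> \oo] --> (0 : \bar R)].

Definition symbol (k : int) (xi : R) : R :=
  if k == 0 then 0 else (k%:~R) ^+ 2 / ((k%:~R) ^+ 2 + xi ^+ 2).

(* The symbol is (i k)^2 / -(k^2 + xi^2).  Graph of the Fourier multiplier d_1 Delta^-1 d_1 on L^2(T x R). *)
Definition d1_invLap_d1 (w v : R * R -> R[i]) : Prop :=
  exists F, is_fourier w F /\
            is_fourier v (fun k xi => (symbol k xi)%:C * F k xi).

Definition ae_equal (u v : R * R -> R[i]) : Prop :=
  ae_eq mu2 Omega u v.

(* Graph of L = g(y) d_1 Delta^-1 d_1. *)
Definition L_op (g : R -> R) (w u : R * R -> R[i]) : Prop :=
  exists v, d1_invLap_d1 w v /\ ae_equal u (fun p => (g p.2)%:C * v p).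

Definition eigenfunction (g : R -> R) (lam : R[i]) (w : R * R -> R[i]) :
    Prop :=
  [/\ L2 w, ~ ae_equal w (fun=> 0) & L_op g w (fun p => lam * w p)].

Definition eigenvalue_L (g : R -> R) (lam : R[i]) : Prop :=
  exists w, eigenfunction g lam w.

End Defs.

(* Main.v *)
Require Import Defs.
From HB Require Import structures.
From mathcomp Require Import all_boot all_order all_algebra.
From mathcomp Require Import all_classical all_reals all_analysis.
From mathcomp Require Import measurable_realfun.
From mathcomp Require Import ring lra zify.

Set Implicit Arguments.
Unset Strict Implicit.
Unset Printing Implicit Defensive.

Import Order.TTheory GRing.Theory Num.Theory.
Import numFieldNormedType.Exports.

Local Open Scope classical_set_scope.
Local Open Scope ring_scope.

(** For w = cos(kx) (u - u''/k^2) the multiplier gives cos(kx) u, so w is an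
    eigenfunction of g(y) d_1 Delta^-1 d_1 with eigenvalue lambda as soon as
    u'' = k^2 (1 - g / lambda) u with u decaying.  The largest such lambda for
    a given k has a positive u.  It is obtained by Neumann shooting on [-n, n]
    in the parameter mu = 1 / lambda, followed by a compactness argument in
    (mu, u(0), u'(0)) as n goes to infinity: where |y| is large, lambda stays
    above limsup g, so u is convex there and the limit decays exponentially.
    Sturm comparison on an interval where g is close to its supremum bounds
    lambda from below for large k, and Picone's identity shows that lambda is
    determined by k and strictly increases with k.  On the Fourier side,
    integration by parts bounds the tails of the truncated transforms by
    o(1) / (1 + xi^2), which replaces Plancherel's theorem. *)

(** * Derivatives and primitives *)

(** On the line, a limit of solutions on growing intervals could vanish or fail to decay. Vanishing
    is excluded by normalising (u(0), u'(0)) to the unit circle. Decay comes from the hypothesis on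
    the supremum: some L1 >= 0 below sup g bounds g for large |y|, and every parameter used
    satisfies 1 / mu >= L > L1, so u''/u is bounded below by a positive constant far out. The
    Neumann conditions at the ends fix the sign of u' there, and this sign selects the decaying
    behaviour over the growing one. The window for mu has its left end at 1 / (sup g + 1), where the
    coefficient is positive everywhere and the shot solution never turns back. Its right end is 1 /
    L with L < sup g, where the coefficient is at most -c k^2 on a fixed interval. A half period
    must fit into that interval, and this is what forces k to be large. Positivity of u survives the
    limit and is used again later: Picone's identity divides by it. *)

Section calculus.
Context {R : realType}.
Implicit Types (f g F G : R -> R).

Lemma is_derive_fcst (c y : R) : is_derive y 1 (fun=> c) (0 : R).
Proof. exact: is_derive_cst. Qed.

Lemma is_derive_fid (y : R) : is_derive y 1 (fun t : R => t) (1 : R).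
Proof. exact: is_derive_id. Qed.

Lemma is_derive_fadd f g (y df dg : R) : is_derive y 1 f df -> is_derive y 1 g dg ->
  is_derive y 1 (fun t => f t + g t) (df + dg).
Proof. by move=> hf hg; exact: is_deriveD. Qed.

Lemma is_derive_fopp f (y df : R) : is_derive y 1 f df -> is_derive y 1 (fun t => - f t) (- df).
Proof. by move=> hf; exact: is_deriveN. Qed.

Lemma is_derive_fmul f g (y df dg : R) : is_derive y 1 f df -> is_derive y 1 g dg ->
  is_derive y 1 (fun t => f t * g t) (df * g y + f y * dg).
Proof.
move=> hf hg; have h := is_deriveM hf hg.
by apply: is_derive_eq; rewrite /GRing.scale /= addrC mulrC.
Qed.

Lemma is_derive_fexp f n (y df : R) : is_derive y 1 f df ->
  is_derive y 1 (fun t => f t ^+ n) (n%:R * f y ^+ n.-1 * df).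
Proof.
move=> hf; have h := is_deriveX n hf.
rewrite (_ : (fun t => f t ^+ n) = f ^+ n); last first.
  by apply/funext => t; rewrite exprfctE.
exact: h.
Qed.

Lemma is_derive_finv f (y df : R) : f y != 0 -> is_derive y 1 f df ->
  is_derive y 1 (fun t => (f t)^-1) (- df / f y ^+ 2).
Proof.
move=> f0 hf; have h := is_deriveV f0 hf.
by apply: is_derive_eq; rewrite /GRing.scale /= ; field.
Qed.

Lemma is_derive_fcomp f g (y df dg : R) : is_derive y 1 g dg -> is_derive (g y) 1 f df ->
  is_derive y 1 (fun t => f (g t)) (df * dg).
Proof. by move=> hg hf; have h := is_derive1_comp hf hg; exact: h. Qed.

Lemma is_derive_continuous f (y d : R) : is_derive y 1 f d -> {for y, continuous f}.
Proof. by move=> [h _]; apply: differentiable_continuous; apply/derivable1_diffP. Qed.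

Definition derives f df := forall y : R, is_derive y 1 f (df y).

Lemma derives_continuous f df : derives f df -> continuous f.
Proof. by move=> h y; exact: is_derive_continuous (h y). Qed.

End calculus.

(** Each rule leaves the derivative as a unification variable, so [derive_rule] computes it from the
    syntax and returns an equation between the computed and the stated derivative.
    [notypeclasses refine] keeps instance search away from the [is_derive] premises. *)
Ltac derive_step := match goal with
 | H : is_derive ?y _ ?f _ |- is_derive ?y _ (fun t => ?f t) _ => exact: H
 | H : forall y, is_derive y _ ?f _ |- is_derive ?y _ (fun t => ?f t) _ => exact: (H y)
 | H : derives ?f _ |- is_derive ?y _ (fun t => ?f t) _ => exact: (H y)
 | H : derives ?f _ |- is_derive ?y _ ?f _ => exact: (H y)
 | |- is_derive _ _ (fun=> ?c) _ => exact: is_derive_fcst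
 | |- is_derive _ _ (fun t => t) _ => exact: is_derive_fid
 | |- is_derive _ _ (fun t => @?f t + @?g t) _ => notypeclasses refine (@is_derive_fadd _ f g _ _ _ _ _)
 | |- is_derive _ _ (fun t => - @?f t) _ => notypeclasses refine (@is_derive_fopp _ f _ _ _)
 | |- is_derive _ _ (fun t => @?f t * @?g t) _ => notypeclasses refine (@is_derive_fmul _ f g _ _ _ _ _)
 | |- is_derive _ _ (fun t => (@?f t) ^+ ?n) _ => notypeclasses refine (@is_derive_fexp _ f n _ _ _)
 | |- is_derive _ _ (fun t => (@?f t)^-1) _ => notypeclasses refine (@is_derive_finv _ f _ _ _ _)
 | |- is_derive ?y _ (fun t => expR (@?g t)) _ =>
     notypeclasses refine (@is_derive_fcomp _ expR g y (expR (g y)) _ _ _); [|exact: is_derive_expR]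
 | |- is_derive ?y _ (fun t => cos (@?g t)) _ =>
     notypeclasses refine (@is_derive_fcomp _ cos g y (- sin (g y)) _ _ _); [|exact: is_derive_cos]
 | |- is_derive ?y _ (fun t => sin (@?g t)) _ =>
     notypeclasses refine (@is_derive_fcomp _ sin g y (cos (g y)) _ _ _); [|exact: is_derive_sin]
 | H : forall y, is_derive y _ ?f _ |- is_derive ?y _ (fun t => ?f (@?g t)) _ =>
     notypeclasses refine (@is_derive_fcomp _ f g y _ _ _ (H (g y)))
 | H : derives ?f _ |- is_derive ?y _ (fun t => ?f (@?g t)) _ =>
     notypeclasses refine (@is_derive_fcomp _ f g y _ _ _ (H (g y)))
 end.
Ltac derive_rule := notypeclasses refine (@is_derive_eq _ _ _ _ _ _ _ _ _ _); [ repeat derive_step | ]; cbv beta.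

Section calculus2.
Context {R : realType}.
Implicit Types (f g F G : R -> R).

Lemma continuous_within f (A : set R) : continuous f -> {within A, continuous f}.
Proof. exact: continuous_subspaceT. Qed.

Lemma nondecreasing_is_derive f (df : R -> R) (a b : R) : a <= b ->
  (forall y, a <= y <= b -> is_derive y 1 f (df y)) ->
  (forall y, a <= y <= b -> 0 <= df y) -> f a <= f b.
Proof.
move=> ab hf h0.
have cf : {within `[a, b], continuous f}.
  apply: continuous_in_subspaceT => x; rewrite inE /= in_itv /= => xab.
  exact: is_derive_continuous (hf x xab).
have [|c cab E] := MVT_segment ab _ cf (df := df).
  move=> x; rewrite in_itv /= => /andP[ax xb]; apply: hf; rewrite !ltW//.
by rewrite -subr_ge0 E mulr_ge0 ?subr_ge0// h0.
Qed.

(** Integrals over [[a, x]] need a base point to the left of [x], and no single one serves the whole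
    line. The base therefore moves with [x]. Additivity makes the value independent of it, so near a
    given [y] it can be frozen and the fundamental theorem applies. *)
Lemma primitive_exists f : continuous f ->
  exists F, F 0 = 0 /\ derives F f.
Proof.
move=> cf.
pose I (a x : R) : R := Rintegral (@lebesgue_measure R) `[a, x] f.
have intf a x : (@lebesgue_measure R).-integrable `[a, x] (EFin \o f).
  apply: continuous_compact_integrable; first exact: segment_compact.
  exact: continuous_within.
have shift a b x : a <= b -> b <= x -> I a x - I a b = I b x.
  move=> ab bx; rewrite /I Rintegral_itvB; last 3 first.
  - exact: intf.
  - by rewrite bnd_simp.
  - by rewrite bnd_simp.
  by rewrite Rintegral_itv_obnd_cbnd//; apply: integrableS (intf b x) => //;
     apply: subset_itvr; rewrite bnd_simp.
have indep (a b x : R) : a <= b -> b <= x -> b <= 0 -> I a x - I a 0 = I b x - I b 0.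
  by move=> ab bx b0; rewrite -(shift a b x)// -(shift a b 0)//; ring.
pose F x := I (- (`|x| + 1)) x - I (- (`|x| + 1)) 0.
exists F; split; first by rewrite /F subrr.
move=> y.
(* For |x - y| < 1 the moving base -(|x| + 1) stays to the right of -n. *)
pose n : R := `|y| + 3.
have FE x : `|x - y| < 1 -> F x = I (- n) x - I (- n) 0.
  move=> xy; rewrite /F; apply/esym/indep; rewrite /n.
  - by rewrite lerN2; have := ler_normB (x-y) (-y); rewrite opprK subrK normrN; lra.
  - by have := ler_norm (-x); rewrite normrN; lra.
  - by have := normr_ge0 x; lra.
have [dI EI] : derivable (I (- n)) y 1 /\ derive1 (I (- n)) y = f y.
  apply: (@continuous_FTC1_closed R f (-n) y (y + 1)); [lra|exact: intf| |exact: cf].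
  by rewrite /n; have := ler_norm (-y); rewrite normrN; lra.
have dI' : is_derive y 1 (I (- n)) (f y).
  by rewrite -EI derive1E; apply: derivableP.
have dG : is_derive y 1 (fun x => I (- n) x - I (- n) 0) (f y).
  by derive_rule; ring.
apply: (near_eq_is_derive _ dG).
near=> x; apply/esym/FE.
near: x; exists 1 => //= x; by rewrite /ball /= distrC.
Unshelve. all: by end_near. Qed.

Lemma nondecreasing_derives f df (a b : R) : derives f df -> a <= b ->
  (forall y, a <= y <= b -> 0 <= df y) -> f a <= f b.
Proof. by move=> h ab h0; apply: (nondecreasing_is_derive ab _ h0) => y _; exact: h. Qed.

Lemma convex_min (H H1 H2 : R -> R) : derives H H1 -> derives H1 H2 -> (forall y, 0 <= H2 y) ->
  H1 0 = 0 -> forall y, H 0 <= H y.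
Proof.
move=> h1 h2 h20 H10 y; have [y0|/ltW y0] := leP 0 y.
  apply: (nondecreasing_derives h1) => // z /andP[z0 _].
  by rewrite -H10; apply: (nondecreasing_derives h2).
rewrite -lerN2; apply: (@nondecreasing_is_derive (fun t => - H t) (fun t => - H1 t)) => //.
  by move=> z _; derive_rule.
by move=> z /andP[_ z0]; rewrite oppr_ge0 -H10; apply: (nondecreasing_derives h2).
Qed.

(** Both B H + F and B H - F are convex with a critical point at 0, so each is minimal there. *)
Lemma second_derivative_bound (F F1 F2 H H1 H2 : R -> R) (B : R) :
  derives F F1 -> derives F1 F2 -> derives H H1 -> derives H1 H2 ->
  F 0 = 0 -> F1 0 = 0 -> H1 0 = 0 -> (forall y, `|F2 y| <= B * H2 y) ->
  forall y, `|F y| <= B * (H y - H 0).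
Proof.
move=> f1 f2 h1 h2 F0 F10 H10 b y; rewrite ler_norml; apply/andP; split.
  have := @convex_min (fun t => B * H t + F t) (fun t => B * H1 t + F1 t)
    (fun t => B * H2 t + F2 t).
  rewrite F0 F10 H10 => /(_ _ _ _ _ y) h.
  suff : B * H 0 + 0 <= B * H y + F y by lra.
  apply: h => [z|z|z|]; [by derive_rule; ring|by derive_rule; ring| |by ring].
  by have := b z; rewrite ler_norml; lra.
have := @convex_min (fun t => B * H t - F t) (fun t => B * H1 t - F1 t)
    (fun t => B * H2 t - F2 t).
rewrite F0 F10 H10 => /(_ _ _ _ _ y) h.
suff : B * H 0 - 0 <= B * H y - F y by lra.
apply: h => [z|z|z|]; [by derive_rule; ring|by derive_rule; ring| |by ring].
by have := b z; rewrite ler_norml; lra.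
Qed.

(* With E = f^2 + f1^2 + eta^2 and L = 2 + M, |E'| <= L E, so E e^{-Ly} and
   E e^{Ly} are monotone. *)
Lemma energy_bound (f f1 q h : R -> R) (M eta r : R) : 0 <= r ->
  derives f f1 -> derives f1 (fun y => q y * f y + h y) ->
  f 0 = 0 -> f1 0 = 0 ->
  (forall y, `|y| <= r -> `|q y| <= M) -> (forall y, `|y| <= r -> `|h y| <= eta) ->
  forall y, `|y| <= r -> f y ^+ 2 + f1 y ^+ 2 <= eta ^+ 2 * expR ((2 + M) * r).
Proof.
move=> r0 df df1 f0 f10 hq hh.
have M0 : 0 <= M by apply: le_trans (hq 0 _); rewrite ?normr0.
have key y : `|y| <= r -> `|2 * f y * f1 y + 2 * f1 y * (q y * f y + h y)| <=
    (2 + M) * (f y ^+ 2 + f1 y ^+ 2 + eta ^+ 2).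
  move=> yr; have := hq y yr; have := hh y yr.
  rewrite !ler_norml => /andP[h1 h2] /andP[q1 q2].
  have hsq : h y ^+ 2 <= eta ^+ 2.
    have : 0 <= (eta - h y) * (eta + h y) by rewrite mulr_ge0//; lra.
    by lra.
  have A : `|2 * f y * f1 y| <= f y ^+ 2 + f1 y ^+ 2.
    have := sqr_ge0 (f y - f1 y); have := sqr_ge0 (f y + f1 y).
    by rewrite ler_norml !expr2 => ? ?; apply/andP; split; lra.
  have C : `|2 * f y * f1 y * q y| <= M * (f y ^+ 2 + f1 y ^+ 2).
    by rewrite normrM mulrC; apply: ler_pM => //; exact: hq.
  have D : `|2 * f1 y * h y| <= f1 y ^+ 2 + eta ^+ 2.
    have := sqr_ge0 (f1 y - h y); have := sqr_ge0 (f1 y + h y).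
    by move: hsq; rewrite ler_norml !expr2 => ? ? ?; apply/andP; split; lra.
  move: A C D; rewrite !ler_norml => /andP[A1 A2] /andP[C1 C2] /andP[D1 D2].
  have := sqr_ge0 eta; have := sqr_ge0 (f y); have := sqr_ge0 (f1 y).
  by move=> ? ? ?; apply/andP; split; nra.
pose E y := f y ^+ 2 + f1 y ^+ 2 + eta ^+ 2.
have dE (y : R) : is_derive y 1 E (2 * f y * f1 y + 2 * f1 y * (q y * f y + h y)).
  by rewrite /E; derive_rule; rewrite /=; ring.
suff main y : `|y| <= r -> E y <= eta ^+ 2 * expR ((2 + M) * `|y|).
  move=> y yr; have := main y yr; rewrite /E.
  have : eta ^+ 2 * expR ((2 + M) * `|y|) <= eta ^+ 2 * expR ((2 + M) * r).
    by rewrite ler_wpM2l ?sqr_ge0// ler_expR ler_wpM2l//; lra.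
  by have := sqr_ge0 eta; lra.
have E0 : E 0 = eta ^+ 2 by rewrite /E f0 f10; ring.
move=> yr; have [y0|/ltW y0] := leP 0 y.
  have /(_ y0) := @nondecreasing_is_derive (fun t => - (E t * expR (- (2 + M) * t)))
    (fun t => - ((2 * f t * f1 t + 2 * f1 t * (q t * f t + h t)) - (2 + M) * E t) * expR (- (2 + M) * t)) 0 y.
  rewrite mulr0 expR0 E0 mulr1 => H.
  have {}H : - eta ^+ 2 <= - (E y * expR (- (2 + M) * y)).
    apply: H => z /andP[z0 zy]; first by derive_rule; ring.
    have /key : `|z| <= r by rewrite ger0_norm// (le_trans zy)//; rewrite ger0_norm in yr.
    rewrite ler_norml /E => /andP[_ ?]; rewrite mulr_ge0 ?expR_ge0//; lra.
  rewrite ger0_norm//; move: H; rewrite lerN2 mulNr expRN.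
  by rewrite ler_pdivrMr ?expR_gt0.
have /(_ y0) := @nondecreasing_is_derive (fun t => E t * expR ((2 + M) * t))
    (fun t => ((2 * f t * f1 t + 2 * f1 t * (q t * f t + h t)) + (2 + M) * E t) * expR ((2 + M) * t)) y 0.
rewrite mulr0 expR0 E0 mulr1 => H.
have {}H : E y * expR ((2 + M) * y) <= eta ^+ 2.
  apply: H => z /andP[z0 zy]; first by derive_rule; ring.
  have /key : `|z| <= r by rewrite ler0_norm//; rewrite ler0_norm// in yr; lra.
  rewrite ler_norml /E => /andP[? _]; rewrite mulr_ge0 ?expR_ge0//; lra.
by rewrite ler0_norm// mulrN expRN ler_pdivlMr ?expR_gt0.
Qed.

End calculus2.

(** * Linear second order equations *)

Section ode.
Context {R : realType}.
Implicit Types (f g F G q : R -> R).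

(** Choosing a primitive makes the Picard map a function of [f]; the default is reached only when no
    primitive exists. *)
Definition primitive_at0 f : R -> R := xget (fun=> 0) [set F | F 0 = 0 /\ derives F f].

Lemma primitive_at0P f : continuous f -> primitive_at0 f 0 = 0 /\ derives (primitive_at0 f) f.
Proof.
move=> cf; have [F hF] := primitive_exists cf.
by rewrite /primitive_at0; case: xgetP => [? _ //|/(_ F)].
Qed.

(** The sequence x_n - 2c/2^n is nondecreasing and stays below the nonincreasing x_n + 2c/2^n, so
    the supremum of the first is within 2c/2^n of x_n. The explicit rate later gives local
    uniformity in y. *)
Lemma geometric_limit (x : nat -> R) (c : R) :
  (forall n, `|x n.+1 - x n| <= c / 2 ^+ n) ->
  exists l, forall n, `|l - x n| <= 2 * c / 2 ^+ n.
Proof.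
move=> h.
have p n : (2 : R) ^+ n != 0 by rewrite expf_neq0.
have step n : x n - 2 * c / 2 ^+ n <= x n.+1 - 2 * c / 2 ^+ n.+1 /\
   x n.+1 + 2 * c / 2 ^+ n.+1 <= x n + 2 * c / 2 ^+ n.
  have := h n; rewrite ler_norml => /andP[h1 h2].
  rewrite (_ : 2 * c / 2 ^+ n.+1 = c / 2 ^+ n); last by rewrite exprS; field.
  rewrite (_ : 2 * c / 2 ^+ n = 2 * (c / 2 ^+ n)); last by rewrite mulrA.
  by split; lra.
have c0 : 0 <= c by have := h 0; rewrite expr0 divr1; apply: le_trans.
have lo m n : (m <= n)%N -> x m - 2 * c / 2 ^+ m <= x n - 2 * c / 2 ^+ n.
  elim: n => [|n IH]; first by rewrite leqn0 => /eqP->.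
  by rewrite leq_eqVlt => /predU1P[->//|/IH /le_trans]; apply; case: (step n).
have hi m n : (m <= n)%N -> x n + 2 * c / 2 ^+ n <= x m + 2 * c / 2 ^+ m.
  elim: n => [|n IH]; first by rewrite leqn0 => /eqP->.
  by rewrite leq_eqVlt => /predU1P[->//|/IH]; apply: le_trans; case: (step n).
have pos n : 0 <= 2 * c / 2 ^+ n by rewrite divr_ge0// ?mulr_ge0// exprn_ge0.
have lohi m n : x m - 2 * c / 2 ^+ m <= x n + 2 * c / 2 ^+ n.
  have := lo m (maxn m n); have := hi n (maxn m n).
  by rewrite leq_maxl leq_maxr => /(_ isT) ? /(_ isT) ?; have := pos (maxn m n); lra.
pose S := range (fun n => x n - 2 * c / 2 ^+ n).
have hS : has_sup S.
  split; first by exists (x 0%N - 2 * c / 2 ^+ 0), 0%N.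
  by exists (x 0%N + 2 * c / 2 ^+ 0) => _ [n _ <-].
exists (sup S) => n; rewrite ler_norml; apply/andP; split.
  have : x n - 2 * c / 2 ^+ n <= sup S by apply: (ub_le_sup hS.2); exists n.
  lra.
have : sup S <= x n + 2 * c / 2 ^+ n.
  by apply: ge_sup; [exact: hS.1|] => _ [m _ <-].
lra.
Qed.

Section picard.
Variables (q : R -> R) (M a b : R).
Hypotheses (cq : continuous q) (qM : forall y, `|q y| <= M).

Let s1 f : R -> R := fun y => b + primitive_at0 (fun y => q y * f y) y.
Let s f : R -> R := fun y => a + b * y + primitive_at0 (primitive_at0 (fun y => q y * f y)) y.

(* w'' = K^2 w with 2 M <= K^2, so the Picard map s contracts by 1/2 in the sup
   norm weighted by w. *)
Let K := M + 1.
Let w (y : R) := expR (K * y) + expR (- K * y).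
Let w1 (y : R) := K * expR (K * y) - K * expR (- K * y).
Let w2 (y : R) := K ^+ 2 * w y.

Let M0 : 0 <= M. Proof. exact: le_trans (qM 0). Qed.

Let dw : derives w w1.
Proof. by move=> y; rewrite /w /w1; derive_rule; ring. Qed.

Let dw1 : derives w1 w2.
Proof. by move=> y; rewrite /w2 /w /w1; derive_rule; ring. Qed.

Let w_ge (y : R) : 1 + `|y| <= w y.
Proof.
have M0' := M0; rewrite /w mulNr; have [y0|y0] := ger0P y.
  have := expR_ge1Dx (K * y); have := expR_ge0 (- (K * y)).
  by have := mulr_ge0 M0' y0; rewrite /K; lra.
have := expR_ge1Dx (- (K * y)); have := expR_ge0 (K * y).
by have := mulr_ge0_le0 M0' (ltW y0); rewrite /K; lra.
Qed.

Let qf_cont f : continuous f -> continuous (fun y => q y * f y).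
Proof. by move=> cf y; apply: cvgM; [exact: cq|exact: cf]. Qed.

Let s_derives f : continuous f -> derives (s f) (s1 f).
Proof.
move=> cf; have [_ d1] := primitive_at0P (qf_cont cf); have [_ d2] := primitive_at0P (derives_continuous d1).
by move=> y; rewrite /s /s1; derive_rule; ring.
Qed.

Let s1_derives f : continuous f -> derives (s1 f) (fun y => q y * f y).
Proof.
by move=> cf; have [_ d1] := primitive_at0P (qf_cont cf); move=> y; rewrite /s1; derive_rule; ring.
Qed.

Let s0 f : continuous f -> s f 0 = a.
Proof.
move=> cf; have [_ d1] := primitive_at0P (qf_cont cf); have [e _] := primitive_at0P (derives_continuous d1).
by rewrite /s e; ring.
Qed.

Let s10 f : continuous f -> s1 f 0 = b.
Proof. by move=> cf; have [e _] := primitive_at0P (qf_cont cf); rewrite /s1 e addr0. Qed.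

Let s_diff f g (A : R) : 0 <= A -> continuous f -> continuous g ->
  (forall y, `|f y - g y| <= A * w y) -> forall y, `|s f y - s g y| <= A / 2 * w y.
Proof.
move=> A0 cf cg h y.
have H : forall y, `|s f y - s g y| <= A / 2 * (w y - w 0).
  have sf := s_derives cf; have sg := s_derives cg.
  have s1f := s1_derives cf; have s1g := s1_derives cg.
  apply: (@second_derivative_bound _ (fun t => s f t - s g t)
      (fun t => s1 f t - s1 g t) (fun t => q t * f t - q t * g t) w w1 w2) => //.
  - by move=> z; derive_rule.
  - by move=> z; derive_rule.
  - by rewrite !s0// subrr.
  - by rewrite !s10// subrr.
  - by rewrite /w1 !mulr0 subrr.
  - move=> z; rewrite -mulrBr normrM /w2 mulrCA.
    apply: (le_trans (ler_pM _ _ (qM z) (h z))) => //.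
    have := w_ge z; have := normr_ge0 z; rewrite /K => ? ?.
    have Aw : 0 <= A * w z by apply: mulr_ge0 => //; lra.
    by have := M0; have := sqr_ge0 M; nra.
apply: le_trans (H y) _; rewrite ler_wpM2l//; first lra.
by have := w_ge 0; rewrite normr0; lra.
Qed.

Let sn n : R -> R := iter n s (fun=> 0).

Let sn_cont n : continuous (sn n).
Proof. by elim: n => [|n IH]; [exact: cst_continuous|exact: derives_continuous (s_derives IH)]. Qed.

Let A := `|a| + `|b|.
Let A0 : 0 <= A. Proof. by rewrite addr_ge0. Qed.

Let sn_diff n y : `|sn n.+1 y - sn n y| <= A * w y / 2 ^+ n.
Proof.
elim: n y => [|n IH] y.
  rewrite expr0 divr1 /= subr0.
  (* The primitives in [s] are merely chosen ones, so that they vanish here has to be derived, from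
     [second_derivative_bound] with B = 0. *)
  have -> : s (fun=> 0) y = a + b * y.
    rewrite /s; have := @second_derivative_bound _ (primitive_at0 (primitive_at0 (fun y => q y * 0)))
      (primitive_at0 (fun y => q y * 0)) (fun y => q y * 0) w w1 w2 0.
    have c0 : continuous (fun y => q y * 0) by apply: qf_cont; exact: cst_continuous.
    have [e1 d1] := primitive_at0P c0; have [e2 d2] := primitive_at0P (derives_continuous d1).
    move=> /(_ d2 d1 dw dw1 e2 e1 _ _ y) H.
    suff : `|primitive_at0 (primitive_at0 (fun y => q y * 0)) y| <= 0 by rewrite normr_le0 => /eqP ->; ring.
    rewrite -[leRHS](mul0r (w y - w 0)); apply: H; first by rewrite /w1 !mulr0 subrr.
    by move=> z; rewrite mulr0 normr0 mul0r.
  apply: le_trans (ler_normD _ _) _; rewrite normrM.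
  have := w_ge y; have := normr_ge0 a; have := normr_ge0 b; have := normr_ge0 y.
  by rewrite /A; nra.
have := @s_diff (sn n.+1) (sn n) (A / 2 ^+ n) _ (@sn_cont _) (@sn_cont _) _ y.
have p : (2 : R) ^+ n != 0 by rewrite expf_neq0.
rewrite (_ : A / 2 ^+ n / 2 * w y = A * w y / 2 ^+ n.+1); last by rewrite exprS; field.
apply; first by rewrite divr_ge0// exprn_ge0.
by move=> z; rewrite mulrAC.
Qed.

(** The iterates converge pointwise with error 2 A w(y) / 2^n. Since [w] is continuous, convergence
    is locally uniform, so the limit is continuous and the Picard map can be applied to it. *)
Lemma ode_exists : exists u v : R -> R,
  [/\ u 0 = a, v 0 = b, derives u v & derives v (fun y => q y * u y)].
Proof.
have /choice[u hu] : forall y, exists l, forall n, `|l - sn n y| <= 2 * (A * w y) / 2 ^+ n.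
  by move=> y; apply: geometric_limit => n; exact: sn_diff.
have half e : 0 < e -> exists n, 1 / (2 : R) ^+ n < e.
  move=> e0; exists (Num.trunc e^-1).+1; rewrite div1r invf_plt ?posrE ?exprn_gt0//.
  apply: lt_trans (truncnS_gt _) _.
  by rewrite -natrX ltr_nat ltn_expl.
have cu : continuous u.
  move=> y; apply/cvgrPdist_lt => e e0.
  have W0 : 0 < 2 * A * (w y + 1) + 1.
    by have := w_ge y; have := A0; have := normr_ge0 y; nra.
  have [n hn] := half (e / 3 / (2 * A * (w y + 1) + 1)) ltac:(by rewrite !divr_gt0).
  have bnd z : w z <= w y + 1 -> `|u z - sn n z| < e / 3.
    move=> wz; apply: le_lt_trans (hu z n) _.
    move: hn; rewrite ltr_pdivlMr// => hn; apply: le_lt_trans hn.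
    rewrite div1r [leRHS]mulrC ler_wpM2r ?invr_ge0 ?exprn_ge0//.
    by have := A0; nra.
  near=> z.
  have : `|sn n y - sn n z| < e / 3.
    near: z; apply: cvgr_dist_lt; first exact: sn_cont.
    by rewrite divr_gt0.
  have /bnd : w z <= w y + 1.
    near: z; have /cvgr_dist_le/(_ 1 ltr01) := derives_continuous dw (x := y).
    apply: filterS => z; rewrite ler_norml; lra.
  have /bnd : w y <= w y + 1 by lra.
  by rewrite !ltr_norml; lra.
exists (s u), (s1 u); split; [exact: s0|exact: s10|exact: s_derives|].
suff e : s u = u by rewrite e; exact: s1_derives.
apply/funext => y.
(* Both sides are close to the iterate n + 1: [s u] by contraction, [u] by the rate of
   convergence. *)
have H n : `|s u y - u y| <= 3 * (A * w y) * (1 / 2 ^+ n).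
  have p : (2 : R) ^+ n != 0 by rewrite expf_neq0.
  have H1 : `|s u y - sn n.+1 y| <= 2 * A / 2 ^+ n / 2 * w y.
    apply: (s_diff _ cu (@sn_cont n)).
      by apply: divr_ge0; [apply: mulr_ge0; [exact: ler0n|exact: A0] | exact: exprn_ge0].
    by move=> z; apply: le_trans (hu z n) _; rewrite [leLHS](_ : _ = 2 * A / 2 ^+ n * w z)//; field.
  rewrite (_ : 2 * A / 2 ^+ n / 2 * w y = A * w y * (1 / 2 ^+ n)) in H1; last by field.
  have := hu y n.+1.
  rewrite (_ : 2 * (A * w y) / 2 ^+ n.+1 = A * w y * (1 / 2 ^+ n)); last first.
    by rewrite exprS; field.
  have P : 0 <= A * w y * (1 / 2 ^+ n).
    rewrite mulr_ge0 ?divr_ge0 ?exprn_ge0// mulr_ge0//.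
    by have := w_ge y; have := normr_ge0 y; lra.
  move: H1; rewrite !ler_norml; lra.
apply/eqP; rewrite -subr_eq0 -normr_le0 leNgt; apply/negP => e0.
have B0 : 0 < 3 * (A * w y) + 1.
  by have := w_ge y; have := A0; have := normr_ge0 y; nra.
have [n hn] := half (`|s u y - u y| / (3 * (A * w y) + 1)) ltac:(by rewrite divr_gt0).
move: hn; rewrite ltr_pdivlMr// => hn.
have : 0 < 1 / (2 : R) ^+ n by rewrite divr_gt0// exprn_gt0.
by have := H n; nra.
Unshelve. all: by end_near. Qed.

End picard.
End ode.

(** * Existence of a positive solution on the line *)

Section second_order.
Context {R : realType}.
Implicit Types (q u v g : R -> R).

Definition solves q u v := derives u v /\ derives v (fun y => q y * u y).

Lemma derives_shift u v (c : R) : derives u v ->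
  derives (fun y => u (y + c)) (fun y => v (y + c)).
Proof. by move=> du y; derive_rule; ring. Qed.

Lemma solves_shift q u v (c : R) : solves q u v ->
  solves (fun y => q (y + c)) (fun y => u (y + c)) (fun y => v (y + c)).
Proof. by case=> du dv; split; [exact: derives_shift|move=> y; derive_rule; ring]. Qed.

Lemma solves_lin q u1 v1 u2 v2 (a b : R) : solves q u1 v1 -> solves q u2 v2 ->
  solves q (fun y => a * u1 y + b * u2 y) (fun y => a * v1 y + b * v2 y).
Proof. by move=> [? ?] [? ?]; split => y; derive_rule; ring. Qed.

Lemma solves_cont q u v : solves q u v -> continuous u /\ continuous v.
Proof. by case=> du dv; split; [exact: derives_continuous du|exact: derives_continuous dv]. Qed.

Lemma solves_uniq0 q u v (M : R) : (forall y, `|q y| <= M) -> solves q u v ->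
  u 0 = 0 -> v 0 = 0 -> forall y, u y = 0 /\ v y = 0.
Proof.
move=> qM [du dv] u0 v0 y.
have := @energy_bound _ u v q (fun=> 0) M 0 `|y| (normr_ge0 y) du _ u0 v0 _ _ y (lexx _).
rewrite expr0n /= mul0r => H.
have {}H : u y ^+ 2 + v y ^+ 2 <= 0.
  by apply: H => [z|//|z _]; [derive_rule; rewrite addr0|rewrite normr0].
have := sqr_ge0 (u y); have := sqr_ge0 (v y) => v2 u2.
by split; apply/eqP; rewrite -sqrf_eq0 eq_le; apply/andP; split; lra.
Qed.

Lemma solves_uniq q u v (M y0 : R) : (forall y, `|q y| <= M) -> solves q u v ->
  u y0 = 0 -> v y0 = 0 -> forall y, u y = 0 /\ v y = 0.
Proof.
move=> qM s u0 v0 y.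
have := @solves_uniq0 _ _ _ M _ (solves_shift y0 s).
rewrite add0r => /(_ (fun z => qM _) u0 v0 (y - y0)).
by rewrite subrK.
Qed.

Lemma derive_gt0_local u v (y : R) : derives u v -> continuous v -> 0 < v y ->
  exists2 d, 0 < d & forall z, (y - d < z < y -> u z < u y) /\ (y < z < y + d -> u y < u z).
Proof.
move=> du cv vy.
have /cvgr_dist_lt/(_ _ vy)[d /= d0 hd] := cv y.
have pos z : `|y - z| < d -> 0 < v z by move=> /hd; rewrite /= ltr_norml; lra.
have mvt a b : a < b -> (forall z, a <= z <= b -> 0 < v z) -> u a < u b.
  move=> ab h; have [||c cab E] := MVT ab (f := u) (df := v).
  - by move=> x _; exact: du.
  - by apply: continuous_within; exact: derives_continuous du.
  move: cab; rewrite in_itv /= => /andP[/ltW ac /ltW cb].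
  by rewrite -subr_gt0 E mulr_gt0 ?subr_gt0// h// ac.
exists d => // z; split => /andP[h1 h2]; apply: mvt => // t ?; apply: pos;
  rewrite ltr_norml; lra.
Qed.

Lemma nonneg_zero_derive q u v (y : R) : solves q u v -> (forall z, 0 <= u z) ->
  u y = 0 -> v y = 0.
Proof.
move=> s u0 uy; have [cu cv] := solves_cont s; case: s => du dv.
have [||//] := ltgtP (v y) 0 => vy; exfalso.
  have [d d0 /(_ (y + d / 2))[_ h]] := @derive_gt0_local (fun t => - u t) (fun t => - v t) y
    (fun t => is_derive_fopp (du t)) (fun t => cvgN (cv t)) ltac:(by rewrite oppr_gt0).
  by have := u0 (y + d / 2); have := h ltac:(lra); lra.
have [d d0 /(_ (y - d / 2))[h _]] := derive_gt0_local du cv vy.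
by have := u0 (y - d / 2); have := h ltac:(lra); lra.
Qed.

(* With K = k^2 and mu = 1 / lambda, u'' = hill K g mu u is the eigenvalue
   equation for cos(kx) (u - u''/k^2). *)
Definition hill (K : R) g (mu : R) : R -> R := fun y => K * (1 - mu * g y).

Section param.
Variables (g : R -> R) (G K : R).
Hypotheses (cg : continuous g) (gG : forall y, `|g y| <= G).

Lemma hill_cont mu : continuous (hill K g mu).
Proof.
move=> y; apply: cvgM; first exact: cvg_cst.
by apply: cvgB; [exact: cvg_cst|apply: cvgM; [exact: cvg_cst|exact: cg]].
Qed.

Lemma hill_bound mu m y : `|mu| <= m -> `|hill K g mu y| <= `|K| * (1 + m * G).
Proof.
move=> h; rewrite /hill normrM ler_wpM2l//.
apply: le_trans (ler_normB _ _) _; rewrite normr1 lerD2l normrM.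
exact: ler_pM.
Qed.

(** The difference of two solutions with the same data has zero data and solves an equation forced
    by (hill mu - hill mu0) u_mu0, which is of order |mu - mu0| on bounded sets. [energy_bound] then
    gives locally uniform dependence on mu. *)
Lemma solves_param (a b : R) : exists u v : R -> R -> R,
  [/\ forall mu, solves (hill K g mu) (u mu) (v mu),
      forall mu, u mu 0 = a, forall mu, v mu 0 = b &
      forall r mu0 e : R, 0 < e -> exists2 d, 0 < d & forall mu, `|mu - mu0| < d ->
        forall y, `|y| <= r -> `|u mu y - u mu0 y| <= e /\ `|v mu y - v mu0 y| <= e].
Proof.
have /choice[u /choice[v H]] : forall mu, exists u, exists v,
    [/\ u 0 = a, v 0 = b, derives u v & derives v (fun y => hill K g mu y * u y)].
  by move=> mu; apply: ode_exists; [exact: hill_cont|move=> y; exact: (@hill_bound _ `|mu|)].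
exists u, v; split; [by move=> mu; case: (H mu)..|].
move=> r mu0 e e0.
have [r0|r0] := ltP r 0.
  by exists 1 => // mu _ y yr; have := normr_ge0 y; lra.
have sm mu : solves (hill K g mu) (u mu) (v mu) by case: (H mu).
have [B hB] : exists B, forall y, `|y| <= r -> `|u mu0 y| <= B.
  have [||c _ hc] := @EVT_max R (fun y => `|u mu0 y|) (- r) r.
  - by lra.
  - apply: continuous_within => y; apply: cvg_norm; exact: (solves_cont (sm mu0)).1.
  by exists `|u mu0 c| => y; rewrite ler_norml => yr; apply: hc; rewrite in_itv.
have B0 : 0 <= B by apply: le_trans (hB 0 _); rewrite ?normr0.
have G0 : 0 <= G by apply: le_trans (gG 0).
pose M := `|K| * (1 + (`|mu0| + 1) * G).
pose X := expR ((2 + M) * r).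
have M0 : 0 <= M by rewrite mulr_ge0// addr_ge0// mulr_ge0// addr_ge0.
have X1 : 1 <= X by rewrite -expR0 ler_expR mulr_ge0//; lra.
pose c := `|K| * G * B + 1.
have c0 : 0 < c by rewrite ltr_wpDl// !mulr_ge0.
(* The bound 1 keeps |mu| <= |mu0| + 1, so that [M] bounds the coefficient; the other one gives eta
   X <= e. *)
pose d := Num.min 1 (e / (c * X)).
have d0 : 0 < d by rewrite lt_min ltr01 divr_gt0// mulr_gt0//; lra.
exists d => // mu hmu y yr.
have dmu : `|mu - mu0| * (c * X) <= e.
  rewrite -ler_pdivlMr ?mulr_gt0//; last lra.
  by apply/ltW; move: hmu; rewrite lt_min => /andP[].
have mub : `|mu| <= `|mu0| + 1.
  have := ler_normD (mu - mu0) mu0; rewrite subrK.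
  by move: hmu; rewrite lt_min => /andP[? _]; lra.
pose eta := `|mu - mu0| * c.
have [du dv] := sm mu; have [du0 dv0] := sm mu0.
have [u0 v0 _ _] := H mu; have [u00 v00 _ _] := H mu0.
have := @energy_bound _ (fun t => u mu t - u mu0 t) (fun t => v mu t - v mu0 t)
  (hill K g mu) (fun t => (hill K g mu t - hill K g mu0 t) * u mu0 t) M eta r r0.
rewrite u0 v0 u00 v00 !subrr => /(_ _ _ erefl erefl _ _ y yr) E.
have {}E : (u mu y - u mu0 y) ^+ 2 + (v mu y - v mu0 y) ^+ 2 <= eta ^+ 2 * X.
  apply: E.
  - by move=> z; derive_rule.
  - by move=> z; derive_rule; ring.
  - by move=> z _; exact: hill_bound.
  - move=> z zr; rewrite /hill.
    rewrite (_ : (_ - _) * _ = - ((mu - mu0) * (K * g z * u mu0 z))); last by ring.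
    rewrite normrN normrM ler_wpM2l// !normrM /c ler_wpDr//.
    apply: ler_pM; rewrite ?mulr_ge0 ?hB // ler_wpM2l //.
have eX : eta ^+ 2 * X <= e ^+ 2.
  apply: (@le_trans _ _ ((eta * X) ^+ 2)).
    by rewrite [(eta * X) ^+ 2]exprMn ler_wpM2l ?sqr_ge0// expr2 ler_peMl//; lra.
  have h : eta * X <= e by rewrite /eta -mulrA.
  have : 0 <= eta * X by rewrite mulr_ge0//; [rewrite mulr_ge0// ltW|lra].
  by nra.
have := sqr_ge0 (u mu y - u mu0 y); have := sqr_ge0 (v mu y - v mu0 y) => ? ?.
by split; rewrite ler_norml; apply/andP; split; nra.
Qed.

End param.
End second_order.

(** * Neumann shooting on a bounded interval *)

Section ground_state.
Context {R : realType}.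
Implicit Types (q u v g : R -> R).

Lemma continuous_pos_of_neq0 u (a b : R) : continuous u -> a <= b -> 0 < u a ->
  (forall y, a <= y <= b -> u y != 0) -> 0 < u b.
Proof.
move=> cu ab ua hz; rewrite ltNge; apply/negP => ub.
have [||c] := @IVT R u a b 0 ab; first exact: continuous_within.
  by rewrite minC maxC /Num.min /Num.max; case: ifP => h; rewrite ?ub ?(ltW ua)//;
    have := le_lt_trans ub ua; rewrite h.
by rewrite in_itv /= => /hz/eqP.
Qed.

(** (u v)' = v^2 + q u^2 >= 0 gives u v >= 0, so u^2 is nondecreasing from 1 and u cannot reach
    0. *)
Lemma solves_pos q u v (L : R) : solves q u v -> (forall y, 0 < q y) -> 0 < L ->
  u 0 = 1 -> v 0 = 0 -> (forall y, 0 <= y -> 0 < u y) /\ 0 < v L.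
Proof.
move=> s q0 L0 u0 v0; have [cu cv] := solves_cont s; case: (s) => du dv.
have uv y : 0 <= y -> 0 <= u y * v y.
  move=> y0; suff : u 0 * v 0 <= u y * v y by rewrite v0 mulr0.
  apply: (@nondecreasing_derives _ (fun t => u t * v t) (fun t => v t ^+ 2 + q t * u t ^+ 2)) => //.
    by move=> z; derive_rule; ring.
  by move=> z _; rewrite addr_ge0 ?sqr_ge0// mulr_ge0 ?sqr_ge0// ltW.
have u1 y : 0 <= y -> 1 <= u y ^+ 2.
  move=> y0; suff : u 0 ^+ 2 <= u y ^+ 2 by rewrite u0 expr1n.
  apply: (@nondecreasing_derives _ (fun t => u t ^+ 2) (fun t => 2 * (u t * v t))) => //.
    by move=> z; derive_rule; ring.
  by move=> z /andP[z0 _]; rewrite mulr_ge0// uv.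
have up y : 0 <= y -> 0 < u y.
  move=> y0; apply: (continuous_pos_of_neq0 cu y0); first by rewrite u0.
  move=> z /andP[z0 _]; apply/eqP => uz; have := u1 z z0.
  by rewrite uz expr0n /=; lra.
split => //.
have [||c cab E] := MVT L0 (f := v) (df := fun y => q y * u y).
- by move=> x _; exact: dv.
- exact: continuous_within.
move: cab; rewrite in_itv /= => /andP[c0 _].
by move: E; rewrite v0 !subr0 => ->; rewrite !mulr_gt0// up// ltW.
Qed.

Section shooting.
Variables (g : R -> R) (G K : R).
Hypotheses (cg : continuous g) (gG : forall y, `|g y| <= G).

(* Neumann shooting: at the first mu where the solution with data (1, 0) stops
   being positive and increasing at L, its derivative at L vanishes. *)
Lemma shooting (L mu1 mu0 : R) : 0 < L -> mu1 <= mu0 ->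
  (forall y, 0 < hill K g mu1 y) ->
  (forall u v, solves (hill K g mu0) u v -> ~ (forall y, 0 <= y <= L -> 0 < u y)) ->
  exists mu, exists u, exists v, [/\ mu1 <= mu <= mu0, solves (hill K g mu) u v,
    forall y, 0 <= y <= L -> 0 < u y, v 0 = 0 & v L = 0].
Proof.
move=> L0 mu10 q1 q0.
have [u [v [s u0 v0 cont]]] := solves_param K cg gG 1 0.
pose good mu := (forall y, 0 <= y <= L -> 0 < u mu y) /\ 0 < v mu L.
have good1 : good mu1.
  have [h1 h2] := solves_pos (s mu1) q1 L0 (u0 _) (v0 _).
  by split => // y /andP[/h1].
have good_open mu : good mu -> exists2 d, 0 < d & forall mu', `|mu' - mu| < d -> good mu'.
  move=> [gu gv].
  have [||c] := @EVT_min R (u mu) 0 L; [exact: ltW|by apply: continuous_within; case: (solves_cont (s mu))|].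
  rewrite in_itv /= => /gu uc hc.
  pose e := Num.min (u mu c) (v mu L) / 2.
  have e0 : 0 < e by rewrite divr_gt0// lt_min uc.
  have [eu ev] : e < u mu c /\ e < v mu L.
    have m1 : Num.min (u mu c) (v mu L) <= u mu c by rewrite ge_min lexx.
    have m2 : Num.min (u mu c) (v mu L) <= v mu L by rewrite ge_min lexx orbT.
    by move: e0; rewrite /e => ?; split; lra.
  have [d d0 hd] := cont L mu e e0.
  exists d => // mu' /hd h; split => [y /andP[y0 yL]|].
    have /h[] : `|y| <= L by rewrite ger0_norm.
    have := hc y; rewrite in_itv /= y0 yL => /(_ isT).
    by rewrite ler_norml; lra.
  have /h[_] : `|L| <= L by rewrite ger0_norm// ltW.
  by rewrite ler_norml; lra.
pose B := [set mu | mu1 <= mu <= mu0 /\ ~ good mu].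
have hB : has_inf B.
  split; last by exists mu1 => mu [/andP[]].
  exists mu0; split; first by rewrite mu10 lexx.
  by case=> h _; exact: (q0 _ _ (s mu0)).
pose m := inf B.
have m1 : mu1 <= m by apply: (lb_le_inf hB.1) => mu [/andP[]].
have m0 : m <= mu0.
  apply: (ge_inf hB.2); split; first by rewrite mu10 lexx.
  by case=> h _; exact: (q0 _ _ (s mu0)).
(* [good] is an open condition, so the infimum of the bad parameters is itself bad. Parameters just
   below it are good, which gives the weak inequalities at [m]. *)
have Nm : ~ good m.
  move=> /good_open[d d0 hd].
  have [mu Bmu mud] := inf_adherent d0 hB.
  have mmu : m <= mu := ge_inf hB.2 Bmu.
  by apply: (Bmu.2); apply: hd; rewrite ger0_norm ?subr_ge0// ltrBlDl.
have m1' : mu1 < m by rewrite lt_neqAle m1 andbT; apply/eqP => e; apply: Nm; rewrite -e.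
have appr e : 0 < e -> exists2 mu, `|mu - m| < e & good mu.
  move=> e0; pose mu := Num.max mu1 (m - e / 2).
  have mum : mu < m by rewrite gt_max m1'/=; lra.
  have h1 : mu1 <= mu by rewrite le_max lexx.
  have h2 : m - e / 2 <= mu by rewrite le_max lexx orbT.
  exists mu; first by rewrite ltr_norml; apply/andP; split; lra.
  apply: contrapT => Ng; suff : m <= mu by lra.
  by apply: (ge_inf hB.2); split => //; rewrite h1 /=; lra.
have um y : 0 <= y <= L -> 0 <= u m y.
  move=> /andP[y0 yL]; rewrite leNgt; apply/negP => uy.
  have [d d0 hd] := cont L m (- u m y / 2) ltac:(by lra).
  have [mu /hd hmu [gu _]] := appr d d0.
  have /hmu[] : `|y| <= L by rewrite ger0_norm.
  by have := gu y; rewrite y0 yL => /(_ isT); rewrite ler_norml; lra.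
have vL : 0 <= v m L.
  rewrite leNgt; apply/negP => vy.
  have [d d0 hd] := cont L m (- v m L / 2) ltac:(by lra).
  have [mu /hd hmu [_ gv]] := appr d d0.
  have /hmu[_] : `|L| <= L by rewrite ger0_norm// ltW.
  by rewrite ler_norml; lra.
have [cu cv] := solves_cont (s m).
have qb := fun y => hill_bound K gG y (lexx `|m|).
have nz y : ~ (u m y = 0 /\ v m y = 0).
  move=> [uy vy]; have [] := solves_uniq qb (s m) uy vy 0.
  by rewrite u0 => /eqP; rewrite oner_eq0.
(* At a zero of [u m] the derivative is nonzero by uniqueness, and either sign makes [u m] negative
   nearby inside [0, L]. The endpoints cause no trouble: u(0) = 1, and a negative derivative at L is
   excluded by [vL]. *)
have upos y : 0 <= y <= L -> 0 < u m y.
  move=> yL; rewrite lt_neqAle um// andbT eq_sym; apply/eqP => uy.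
  have y0 : 0 < y.
    move: yL => /andP[]; rewrite le_eqVlt => /predU1P[y0 _|//].
    by move: uy; rewrite -y0 u0 => /eqP; rewrite oner_eq0.
  have y1 : y <= L by move: yL => /andP[].
  have [vy|vy|vy] := ltgtP (v m y) 0; last by apply: (nz y).
  - have [d d0 hd] := @derive_gt0_local _ (fun t => - u m t) (fun t => - v m t) y
      (fun t => is_derive_fopp ((s m).1 t)) (fun t => cvgN (cv t)) ltac:(by rewrite oppr_gt0).
    move: y1; rewrite le_eqVlt => /predU1P[yL'|yL'].
      by move: vL; rewrite -yL'; lra.
    pose z := Num.min L (y + d / 2).
    have zy : y < z by rewrite lt_min yL' /=; lra.
    have zL : z <= L by rewrite ge_min lexx.
    have zd : z <= y + d / 2 by rewrite ge_min lexx orbT.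
    have [_ /(_ ltac:(lra))] := hd z.
    have := um z ltac:(lra); lra.
  - have [d d0 hd] := derive_gt0_local (s m).1 cv vy.
    pose z := Num.max 0 (y - d / 2).
    have zy : z < y by rewrite gt_max y0 /=; lra.
    have z0 : 0 <= z by rewrite le_max lexx.
    have zd : y - d / 2 <= z by rewrite le_max lexx orbT.
    have [/(_ ltac:(lra)) + _] := hd z.
    have := um z ltac:(lra); lra.
exists m, (u m), (v m); split => //; first by rewrite m1.
(* A positive derivative at L would make [m] good. *)
by have [||//] := ltgtP (v m L) 0; [lra|move=> vL0; exfalso; apply: Nm].
Qed.

End shooting.
End ground_state.

(** * From bounded intervals to the line *)

Section ground_state_line.
Context {R : realType}.
Implicit Types (q u v g : R -> R).

(* Sturm comparison with sin (w (y - a)). *)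
Lemma sturm_zero q u v (a w : R) : solves q u v -> 0 < w ->
  (forall y, a <= y <= a + pi / w -> q y <= - w ^+ 2) ->
  ~ (forall y, a <= y <= a + pi / w -> 0 < u y).
Proof.
move=> [du dv] w0 hq hu.
pose b := a + pi / w.
have ab : a <= b by rewrite lerDl divr_ge0 ?pi_ge0// ltW.
(* This Wronskian is nondecreasing where [u] is positive, yet it equals w u(a) > 0 at the left end
   and -w u(b) < 0 at the right end. *)
have := @nondecreasing_derives _ (fun t => w * u t * cos (w * (t - a)) - v t * sin (w * (t - a)))
  (fun t => - (w ^+ 2 + q t) * u t * sin (w * (t - a))) a b _ ab _.
rewrite subrr mulr0 cos0 sin0 !mulr0 mulr1 subr0.
rewrite (_ : w * (b - a) = pi); last by rewrite /b; field; rewrite gt_eqF.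
rewrite cospi sinpi mulr0 subr0 mulrN1 => H.
have ua := hu a; have ub := hu b.
move: ua ub; rewrite !lexx !ab => /(_ isT) ua /(_ isT) ub.
have : w * u a <= - (w * u b).
  apply: H => y; first by derive_rule; ring.
  move=> yab; have /andP[ay yb] := yab.
  rewrite -mulrA mulr_ge0//; first by have := hq y yab; lra.
  apply: mulr_ge0; first exact/ltW/hu.
  apply: sin_ge0_pi; rewrite mulr_ge0 ?(ltW w0) ?subr_ge0//=.
  rewrite -ler_pdivlMl// mulrC; move: yb; rewrite /b; lra.
have := mulr_gt0 w0 ua; have := mulr_gt0 w0 ub; lra.
Qed.

Lemma cluster_closed (T : topologicalType) (x : nat -> T) (p : T) (D : set T) :
  closed D -> (\forall n \near \oo, D (x n)) -> cluster (x n @[n --> \oo]) p -> D p.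
Proof.
by move=> cD xD cl; apply: cD => B Bp; exact: cl.
Qed.

Variables (g : R -> R) (G K : R).
Hypotheses (cg : continuous g) (gG : forall y, `|g y| <= G).

(** Shooting takes place on [0, 2n] and is translated to [-n, n]. Beyond [Y] the coefficient is
    nonnegative, so [v] is nondecreasing there, and its vanishing at both ends fixes its sign. *)
Lemma neumann_ground (mu1 mu0 Y r : R) n : mu1 <= mu0 -> 0 <= Y -> Y < n%:R -> r < n%:R -> (0 < n)%N ->
  (forall y, 0 < hill K g mu1 y) ->
  (forall mu y, mu1 <= mu <= mu0 -> Y <= `|y| -> 0 <= hill K g mu y) ->
  (forall u v, solves (hill K g mu0) u v -> ~ (forall y, `|y| <= r -> 0 < u y)) ->
  exists mu, exists u, exists v, [/\ mu1 <= mu <= mu0, solves (hill K g mu) u v,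
    forall y, `|y| <= n%:R -> 0 < u y,
    forall y, Y <= y <= n%:R -> v y <= 0 &
    forall y, Y <= - y <= n%:R -> 0 <= v y].
Proof.
move=> mu10 Y0 Yn rn n0 q1 qY q0.
pose gn y := g (y + - n%:R).
have cgn : continuous gn.
  have : continuous (g \o (fun y => y + - n%:R)); last by [].
  move=> y; apply: continuous_comp; last exact: cg.
  by apply: cvgD; [exact: cvg_id|exact: cvg_cst].
have n0' : 0 < n%:R :> R by rewrite ltr0n.
have back u v mu : solves (hill K gn mu) u v ->
    solves (hill K g mu) (fun y => u (y + n%:R)) (fun y => v (y + n%:R)).
  move=> /(solves_shift n%:R); congr solves; apply/funext => y.
  by rewrite /hill /gn addrK.
have [|||u v s0 up|mu [u [v [muI s up v0 vL]]]] :=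
    @shooting R gn G K cgn (fun y => gG _) (n%:R + n%:R) mu1 mu0.
- by rewrite addr_gt0.
- exact: mu10.
- by move=> y; exact: q1.
- apply: (q0 _ _ (back _ _ _ s0)) => y yr; apply: up.
  by move: yr; rewrite ler_norml; lra.
exists mu, (fun y => u (y + n%:R)), (fun y => v (y + n%:R)).
have [du dv] := back _ _ _ s.
have up' y : `|y| <= n%:R -> 0 < u (y + n%:R).
  by rewrite ler_norml => yn; apply: up; lra.
split; [exact: muI|exact: (back _ _ _ s)|exact: up'| |].
- move=> y /andP[Yy yn]; rewrite -vL.
  apply: (nondecreasing_derives dv yn) => z /andP[yz zn].
  apply: mulr_ge0; last by apply/ltW/up'; rewrite ler_norml; lra.
  by apply: qY => //; apply: (le_trans _ (ler_norm z)); lra.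
- move=> y /andP[Yy yn]; rewrite -v0 -(addNr n%:R).
  have yn' : - n%:R <= y by lra.
  apply: (nondecreasing_derives dv yn') => z /andP[yz zn].
  apply: mulr_ge0; last by apply/ltW/up'; rewrite ler_norml; lra.
  by apply: qY => //; rewrite -normrN; apply: (le_trans _ (ler_norm (- z))); lra.
Qed.

(** By linearity a normalised solution is a point (mu, u(0), v(0)) of a compact box. The conditions
    to be kept are closed in this point once strict positivity is relaxed, and uniqueness restores
    strictness in the limit. *)
Lemma ground_exists (mu1 mu0 Y r : R) : mu1 <= mu0 -> 0 <= Y ->
  (forall y, 0 < hill K g mu1 y) ->
  (forall mu y, mu1 <= mu <= mu0 -> Y <= `|y| -> 0 <= hill K g mu y) ->
  (forall u v, solves (hill K g mu0) u v -> ~ (forall y, `|y| <= r -> 0 < u y)) ->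
  exists mu, exists u, exists v, [/\ mu1 <= mu <= mu0, solves (hill K g mu) u v,
    forall y, 0 < u y, forall y, Y <= y -> v y <= 0 & forall y, y <= - Y -> 0 <= v y].
Proof.
move=> mu10 Y0 q1 qY q0.
have [U [V [sU U0 V0 contU]]] := solves_param K cg gG 1 0.
have [U' [V' [sU' U'0 V'0 contU']]] := solves_param K cg gG 0 1.
pose W (p : R * (R * R)) y := p.2.1 * U p.1 y + p.2.2 * U' p.1 y.
pose Z (p : R * (R * R)) y := p.2.1 * V p.1 y + p.2.2 * V' p.1 y.
have sW p : solves (hill K g p.1) (W p) (Z p) := solves_lin _ _ (sU _) (sU' _).
pose N := (Num.trunc (Num.max Y r)).+1.
have NP n : (N <= n)%N -> Y < n%:R /\ r < n%:R.
  move=> Nn; have h : Num.max Y r < n%:R.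
    by apply: lt_le_trans (truncnS_gt _) _; rewrite ler_nat.
  by move: h; rewrite gt_max => /andP[].
pose P n (p : R * (R * R)) := [/\ mu1 <= p.1 <= mu0, p.2.1 ^+ 2 + p.2.2 ^+ 2 = 1,
    forall y, `|y| <= n%:R -> 0 <= W p y,
    forall y, Y <= y <= n%:R -> Z p y <= 0 &
    forall y, Y <= - y <= n%:R -> 0 <= Z p y].
have /choice[x hx] : forall n, exists p, (N <= n)%N -> P n p.
  (* Below [N] the interval [-n, n] may be too short for the construction, and the point is
     arbitrary. *)
  move=> n; have [Nn|] := leqP N n; last by exists (0, (0, 0)); lia.
  have [Yn rn] := NP n Nn.
  have [|mu [u [v [muI s up vr vl]]]] := neumann_ground mu10 Y0 Yn rn _ q1 qY q0; first by lia.
  pose d := Num.sqrt (u 0 ^+ 2 + v 0 ^+ 2).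
  have u0 : 0 < u 0 by apply: up; rewrite normr0.
  have d2 : 0 < u 0 ^+ 2 + v 0 ^+ 2 by rewrite ltr_wpDr ?sqr_ge0// exprn_gt0.
  have d0 : 0 < d by rewrite sqrtr_gt0.
  exists (mu, (u 0 / d, v 0 / d)) => _.
  have E y : W (mu, (u 0 / d, v 0 / d)) y = u y / d /\ Z (mu, (u 0 / d, v 0 / d)) y = v y / d.
    have := solves_uniq0 (fun y => hill_bound K gG y (lexx `|mu|))
      (solves_lin d^-1 (-1) s (sW (mu, (u 0 / d, v 0 / d)))).
    rewrite /W /Z /= !U0 !U'0 !V0 !V'0 => /(_ _ _ y)[||h1 h2]; [by ring|by ring|].
    by split; lra.
  split => //=.
  - rewrite !expr_div_n sqr_sqrtr ?(ltW d2)//; field; rewrite gt_eqF//.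
  - by move=> y yn; rewrite (E y).1 divr_ge0// ltW ?up.
  - by move=> y yn; rewrite (E y).2 pmulr_lle0 ?invr_gt0// vr.
  - by move=> y yn; rewrite (E y).2 divr_ge0// ?vl// ltW.
pose C := `[mu1, mu0] `*` (`[-1, 1] `*` `[-1, 1]) : set (R * (R * R)).
have cC : compact C.
  by apply: compact_setX; [|apply: compact_setX]; exact: segment_compact.
have xN (Q : nat -> Prop) : (exists m, forall n, (N <= n)%N -> (m <= n)%N -> Q n) ->
    \forall n \near \oo, Q n.
  move=> [m hm]; exists (maxn N m) => // n /=; rewrite geq_max => /andP[? ?]; exact: hm.
have xC : (x n @[n --> \oo]) C.
  apply: xN; exists 0%N => n Nn _; have [h1 h2 _ _ _] := hx n Nn.
  split; first by rewrite /= in_itv.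
  have := sqr_ge0 (x n).2.1; have := sqr_ge0 (x n).2.2.
  by split => /=; rewrite in_itv /=; apply/andP; split; nra.
have [p [Cp clp]] := cC _ _ xC.
have contp (A : R -> R -> R) y :
   (forall r mu0 e : R, 0 < e -> exists2 d, 0 < d & forall mu, `|mu - mu0| < d ->
        forall y, `|y| <= r -> `|A mu y - A mu0 y| <= e) ->
   continuous (fun p : R * (R * R) => A p.1 y).
  move=> hA; have : continuous ((fun mu => A mu y) \o (fst : R * (R * R) -> R)); last by [].
  move=> z; apply: continuous_comp; first exact: cvg_fst.
  apply/cvgrPdist_le => e e0; have [d d0 hd] := hA `|y| z.1 e e0.
  exists d => //= mu; rewrite /= => h.
  by rewrite distrC; apply: (hd mu) => //; rewrite distrC.
have contU1 y : continuous (fun p : R * (R * R) => U p.1 y).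
  by apply: contp => r' m e /(contU r' m)[d d0 hd]; exists d => // mu /hd h z /h[].
have contU'1 y : continuous (fun p : R * (R * R) => U' p.1 y).
  by apply: contp => r' m e /(contU' r' m)[d d0 hd]; exists d => // mu /hd h z /h[].
have contV1 y : continuous (fun p : R * (R * R) => V p.1 y).
  by apply: contp => r' m e /(contU r' m)[d d0 hd]; exists d => // mu /hd h z /h[].
have contV'1 y : continuous (fun p : R * (R * R) => V' p.1 y).
  by apply: contp => r' m e /(contU' r' m)[d d0 hd]; exists d => // mu /hd h z /h[].
have c1 : continuous (fun p : R * (R * R) => p.2.1).
  have : continuous ((fst : R * R -> R) \o (snd : R * (R * R) -> R * R)); last by [].
  by move=> z; apply: continuous_comp; [exact: cvg_snd|exact: cvg_fst].
have c2 : continuous (fun p : R * (R * R) => p.2.2).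
  have : continuous ((snd : R * R -> R) \o (snd : R * (R * R) -> R * R)); last by [].
  by move=> z; apply: continuous_comp; [exact: cvg_snd|exact: cvg_snd].
have contW y : continuous (fun p => W p y).
  by move=> z; apply: cvgD; apply: cvgM; [exact: c1|exact: contU1|exact: c2|exact: contU'1].
have contZ y : continuous (fun p => Z p y).
  by move=> z; apply: cvgD; apply: cvgM; [exact: c1|exact: contV1|exact: c2|exact: contV'1].
have arch (y : R) : exists m, forall n, (m <= n)%N -> `|y| <= n%:R.
  exists (Num.trunc `|y|).+1 => n mn; apply/ltW; apply: lt_le_trans (truncnS_gt _) _.
  by rewrite ler_nat.
have ge0cl (f : R * (R * R) -> R) : continuous f ->
    (exists m, forall n, (N <= n)%N -> (m <= n)%N -> 0 <= f (x n)) -> 0 <= f p.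
  move=> cf hf; apply: (@cluster_closed _ x p [set z | 0 <= f z]) => //.
    by apply: (@closed_comp _ _ f [set t | 0 <= t]) => [z _|]; [exact: cf|exact: closed_ge].
  exact: xN.
have Wp y : 0 <= W p y.
  apply: (ge0cl (fun p => W p y)) => //; have [m hm] := arch y.
  by exists m => n Nn mn; have [_ _ h _ _] := hx n Nn; apply/h/hm.
have Zr y : Y <= y -> Z p y <= 0.
  move=> Yy; rewrite -oppr_ge0.
  apply: (ge0cl (fun p => - Z p y)) => [z|]; first by apply: cvgN; exact: contZ.
  have [m hm] := arch y.
  exists m => n Nn mn; have [_ _ _ h _] := hx n Nn; rewrite oppr_ge0; apply: h.
  by rewrite Yy (le_trans (ler_norm y))// hm.
have Zl y : y <= - Y -> 0 <= Z p y.
  move=> Yy; apply: (ge0cl (fun p => Z p y)) => //.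
  have [m hm] := arch y.
  exists m => n Nn mn; have [_ _ _ _ h] := hx n Nn; apply: h.
  by rewrite -normrN in hm; have := le_trans (ler_norm (-y)) (hm n mn); lra.
have nrm : p.2.1 ^+ 2 + p.2.2 ^+ 2 = 1.
  have cn : continuous (fun p : R * (R * R) => p.2.1 ^+ 2 + p.2.2 ^+ 2 - 1).
    move=> z; apply: cvgB; last exact: cvg_cst.
    by apply: cvgD; rewrite expr2; apply: cvgM; [exact: c1..|exact: c2|exact: c2].
  apply/eqP; rewrite eq_le -subr_le0 -oppr_ge0 -(subr_ge0 1); apply/andP; split.
    apply: (ge0cl (fun p => - (p.2.1 ^+ 2 + p.2.2 ^+ 2 - 1))) => [z|].
      by apply: cvgN; exact: cn.
    by exists 0%N => n Nn _; have [_ -> _ _ _] := hx n Nn; rewrite subrr oppr0.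
  apply: (ge0cl (fun p => p.2.1 ^+ 2 + p.2.2 ^+ 2 - 1)) => //.
  by exists 0%N => n Nn _; have [_ -> _ _ _] := hx n Nn; rewrite subrr.
exists p.1, (W p), (Z p); split => //.
- by case: Cp => /=; rewrite in_itv.
(* A zero of the nonnegative limit would be a double zero, hence the data at 0 would vanish, against
   the unit norm [nrm]. *)
- move=> y; rewrite lt_neqAle Wp andbT eq_sym; apply/eqP => Wy.
  have Zy := nonneg_zero_derive (sW p) Wp Wy.
  have [] := solves_uniq (fun y => hill_bound K gG y (lexx `|p.1|)) (sW p) Wy Zy 0.
  rewrite /W /Z U0 U'0 V0 V'0 => h1 h2; move: nrm.
  have -> : p.2.1 = 0 by lra.
  have -> : p.2.2 = 0 by lra.
  by rewrite expr0n /= addr0 => /eqP; rewrite eq_sym oner_eq0.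
Qed.

End ground_state_line.

(** * Decay and uniqueness of the parameter *)

Section decay.
Context {R : realType}.
Implicit Types (q u v g : R -> R).

Lemma derives_linear_lower_bound u v (y z a : R) : derives u v -> y <= z ->
  (forall t, y <= t <= z -> a <= v t) -> a * (z - y) <= u z - u y.
Proof.
move=> du yz h.
have := @nondecreasing_derives _ (fun t => u t - a * t) (fun t => v t - a) y z _ yz _.
move=> H; suff : u y - a * y <= u z - a * z by lra.
by apply: H => [t|t /h]; [derive_rule; ring|rewrite subr_ge0].
Qed.

(** With E_a = a^2 u^2 - v^2 one has E_a' = 2 (a^2 - q) u v, where u v <= 0, so E_c is nondecreasing
    and E_C nonincreasing. If E_c were positive somewhere, u and hence v' would stay bounded below,
    and v would turn positive. If E_C were negative, -v would stay bounded below, and u would reach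
    0. *)
Lemma decay_rate q u v (c C Y : R) : solves q u v -> (forall y, 0 < u y) -> 0 < c -> 0 < C ->
  (forall y, Y <= y -> v y <= 0) -> (forall y, Y <= y -> c ^+ 2 <= q y <= C ^+ 2) ->
  forall y, Y <= y -> c * u y <= - v y <= C * u y.
Proof.
move=> [du dv] up c0 C0 vn hq y Yy.
have dE a : derives (fun t => a ^+ 2 * u t ^+ 2 - v t ^+ 2) (fun t => 2 * ((a ^+ 2 - q t) * (u t * v t))).
  by move=> t; derive_rule; ring.
have uv t : Y <= t -> u t * v t <= 0 by move=> /vn vt; rewrite pmulr_rle0.
have lo : c ^+ 2 * u y ^+ 2 - v y ^+ 2 <= 0.
  rewrite leNgt; apply/negP; set e := _ - _ => e0.
  have Ez z : y <= z -> e <= c ^+ 2 * u z ^+ 2 - v z ^+ 2.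
    move=> yz; apply: (nondecreasing_derives (dE c) yz) => t /andP[yt _].
    have Yt : Y <= t by lra.
    rewrite mulr_ge0// mulr_le0// ?uv// subr_le0.
    by have /andP[] := hq t Yt.
  have [l l0 ul] : exists2 l, 0 < l & forall z, y <= z -> l <= q z * u z.
    exists (c * Num.sqrt e); first by rewrite mulr_gt0// sqrtr_gt0.
    move=> z yz; have Yz : Y <= z by lra.
    have : Num.sqrt e <= c * u z.
      rewrite -[leRHS]ger0_norm; last by rewrite mulr_ge0// ltW.
      rewrite -sqrtr_sqr ler_sqrt ?sqr_ge0// exprMn.
      by have := Ez z yz; have := sqr_ge0 (v z); lra.
    rewrite -(ler_pM2l c0) => /le_trans; apply.
    by rewrite mulrA -expr2 ler_pM2r//; have /andP[] := hq z Yz.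
  (* By this point a slope of at least [l] has brought [v] up to 1. *)
  pose z := y + (1 - v y) / l.
  have vy := vn y Yy.
  have yz : y <= z by rewrite lerDl divr_ge0// ?(ltW l0)//; lra.
  have := @derives_linear_lower_bound v (fun t => q t * u t) y z l dv yz.
  rewrite (_ : l * (z - y) = 1 - v y); last by rewrite /z; field; rewrite gt_eqF.
  move=> H; have : 1 - v y <= v z - v y by apply: H => t /andP[/ul].
  by have := vn _ (le_trans Yy yz); lra.
have hi : C ^+ 2 * u y ^+ 2 - v y ^+ 2 >= 0.
  rewrite leNgt; apply/negP; set e := _ - _ => e0.
  have Ez z : y <= z -> C ^+ 2 * u z ^+ 2 - v z ^+ 2 <= e.
    move=> yz; rewrite -lerN2; apply: (nondecreasing_derives (fun t => is_derive_fopp (dE C t)) yz) => t /andP[yt _].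
    have Yt : Y <= t by lra.
    rewrite oppr_ge0 pmulr_rle0// mulr_ge0_le0// ?uv// subr_ge0.
    by have /andP[] := hq t Yt.
  pose l := Num.sqrt (- e).
  have l0 : 0 < l by rewrite sqrtr_gt0 oppr_gt0.
  have vl z : y <= z -> l <= - v z.
    move=> yz; have Yz : Y <= z by lra.
    rewrite -[leRHS]ger0_norm; last by rewrite oppr_ge0 vn.
    rewrite -sqrtr_sqr ler_sqrt ?sqr_ge0// sqrrN.
    have := Ez z yz; have : 0 <= C ^+ 2 * u z ^+ 2 by rewrite mulr_ge0 ?sqr_ge0.
    by lra.
  pose z := y + u y / l.
  have yz : y <= z by rewrite lerDl divr_ge0// ?(ltW l0)// ltW.
  have := @derives_linear_lower_bound (fun t => - u t) (fun t => - v t) y z l (fun t => is_derive_fopp (du t)) yz.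
  rewrite (_ : l * (z - y) = u y); last by rewrite /z; field; rewrite gt_eqF.
  move=> H; have : u y <= - u z - - u y by apply: H => t /andP[/vl].
  by have := up z; lra.
have vy := vn y Yy; have uy := up y.
have cu : 0 < c * u y by rewrite mulr_gt0.
have Cu : 0 < C * u y by rewrite mulr_gt0.
by rewrite -!exprMn in lo hi; apply/andP; split; nra.
Qed.

Lemma exp_decay q u v (c C Y : R) : solves q u v -> (forall y, 0 < u y) -> 0 < c -> 0 < C ->
  (forall y, Y <= y -> v y <= 0) -> (forall y, Y <= y -> c ^+ 2 <= q y <= C ^+ 2) ->
  forall y, Y <= y -> u y <= u Y * expR (c * Y) * expR (- c * y) /\ `|v y| <= C * u y.
Proof.
move=> s up c0 C0 vn hq y Yy; have rate := decay_rate s up c0 C0 vn hq.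
split; last by rewrite ler0_norm ?vn//; case/andP: (rate y Yy).
rewrite mulNr expRN ler_pdivlMr ?expR_gt0// -lerN2.
apply: (@nondecreasing_derives _ (fun t => - (u t * expR (c * t)))
  (fun t => (- v t - c * u t) * expR (c * t))) => //.
  by move=> t; have [du _] := s; derive_rule; ring.
move=> t /andP[Yt _]; rewrite mulr_ge0 ?expR_ge0// subr_ge0.
by case/andP: (rate t Yt).
Qed.

Lemma solves_reflect q u v : solves q u v ->
  solves (fun y => q (- y)) (fun y => u (- y)) (fun y => - v (- y)).
Proof. by case=> du dv; split => y; derive_rule; ring. Qed.

(** Picone's quotient u1^2 v2 / u2 divides by a decaying function, so besides exponential decay a
    bound on the logarithmic derivative v / u is recorded. Positivity of the coefficient far out
    serves to exclude v = 0 identically. *)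
Definition bound_state (K : R) g (mu : R) u v := [/\ solves (hill K g mu) u v,
  forall y, 0 < u y & exists Y c C A, [/\ 0 < c,
    forall y, Y <= `|y| -> 0 < hill K g mu y /\ `|v y| <= C * u y &
    forall y, `|u y| <= A * expR (- c * `|y|) /\ `|v y| <= A * expR (- c * `|y|)]].

Lemma bound_state_decay (K : R) g mu u v (c C Y : R) : solves (hill K g mu) u v ->
  (forall y, 0 < u y) -> 0 < c -> 0 < C -> 0 <= Y ->
  (forall y, Y <= y -> v y <= 0) -> (forall y, y <= - Y -> 0 <= v y) ->
  (forall y, Y <= `|y| -> c ^+ 2 <= hill K g mu y <= C ^+ 2) -> bound_state K g mu u v.
Proof.
move=> s up c0 C0 Y0 vr vl hq; split => //.
have [cu cv] := solves_cont s.
have [||x0 _ hM] := @EVT_max R (fun y => `|u y| + `|v y|) (- Y) Y.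
- by lra.
- by apply: continuous_within => y; apply: cvgD; apply: cvg_norm; [exact: cu|exact: cv].
pose M := `|u x0| + `|v x0|.
have {}hM y : y \in `[- Y, Y]%R -> `|u y| + `|v y| <= M := hM y.
have hr := exp_decay s up c0 C0 vr (fun y Yy => hq y (le_trans Yy (ler_norm y))).
have hl y : Y <= y -> u (- y) <= u (- Y) * expR (c * Y) * expR (- c * y) /\
    `|v (- y)| <= C * u (- y).
  move=> Yy; have := exp_decay (solves_reflect s) (fun y => up (- y)) c0 C0 _ _ Yy.
  rewrite normrN; apply => z Yz; first by rewrite oppr_le0 vl// lerN2.
  by apply: hq; rewrite normrN (le_trans Yz)// ler_norm.
have M0 : 0 <= M by have := hM 0; rewrite in_itv /= oppr_le0 Y0 => /(_ isT); apply: le_trans.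
have far y : Y <= `|y| -> u y <= (u Y + u (- Y)) * expR (c * Y) * expR (- c * `|y|) /\
    `|v y| <= C * u y.
  have eY z := mulr_ge0 (expR_ge0 (c * Y)) (expR_ge0 (- c * z)).
  have [y0|/ltW y0] := leP 0 y.
    rewrite ger0_norm// => /hr[h1 h2]; split => //; apply: le_trans h1 _.
    by have := mulr_ge0 (ltW (up (- Y))) (eY y); lra.
  rewrite ler0_norm// => /hl; rewrite opprK => -[h1 h2]; split => //; apply: le_trans h1 _.
  by have := mulr_ge0 (ltW (up Y)) (eY (- y)); lra.
(* The factor exp(cY) makes the weight at least 1 on [-Y, Y], where [M] is the bound; the factor 1 +
   C covers [v] as well as [u] outside. *)
exists Y, c, C, ((u Y + u (- Y) + M) * expR (c * Y) * (1 + C)); split => //.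
  move=> y Yy; split; last by case: (far y Yy).
  by case/andP: (hq y Yy) => h _; apply: lt_le_trans h; rewrite exprn_gt0.
move=> y; have uy := up y; have nu : `|u y| = u y by rewrite ger0_norm// ltW.
rewrite nu.
have eY : 0 < expR (c * Y) * expR (- c * `|y|) by rewrite mulr_gt0 ?expR_gt0.
set E := expR (c * Y) * expR (- c * `|y|) in eY.
rewrite (_ : _ * expR (- c * `|y|) = (u Y + u (- Y) + M) * E * (1 + C)); last by rewrite /E; ring.
have uY := up Y; have uY' := up (- Y).
have S0 : 0 < u Y + u (- Y) by lra.
have ME : 0 <= M * E by rewrite mulr_ge0// ltW.
have SE : 0 <= (u Y + u (- Y)) * E by rewrite mulr_ge0// ltW.
have [/far[h1 h2]|yY] := leP Y `|y|.
  move: h1; rewrite -mulrA -/E => h1.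
  have h3 : C * u y <= C * ((u Y + u (- Y)) * E) by rewrite ler_wpM2l// ltW.
  have h4 := mulr_ge0 (ltW C0) ME; have h5 := mulr_ge0 (ltW C0) SE.
  rewrite mulrDr mulr1 mulrDl [_ * C]mulrC mulrDr.
  by split; [apply: (le_trans h1)|apply: (le_trans h2); apply: (le_trans h3)]; rewrite -subr_ge0; lra.
have hMy : `|u y| + `|v y| <= M.
  by apply: hM; move: yY; rewrite in_itv /= ltr_norml => /andP[? ?]; rewrite !ltW.
have E1 : 1 <= E by rewrite /E -expRD -expR0 ler_expR mulNr -mulrBr mulr_ge0 ?subr_ge0// ltW.
have h1 : M <= M * E by rewrite ler_peMr.
have h4 := mulr_ge0 (ltW C0) ME; have h5 := mulr_ge0 (ltW C0) SE.
have := normr_ge0 (v y); move: hMy; rewrite nu => ? ?.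
rewrite mulrDr mulr1 mulrDl [_ * C]mulrC mulrDr.
split; (apply: (@le_trans _ _ M); first by lra);
  by apply: (le_trans h1); rewrite -subr_ge0; lra.
Qed.

Lemma exp_small (c A e : R) : 0 < c -> 0 < e -> exists N, forall z, N <= z -> A * expR (- c * z) < e.
Proof.
move=> c0 e0; exists (`|A| / e / c) => z zN.
have : `|A| < e * expR (c * z).
  have : `|A| <= e * (c * z) by move: zN; rewrite !ler_pdivrMr// mulrC [z * c]mulrC.
  have := expR_ge1Dx (c * z); rewrite -(ler_pM2l e0); lra.
rewrite mulNr expRN ltr_pdivrMr ?expR_gt0//; apply: le_lt_trans; exact: ler_norm.
Qed.

(** This stands in for integrating a nonnegative derivative over the whole line: a nondecreasing
    function that tends to 0 at both ends can take neither sign. *)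
Lemma monotone_decay_eq0 u v (Y c A : R) : derives u v -> (forall y, 0 <= v y) -> 0 < c ->
  (forall y, Y <= `|y| -> `|u y| <= A * expR (- c * `|y|)) -> forall y, u y = 0.
Proof.
move=> du v0 c0 hu y; apply/eqP; rewrite eq_le; apply/andP; split; rewrite leNgt; apply/negP => uy.
  have [N hN] := exp_small A c0 uy.
  pose z := Num.max (Num.max N Y) (Num.max y 0).
  have [zN zY zy z0] : [/\ N <= z, Y <= z, y <= z & 0 <= z].
    by split; rewrite !le_max lexx ?orbT.
  have := nondecreasing_derives du zy (fun t _ => v0 t); have := hN z zN.
  have := hu z; rewrite ger0_norm// => /(_ zY); have := ler_norm (u z); lra.
have uy' : 0 < - u y by rewrite oppr_gt0.
have [N hN] := exp_small A c0 uy'.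
pose z := Num.max (Num.max N Y) (Num.max (- y) 0).
have [zN zY zy z0] : [/\ N <= z, Y <= z, - y <= z & 0 <= z].
  by split; rewrite !le_max lexx ?orbT.
have zy' : - z <= y by lra.
have := nondecreasing_derives du zy' (fun t _ => v0 t); have := hN z zN.
have := hu (- z); rewrite normrN ger0_norm// => /(_ zY).
by have := ler_norm (- u (- z)); rewrite normrN; lra.
Qed.

(* Picone's identity for u1^2 (m1 - m2), with m = v / (mu K u). *)
Lemma picone (K1 K2 mu1 mu2 : R) g u1 v1 u2 v2 :
  0 < K1 -> K1 <= K2 -> 0 < mu1 -> mu1 <= mu2 ->
  bound_state K1 g mu1 u1 v1 -> bound_state K2 g mu2 u2 v2 -> K1 = K2 /\ mu1 = mu2.
Proof.
move=> K10 K12 mu10 mu12 [[du1 dv1] up1 [Y1 [c1 [C1 [A1 [c10 h1 A1P]]]]]]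
  [[du2 dv2] up2 [Y2 [c2 [C2 [A2 [c20 h2 A2P]]]]]].
have K20 : 0 < K2 by lra.
have mu20 : 0 < mu2 by lra.
have nz1 y : u1 y != 0 by rewrite gt_eqF.
have nz2 y : u2 y != 0 by rewrite gt_eqF.
have K1n : K1 != 0 by rewrite gt_eqF.
have K2n : K2 != 0 by rewrite gt_eqF.
have mu1n : mu1 != 0 by rewrite gt_eqF.
have mu2n : mu2 != 0 by rewrite gt_eqF.
(* With this scaling both equations read (a v)' = (1 / mu - g) u, so [g] cancels in P'. What remains
   is [Q], whose three summands are nonnegative because K1 <= K2 and mu1 <= mu2. *)
pose a1 := (mu1 * K1)^-1; pose a2 := (mu2 * K2)^-1.
pose P y := a1 * (u1 y * v1 y) - a2 * (u1 y ^+ 2 * v2 y * (u2 y)^-1).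
pose Q y := u1 y ^+ 2 * (mu1 * K1 * (a1 * v1 y / u1 y - a2 * v2 y / u2 y) ^+ 2 +
  (a2 * v2 y / u2 y) ^+ 2 * (mu2 * K2 - mu1 * K1) + (mu1^-1 - mu2^-1)).
have dP : derives P Q.
  move=> y; rewrite /P /Q /a1 /a2; derive_rule; first exact: nz2.
  by rewrite /hill; field; rewrite ?nz1 ?nz2 ?K1n ?K2n ?mu1n ?mu2n.
have q1 : 0 <= mu2 * K2 - mu1 * K1 by rewrite subr_ge0 ler_pM// ltW.
have q2 : 0 <= mu1^-1 - mu2^-1 by rewrite subr_ge0 lef_pV2.
have Q1 y : 0 <= mu1 * K1 * (a1 * v1 y / u1 y - a2 * v2 y / u2 y) ^+ 2.
  by apply: mulr_ge0; [apply/mulr_ge0; exact: ltW|exact: sqr_ge0].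
have Q2 y : 0 <= (a2 * v2 y / u2 y) ^+ 2 * (mu2 * K2 - mu1 * K1).
  by apply: mulr_ge0; [exact: sqr_ge0|].
have Q0 y : 0 <= Q y.
  by apply: mulr_ge0; [exact: sqr_ge0|apply: addr_ge0 => //; apply: addr_ge0].
have a10 : 0 <= a1 by rewrite invr_ge0 mulr_ge0// ltW.
have a20 : 0 <= a2 by rewrite invr_ge0 mulr_ge0// ltW.
have P0 : forall y, P y = 0.
  apply: (@monotone_decay_eq0 P Q Y2 c1 (a1 * A1 ^+ 2 + a2 * (A1 ^+ 2 * C2))) => // y Yy.
  have [+ hv1] := A1P y; rewrite ger0_norm; last exact/ltW/up1.
  set E := expR _ => hu1.
  have E0 : 0 < E by exact: expR_gt0.
  have E1 : E <= 1 by rewrite -expR0 ler_expR mulNr oppr_le0 mulr_ge0// ltW.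
  have hu1' : u1 y ^+ 2 <= A1 ^+ 2 * E.
    have : u1 y ^+ 2 <= (A1 * E) ^+ 2.
      by rewrite ler_sqr ?nnegrE// ?ltW//; apply: lt_le_trans (up1 y) _.
    by move/le_trans; apply; rewrite exprMn ler_wpM2l ?sqr_ge0// expr2 ler_piMl// ltW.
  have huv1 : `|u1 y * v1 y| <= A1 ^+ 2 * E.
    rewrite normrM ger0_norm; last exact/ltW/up1.
    apply: (@le_trans _ _ (A1 * E * (A1 * E))).
      by apply: ler_pM => //; exact/ltW/up1.
    by rewrite -expr2 exprMn ler_wpM2l ?sqr_ge0// expr2 ler_piMl// ltW.
  have hv2 : `|v2 y / u2 y| <= C2.
    rewrite normrM normfV [`|u2 y|]ger0_norm; last exact/ltW/up2.
    by rewrite ler_pdivrMr//; case: (h2 y Yy).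
  have -> : P y = a1 * (u1 y * v1 y) + - (a2 * (u1 y ^+ 2 * (v2 y / u2 y))) by rewrite /P; ring.
  apply: le_trans (ler_normD _ _) _; rewrite mulrDl normrN; apply: lerD.
    by rewrite normrM [`|a1|]ger0_norm// -mulrA ler_wpM2l.
  have hu2 : `|u1 y ^+ 2 * (v2 y / u2 y)| <= A1 ^+ 2 * C2 * E.
    rewrite normrM [`|u1 y ^+ 2|]ger0_norm ?sqr_ge0// [leRHS]mulrAC.
    by apply: ler_pM => //; exact: sqr_ge0.
  by rewrite normrM [`|a2|]ger0_norm// -[leRHS]mulrA ler_wpM2l.
have QE y : Q y = 0.
  have [_ e1] := dP y; rewrite -e1 (_ : P = cst 0); last by apply/funext => z; rewrite P0.
  by rewrite derive_cst.
have QP y : (a2 * v2 y / u2 y) ^+ 2 * (mu2 * K2 - mu1 * K1) = 0 /\ mu1^-1 - mu2^-1 = 0.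
  have /eqP := QE y; rewrite mulf_eq0 sqrf_eq0 (negbTE (nz1 y)) /= => /eqP.
  by have := Q1 y; have := Q2 y; split; lra.
have mu_eq : mu1 = mu2 by have [_ /subr0_eq/invr_inj] := QP 0.
(* If K1 < K2, the middle summand of [Q] forces v2 = 0 everywhere, which contradicts v2' = hill u2 >
   0 far out. *)
split => //; apply/eqP; rewrite eq_le K12 /=; rewrite leNgt; apply/negP => K21.
have qp : mu2 * K2 - mu1 * K1 != 0.
  by rewrite gt_eqF// subr_gt0 mu_eq ltr_pM2l.
have v20 y : v2 y = 0.
  have [/eqP + _] := QP y; rewrite mulf_eq0 (negbTE qp) orbF sqrf_eq0 !mulf_eq0 [(u2 y)^-1 == 0]invr_eq0 (negbTE (nz2 y)) orbF.
  by rewrite /a2 invr_eq0 mulf_eq0 (negbTE mu2n) (negbTE K2n) /= => /eqP.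
have [_] := dv2 Y2; rewrite (_ : v2 = cst 0); last by apply/funext => z; rewrite v20.
rewrite derive_cst => /esym/eqP; rewrite mulf_eq0 (negbTE (nz2 _)) orbF.
have [+ _] := h2 Y2 (ler_norm _).
by move=> /gt_eqF->.
Qed.

End decay.

(** * Integration on the plane *)

Section plane.
Context {R : realType}.
Notation mu := (@lebesgue_measure R).

Lemma floor_approx (x : R) (n : nat) :
  `|x - (Num.floor (n.+1%:R * x))%:~R / n.+1%:R| <= n.+1%:R^-1.
Proof.
have n0 : 0 < n.+1%:R :> R by [].
have := floor_itv (n.+1%:R * x); set z := Num.floor _ => /andP[h1 h2].
rewrite (_ : x - _ = (n.+1%:R * x - z%:~R) / n.+1%:R); last by field.
rewrite normrM [`|_^-1|]ger0_norm ?invr_ge0// ler_piMl ?invr_ge0//.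
by rewrite ler_norml; move: h2; rewrite intrD => h2; apply/andP; split; lra.
Qed.

Lemma continuous_section2 (F : R * R -> R) (x : R) : continuous F ->
  continuous (fun y => F (x, y)).
Proof.
move=> cF; have : continuous (F \o (fun y : R => (x, y))); last by [].
move=> y; apply: continuous_comp; last exact: cF.
have h1 : x @[_ --> y] --> x by exact: cvg_cst.
have h2 : z @[z --> y] --> y by [].
exact: (cvg_pair h1 h2).
Qed.

Lemma continuous_section1 (F : R * R -> R) (y : R) : continuous F ->
  continuous (fun x => F (x, y)).
Proof.
move=> cF; have : continuous (F \o (fun x : R => (x, y))); last by [].
move=> x; apply: continuous_comp; last exact: cF.
have h1 : y @[_ --> x] --> y by exact: cvg_cst.
have h2 : z @[z --> x] --> x by [].
exact: (cvg_pair h2 h1).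
Qed.

(** The plane carries the product sigma-algebra. Rounding the first variable down to a grid of mesh
    1 / (n + 1) gives functions whose preimages are countable unions of measurable products, and
    they converge pointwise to [F]. *)
Lemma continuous2_measurable (F : R * R -> R) : continuous F -> measurable_fun setT F.
Proof.
move=> cF.
pose a (n : nat) (x : R) : R := (Num.floor (n.+1%:R * x))%:~R / n.+1%:R.
pose Fn n (p : R * R) := F (a n p.1, p.2).
have mFn n : measurable_fun setT (Fn n).
  move=> _ B mB; rewrite setTI.
  rewrite (_ : Fn n @^-1` B = \bigcup_(z : int)
     ((fun x : R => Num.floor (n.+1%:R * x)) @^-1` [set z] `*`
      (fun y => F (z%:~R / n.+1%:R, y)) @^-1` B)); last first.
    apply/seteqP; split => [[x y] /= Bxy|[x y] [z _ [/= <-]]]//.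
    by exists (Num.floor (n.+1%:R * x)).
  apply: countable_bigcupT_measurable; first exact: countableP.
  move=> z; apply: measurableX.
    rewrite (_ : _ @^-1` _ = `[z%:~R / n.+1%:R, (z + 1)%:~R / n.+1%:R[%classic).
      exact: measurable_itv.
    apply/seteqP; split => x /=; rewrite in_itv /=.
      by move=> <-; rewrite ler_pdivrMr// ltr_pdivlMr// ![x * _]mulrC;
        exact: floor_itv _.
    rewrite ler_pdivrMr// ltr_pdivlMr// => h; apply/floor_def.
    by rewrite mulrC.
  rewrite -[X in measurable X]setTI; apply: continuous_measurable_fun => //.
  exact: continuous_section2.
apply/measurable_EFinP; apply: (emeasurable_fun_cvg (fun n p => (Fn n p)%:E)) => //.
  by move=> n; apply/measurable_EFinP.
move=> p _; apply/fine_cvgP; split; first by apply: nearW.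
rewrite /comp /=.
have -> : (fun n => Fn n p) = F \o (fun n => (a n p.1, p.2)) by [].
apply: (@cvg_comp _ _ _ _ _ _ (nbhs p)); last exact: cF.
have h2 : p.2 @[_ --> \oo] --> p.2 by exact: cvg_cst.
suff h1 : a n p.1 @[n --> \oo] --> p.1.
  by have := cvg_pair h1 h2; case: p {h1 h2} => p1 p2 /=; apply.
apply/cvgrPdist_le => e e0; exists (Num.trunc e^-1).+1 => // n /= hn.
apply: le_trans (floor_approx p.1 n) _.
rewrite invf_ple ?posrE//.
apply/ltW; apply: lt_le_trans (truncnS_gt _) _.
by rewrite ler_nat; apply: leqW; exact: hn.
Qed.


Definition rect (a b c d : R) : set (R * R) := `[a, b] `*` `[c, d].

Lemma measurable_rect a b c d : measurable (rect a b c d).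
Proof. by apply: measurableX; exact: measurable_itv. Qed.

Lemma mu2_rectE a b c d : mu2 (rect a b c d) = (mu `[a, b] * mu `[c, d])%E.
Proof. by rewrite /mu2 /rect product_measure1E; [|exact: measurable_itv..]. Qed.

Lemma mu2_rect_gt0 a b c d : a < b -> c < d -> (0 < mu2 (rect a b c d))%E.
Proof.
move=> ab cd; rewrite mu2_rectE !lebesgue_measure_itv /= !lte_fin ab cd.
by rewrite -!EFinB -EFinM lte_fin mulr_gt0 ?subr_gt0.
Qed.

Lemma mu2_rect_fin a b c d : (mu2 (rect a b c d) < +oo)%E.
Proof.
rewrite mu2_rectE lte_mul_pinfty//; rewrite lebesgue_measure_itv /=; case: ifP => _ //=;
  by rewrite -?EFinB ?ltry.
Qed.

Lemma integrable_rect a b c d (F : R * R -> R) : continuous F ->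
  mu2.-integrable (rect a b c d) (EFin \o F).
Proof.
move=> cF; apply: measurable_bounded_integrable.
- exact: measurable_rect.
- exact: mu2_rect_fin.
- by apply: measurable_funTS; exact: continuous2_measurable.
have [[x cx]|e] := pselect (exists x, rect a b c d x); last first.
  by exists 0; split; [exact: num_real|move=> M _ x /= rx; exfalso; apply: e; exists x].
have cR : compact (rect a b c d) by apply: compact_setX; exact: segment_compact.
have [||z _ hz] := @compact_EVT_max _ R (fun p => `|F p|) _ _ cR.
- by exists x.
- by apply: continuous_subspaceT => p; apply: cvg_norm; exact: cF.
exists `|F z|; split; first exact: num_real.
move=> M zM p /= rp; apply/ltW; apply: le_lt_trans zM; apply: hz; exact/mem_set.
Qed.

Lemma integrable_seg a b (f : R -> R) : continuous f -> mu.-integrable `[a, b] (EFin \o f).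
Proof.
move=> cf; apply: continuous_compact_integrable; first exact: segment_compact.
exact: continuous_within.
Qed.

Lemma EFin_Rintegral_seg a b (f : R -> R) : continuous f ->
  (\int[mu]_(x in `[a, b]) (f x)%:E)%E = (Rintegral mu `[a, b] f)%:E.
Proof.
move=> cf; rewrite /Rintegral fineK//; apply: integrable_fin_num; first exact: measurable_itv.
exact: integrable_seg.
Qed.

Lemma Fubini_rect a b c d (F : R * R -> R) : continuous F ->
  Rintegral mu2 (rect a b c d) F =
    Rintegral mu `[a, b] (fun x => Rintegral mu `[c, d] (fun y => F (x, y))) /\
  Rintegral mu2 (rect a b c d) F =
    Rintegral mu `[c, d] (fun y => Rintegral mu `[a, b] (fun x => F (x, y))).
Proof.
move=> cF.
have iF := integrable_rect a b c d cF.
have iF' : mu2.-integrable setT ((EFin \o F) \_ (rect a b c d)).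
  have [h _] := integrable_mkcond (mu := mu2) (EFin \o F) (measurable_rect a b c d).
  exact: (h iF).
split; rewrite {1}/Rintegral integral_mkcond.
  rewrite -(integral12_prod_meas1 iF') {2}/Rintegral; congr fine.
  rewrite [RHS]integral_mkcond; apply: eq_integral => x _.
  rewrite /fubini_F [RHS]patchE; case: ifPn => [xab|xab].
    rewrite -EFin_Rintegral_seg; last exact: continuous_section2.
    rewrite [RHS]integral_mkcond; apply: eq_integral => y _; rewrite !patchE /=.
    congr (if _ then _ else _); apply/idP/idP => /set_mem.
      by move=> [_ /= ?]; exact/mem_set.
    by move=> ?; apply/mem_set; split => //=; exact: set_mem xab.
  rewrite integral0_eq// => y _; rewrite patchE ifN//.
  by apply: contra xab => /set_mem[/= ? _]; exact/mem_set.
rewrite -(integral21_prod_meas1 iF') {2}/Rintegral; congr fine.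
rewrite [RHS]integral_mkcond; apply: eq_integral => y _.
rewrite /fubini_G [RHS]patchE; case: ifPn => [yab|yab].
  rewrite -EFin_Rintegral_seg; last exact: continuous_section1.
  rewrite [RHS]integral_mkcond; apply: eq_integral => x _; rewrite !patchE /=.
  congr (if _ then _ else _); apply/idP/idP => /set_mem.
    by move=> [/= ? _]; exact/mem_set.
  by move=> ?; apply/mem_set; split => //=; exact: set_mem yab.
rewrite integral0_eq// => x _; rewrite patchE ifN//.
by apply: contra yab => /set_mem[_ /= ?]; exact/mem_set.
Qed.

Lemma Rintegral_FTC (F f : R -> R) (a b : R) : a <= b -> derives F f -> continuous f ->
  Rintegral mu `[a, b] f = F b - F a.
Proof.
rewrite le_eqVlt => /predU1P[->|ab] dF cf; first by rewrite set_itv1 Rintegral_set1 subrr.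
rewrite /Rintegral (continuous_FTC2 (F := F) ab) ?EFinB//; first exact: continuous_within.
  have cF := derives_continuous dF.
  split; first by move=> x _; case: (dF x).
    by apply: cvg_at_right_filter; exact: cF.
  by apply: cvg_at_left_filter; exact: cF.
by move=> x _; rewrite derive1E; case: (dF x).
Qed.

Lemma continuous_tensor (f h : R -> R) : continuous f -> continuous h ->
  continuous (fun p : R * R => f p.1 * h p.2).
Proof.
move=> cf ch.
have c1 : continuous (f \o (fst : R * R -> R)).
  by move=> p; apply: continuous_comp; [exact: cvg_fst|exact: cf].
have c2 : continuous (h \o (snd : R * R -> R)).
  by move=> p; apply: continuous_comp; [exact: cvg_snd|exact: ch].
by move=> p; apply: cvgM; [exact: c1|exact: c2].
Qed.

Lemma Rintegral_tensor a b c d (f h : R -> R) : continuous f -> continuous h ->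
  Rintegral mu2 (rect a b c d) (fun p => f p.1 * h p.2) =
  Rintegral mu `[a, b] f * Rintegral mu `[c, d] h.
Proof.
move=> cf ch.
have cF := continuous_tensor cf ch.
have [-> _] := Fubini_rect a b c d cF.
rewrite -RintegralZr//; last exact: integrable_seg.
apply: eq_Rintegral => x _ /=.
by rewrite RintegralZl//; exact: integrable_seg.
Qed.

End plane.

(** * Quadratic decay and its integrals *)

Section decaying.
Context {R : realType}.
Notation mu := (@lebesgue_measure R).

Lemma derive_dist_le (F f G g : R -> R) (a b : R) : a <= b -> derives F f -> derives G g ->
  (forall y, a <= y <= b -> `|f y| <= g y) -> `|F b - F a| <= G b - G a.
Proof.
move=> ab dF dG fg; rewrite ler_norml; apply/andP; split.
  have := @nondecreasing_derives _ (fun t => F t + G t) (fun t => f t + g t) a b _ ab _.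
  move=> H; suff : F a + G a <= F b + G b by lra.
  by apply: H => [t|t /fg]; [derive_rule|rewrite ler_norml; lra].
have := @nondecreasing_derives _ (fun t => G t - F t) (fun t => g t - f t) a b _ ab _.
move=> H; suff : G a - F a <= G b - F b by lra.
by apply: H => [t|t /fg]; [derive_rule|rewrite ler_norml; lra].
Qed.

Lemma atan_derives : derives (@atan R) (fun y => (1 + y ^+ 2)^-1).
Proof. by move=> y; exact: is_derive1_atan. Qed.

Lemma oneDsq_gt0 (y : R) : 0 < 1 + y ^+ 2.
Proof. by rewrite ltr_pwDl// sqr_ge0. Qed.

Lemma inv_oneDsq_cvg0 : (1 + N%:R ^+ 2 : R)^-1 @[N --> \oo] --> (0 : R).
Proof.
apply/cvgrPdist_le => e e0; exists (Num.trunc e^-1).+1 => // n /= hn.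
rewrite sub0r normrN ger0_norm; last by rewrite invr_ge0 ltW// oneDsq_gt0.
rewrite invf_ple ?posrE// ?oneDsq_gt0//.
apply/ltW; apply: lt_le_trans (truncnS_gt _) _.
apply: (@le_trans _ _ n%:R); first by rewrite ler_nat.
by rewrite -natrX -(natrD _ 1) ler_nat; nia.
Qed.

Lemma atan_cvg : atan x @[x --> +oo] --> (pi / 2 : R).
Proof.
apply/cvgrPdist_lt => e e0.
pose t := Num.max 0 (pi / 2 - e / 2).
have p0 := pi_gt0 R.
have t0 : 0 <= t by rewrite le_max lexx.
have tp : t < pi / 2 by rewrite gt_max; apply/andP; split; lra.
have te : pi / 2 - e / 2 <= t by rewrite le_max lexx orbT.
exists (tan t); split; first exact: num_real.
move=> x tx; have h : atan (tan t) <= atan x.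
  apply: (nondecreasing_derives atan_derives (ltW tx)) => y _.
  by rewrite invr_ge0 ltW// oneDsq_gt0.
rewrite tanK in h; last by rewrite in_itv /=; apply/andP; split; lra.
by have := atan_ltpi2 x; move=> h2; rewrite ger0_norm; lra.
Qed.

Lemma integral_oneDsq : (\int[mu]_x ((1 + x ^+ 2)^-1)%:E = (pi : R)%:E)%E.
Proof.
have c : continuous (fun x : R => (1 + x ^+ 2)^-1) by exact: continuous_oneDsqrV.
have p x : 0 <= (1 + x ^+ 2 : R)^-1 by rewrite invr_ge0 ltW// oneDsq_gt0.
have e : (fun x : R => (1 + x ^+ 2)^-1) =1 (fun x : R => (1 + x ^+ 2)^-1) \o -%R.
  by move=> x /=; rewrite sqrrN.
rewrite (ge0_symfun_integralT p c e).
rewrite -set_itvcy (@ge0_continuous_FTC2y R _ atan 0 (pi / 2))//.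
- by rewrite atan0 sube0 -EFinM; congr EFin; field.
- exact: continuous_within.
- exact: atan_cvg.
- by apply: cvg_at_right_filter; exact: continuous_atan.
- by move=> x _; rewrite derive1E; case: (atan_derives x).
Qed.

Lemma integral_Omega_oneDsq : (\int[mu2]_(p in Omega) ((1 + p.2 ^+ 2)^-1)%:E < +oo :> \bar R)%E.
Proof.
have mO : measurable (Omega : set (R * R)) by apply: measurableX; [exact: measurable_itv|].
pose f := (fun p : R * R => ((1 + p.2 ^+ 2)^-1)%:E) \_ Omega.
have mf0 : measurable_fun setT (fun p : R * R => ((1 + p.2 ^+ 2)^-1)%:E).
  apply/measurable_EFinP.
  have : measurable_fun setT ((fun x : R => (1 + x ^+ 2)^-1) \o (snd : R * R -> R)); last by [].
  apply: measurableT_comp; last exact: measurable_snd.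
  by apply: continuous_measurable_fun; exact: continuous_oneDsqrV.
rewrite integral_mkcond /mu2 fubini_tonelli1; first last.
- move=> p; rewrite patchE; case: ifP => // _; rewrite lee_fin invr_ge0 ltW// oneDsq_gt0//.
- apply/(measurable_restrictT _ mO); exact: measurable_funTS.
pose I : set R := [set` `[0, 2 * pi]].
rewrite [ltLHS](_ : _ = (\int[mu]_(x in I) (pi : R)%:E)%E); last first.
  rewrite [RHS]integral_mkcond; apply: eq_integral => x _.
  rewrite /fubini_F [RHS]patchE; case: ifPn => [xab|xab].
    rewrite -integral_oneDsq; apply: eq_integral => y _; rewrite patchE ifT//.
    by apply/mem_set; split => //; exact: set_mem xab.
  rewrite integral0_eq// => y _; rewrite patchE ifN//.
  by apply: contra xab => /set_mem[/= ? _]; exact/mem_set.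
rewrite integral_cst; last exact: measurable_itv.
apply: lte_mul_pinfty => //; first by rewrite lee_fin pi_ge0.
have : (mu I < +oo)%E; last by [].
by rewrite /I lebesgue_measure_itv /=; case: ifP => _ //; rewrite -EFinB ltry.
Qed.

(** This weight has the primitive [atan], so tails are explicit; the same weight bounds the errors
    in the frequency variable. *)
Definition decays (h : R -> R) := exists A, forall y, `|h y| <= A * (1 + y ^+ 2)^-1.

Lemma re_normsq (x : R) : normsq (x%:C)%C = x ^+ 2.
Proof. by rewrite /normsq /= expr0n /= addr0. Qed.

Lemma L2_tensor (f h : R -> R) : continuous f -> (forall x, f (x + 2 * pi) = f x) ->
  continuous h -> decays h -> L2 (fun p : R * R => (f p.1 * h p.2)%:C%C).
Proof.
move=> cf pf ch [A hA].
have cF := continuous_tensor cf ch.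
have mO : measurable (Omega : set (R * R)) by apply: measurableX; [exact: measurable_itv|].
split.
- by move=> x y /=; rewrite pf.
- split; first by apply: measurable_funTS; exact: continuous2_measurable.
  exact: measurable_cst.
have [||c _ hc] := @EVT_max R (fun x => `|f x|) 0 (2 * pi).
- by rewrite mulr_ge0// pi_ge0.
- by apply: continuous_within => x; apply: cvg_norm; exact: cf.
have A0 : 0 <= A by have := le_trans (normr_ge0 _) (hA 0); rewrite expr0n /= addr0 invr1 mulr1.
pose B := `|f c| ^+ 2 * A ^+ 2.
have B0 : 0 <= B by rewrite mulr_ge0 ?sqr_ge0.
apply: (@le_lt_trans _ _ (\int[mu2]_(p in Omega) (B%:E * ((1 + p.2 ^+ 2)^-1)%:E))%E).
  apply: ge0_le_integral => //.
  - by move=> p _; rewrite lee_fin re_normsq sqr_ge0.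
  - apply/measurable_EFinP; apply: measurable_funTS.
    under eq_fun do rewrite re_normsq.
    apply: continuous2_measurable => p.
    have : continuous ((fun x : R => x ^+ 2) \o (fun p : R * R => f p.1 * h p.2)); last exact.
    by move=> q; apply: continuous_comp; [exact: cF|exact: exprn_continuous].
  - apply/measurable_EFinP; apply: measurable_funTS.
    apply: measurable_funM; first exact: measurable_cst.
    have : measurable_fun setT ((fun x : R => (1 + x ^+ 2)^-1) \o (snd : R * R -> R)); last by [].
    apply: measurableT_comp; last exact: measurable_snd.
    by apply: continuous_measurable_fun; exact: continuous_oneDsqrV.
  - move=> p [/= p1 _]; rewrite -EFinM lee_fin re_normsq.
    have p0 := oneDsq_gt0 p.2.
    have q0 : 0 < (1 + p.2 ^+ 2)^-1 by rewrite invr_gt0.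
    have q1 : (1 + p.2 ^+ 2)^-1 <= 1 by rewrite invf_le1// lerDl sqr_ge0.
    rewrite -real_normK ?num_real// normrM exprMn /B -[leRHS]mulrA; apply: ler_pM; rewrite ?sqr_ge0//.
      by rewrite ler_sqr ?nnegrE// hc// in_itv.
    apply: (@le_trans _ _ ((A * (1 + p.2 ^+ 2)^-1) ^+ 2)).
      by rewrite ler_sqr ?nnegrE// mulr_ge0// ltW.
    by rewrite exprMn ler_wpM2l ?sqr_ge0// expr2 ler_piMl// ltW.
rewrite ge0_integralZl//.
- by rewrite lte_mul_pinfty// ?lee_fin// integral_Omega_oneDsq.
- apply/measurable_EFinP; apply: measurable_funTS.
  have : measurable_fun setT ((fun x : R => (1 + x ^+ 2)^-1) \o (snd : R * R -> R)); last by [].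
  apply: measurableT_comp; last exact: measurable_snd.
  by apply: continuous_measurable_fun; exact: continuous_oneDsqrV.
- by move=> p _; rewrite lee_fin invr_ge0 ltW// oneDsq_gt0.
Qed.

End decaying.

(** * Fourier transform of cos(kx) h(y) *)

Section fourier_tail.
Context {R : realType}.
Notation mu := (@lebesgue_measure R).

Lemma cos_lipschitz (a b : R) : `|cos a - cos b| <= `|a - b|.
Proof.
wlog ab : a b / a <= b.
  by move=> H; have [/H//|/ltW/H] := leP a b; rewrite distrC [`|b - a|]distrC.
have dc : derives (@cos R) (fun y => - sin y) by move=> y; exact: is_derive_cos.
rewrite distrC [leRHS]distrC [leRHS]ger0_norm ?subr_ge0//.
apply: (derive_dist_le ab dc is_derive_fid) => y _.
by rewrite normrN ler_norml sin_geN1 sin_le1.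
Qed.

(** The phase lets one set of estimates serve both parts of the Fourier integral: th = 0 is the
    cosine transform and th = -pi/2 the sine transform. *)
Definition cosint (h : R -> R) (th : R) (N : nat) (xi : R) : R :=
  Rintegral mu `[- N%:R, N%:R] (fun y => h y * cos (xi * y + th)).

Variables (h h1 : R -> R) (A th : R).
Hypotheses (dh : derives h h1).
Hypotheses (hA : forall y, `|h y| <= A * (1 + y ^+ 2)^-1)
           (h1A : forall y, `|h1 y| <= A * (1 + y ^+ 2)^-1).

Let A0 : 0 <= A.
Proof. by have := le_trans (normr_ge0 _) (hA 0); rewrite expr0n /= addr0 invr1 mulr1. Qed.

Let ch : continuous h. Proof. exact: derives_continuous dh. Qed.

Lemma cos_aff_cont (xi : R) : continuous (fun y => cos (xi * y + th)).
Proof.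
apply: (@derives_continuous _ _ (fun y => - sin (xi * y + th) * xi)) => y.
by derive_rule; ring.
Qed.

Let hc_cont (xi : R) : continuous (fun y => h y * cos (xi * y + th)).
Proof. by move=> y; apply: cvgM; [exact: ch|exact: cos_aff_cont]. Qed.

Let P (xi : R) := primitive_at0 (fun y => h y * cos (xi * y + th)).
Let dP (xi : R) : derives (P xi) (fun y => h y * cos (xi * y + th)).
Proof. exact: (primitive_at0P (@hc_cont xi)).2. Qed.

Let cosintE N xi : cosint h th N xi = P xi N%:R - P xi (- N%:R).
Proof.
have N0 : 0 <= (N%:R : R) by [].
have NN : - (N%:R : R) <= N%:R by lra.
by rewrite /cosint (Rintegral_FTC NN (@dP xi) (@hc_cont xi)).
Qed.

Let Aatan : derives (fun y => A * atan y) (fun y => A * (1 + y ^+ 2)^-1).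
Proof. by move=> y; have := atan_derives y => ?; derive_rule; ring. Qed.

Let osc (xi a b : R) : a <= b -> `|P xi b - P xi a| <= A * (atan b - atan a).
Proof.
move=> ab; rewrite mulrBr; apply: (derive_dist_le ab (@dP xi) Aatan) => y _.
apply: le_trans (hA y); rewrite normrM ler_piMr//.
by rewrite ler_norml cos_geN1 cos_le1.
Qed.

(** One integration by parts trades the factor xi for a derivative of [h] and two boundary terms. *)
Let osc_xi (xi a b : R) : a <= b ->
  `|xi * (P xi b - P xi a)| <= `|h a| + `|h b| + A * (atan b - atan a).
Proof.
move=> ab.
have dQ : derives (fun y => xi * P xi y - h y * sin (xi * y + th)) (fun y => - (h1 y * sin (xi * y + th))).
  by move=> y; have := @dP xi => ?; derive_rule; ring.
have H : `|(xi * P xi b - h b * sin (xi * b + th)) - (xi * P xi a - h a * sin (xi * a + th))| <=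
    A * (atan b - atan a).
  rewrite mulrBr; apply: (derive_dist_le ab dQ Aatan) => y _.
  apply: le_trans (h1A y); rewrite normrN normrM ler_piMr//.
  by rewrite ler_norml sin_geN1 sin_le1.
have s1 y : `|h y * sin (xi * y + th)| <= `|h y|.
  by rewrite normrM ler_piMr// ler_norml sin_geN1 sin_le1.
have := s1 a; have := s1 b; move: H; rewrite !ler_norml => /andP[? ?] /andP[? ?] /andP[? ?].
by apply/andP; split; lra.
Qed.

(** The difference of two truncations lives on [N, M] and [-M, -N], which contributes four boundary
    values of [h] and two increments of A atan. *)
Let T (N : nat) : R := A * (4 * (1 + N%:R ^+ 2)^-1 + 2 * (pi / 2 - atan N%:R)).

Let sq_mono (N M : nat) : (N <= M)%N -> (1 + M%:R ^+ 2)^-1 <= (1 + N%:R ^+ 2 : R)^-1.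
Proof.
move=> NM; rewrite lef_pV2 ?posrE ?oneDsq_gt0// lerD2l ler_sqr ?nnegrE//.
by rewrite ler_nat.
Qed.

Let atan_osc (N M : nat) : 0 <= A * (pi / 2 - atan N%:R) /\
  A * (atan M%:R - atan N%:R) <= A * (pi / 2 - atan (N%:R : R)).
Proof.
have := atan_ltpi2 (N%:R : R); have := atan_ltpi2 (M%:R : R) => hM hN.
by split; [apply: mulr_ge0 => //; lra|apply: ler_wpM2l => //; lra].
Qed.

Let cosint_diff N M xi : (N <= M)%N -> `|cosint h th M xi - cosint h th N xi| <= T N /\
  `|xi * (cosint h th M xi - cosint h th N xi)| <= T N.
Proof.
move=> NM; have NM' : (N%:R : R) <= M%:R by rewrite ler_nat.
have MN' : - (M%:R : R) <= - N%:R by rewrite lerN2.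
have [b0 b1] := atan_osc N M.
have c0 : 0 <= A * (1 + N%:R ^+ 2)^-1 by rewrite mulr_ge0// invr_ge0 ltW// oneDsq_gt0.
have bM : `|h M%:R| <= A * (1 + N%:R ^+ 2)^-1.
  by apply: le_trans (hA _) _; rewrite ler_wpM2l// sq_mono.
have bM' : `|h (- M%:R)| <= A * (1 + N%:R ^+ 2)^-1.
  by apply: le_trans (hA _) _; rewrite sqrrN ler_wpM2l// sq_mono.
have bN : `|h N%:R| <= A * (1 + N%:R ^+ 2)^-1 by exact: hA.
have bN' : `|h (- N%:R)| <= A * (1 + N%:R ^+ 2)^-1 by apply: le_trans (hA _) _; rewrite sqrrN.
have o1 := osc xi NM'; have o2 := osc xi MN'.
have x1 := osc_xi xi NM'; have x2 := osc_xi xi MN'.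
have E : cosint h th M xi - cosint h th N xi =
    (P xi M%:R - P xi N%:R) + (P xi (- N%:R) - P xi (- M%:R)).
  by rewrite !cosintE; ring.
rewrite !atanN in o2 x2; rewrite E mulrDr /T.
split; apply: le_trans (ler_normD _ _) _; lra.
Qed.

Let T_cvg : T N @[N --> \oo] --> (0 : R).
Proof.
have cA : atan (N%:R : R) @[N --> \oo] --> (pi / 2 : R).
  by apply: cvg_comp atan_cvg; exact: cvgr_idn.
have cI := @inv_oneDsq_cvg0 R.
have -> : (0 : R) = A * (4 * 0 + 2 * (pi / 2 - pi / 2)) by ring.
apply: cvgMl_tmp; apply: cvgD; first exact: cvgMl_tmp.
by apply: cvgMl_tmp; apply: cvgB => //; exact: cvg_cst.
Qed.

Let cosint_cvg xi : exists l : R, cosint h th N xi @[N --> \oo] --> l.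
Proof.
(* By [osc] one step changes [cosint] by at most 2 A times the increment of atan, so adding this
   term makes the sequence monotone. *)
pose x (N : nat) := cosint h th N xi + 2 * (A * atan N%:R).
have ndx : nondecreasing_seq x.
  apply/nondecreasing_seqP => N; rewrite /x.
  have NM' : (N%:R : R) <= N.+1%:R by rewrite ler_nat.
  have MN' : - (N.+1%:R : R) <= - N%:R by rewrite lerN2.
  have := osc xi NM'; have := osc xi MN'; rewrite !atanN !cosintE !ler_norml; lra.
have ubx : has_ubound (range x).
  exists (`|cosint h th 0 xi| + T 0 + 2 * (A * (pi / 2))) => _ [N _ <-].
  have [+ _] := cosint_diff xi (leq0n N); have := ler_norm (cosint h th 0 xi).
  have : A * atan (N%:R : R) <= A * (pi / 2) by rewrite ler_wpM2l// ltW// atan_ltpi2.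
  by rewrite /x ler_norml; lra.
exists (sup (range x) - 2 * (A * (pi / 2))).
have -> : (fun N => cosint h th N xi) = (fun N => x N - 2 * (A * atan N%:R)).
  by apply/funext => N; rewrite /x addrK.
apply: cvgB; first exact: nondecreasing_cvgn.
apply: cvgMl_tmp; apply: cvgMl_tmp.
by apply: cvg_comp atan_cvg; exact: cvgr_idn.
Qed.

Lemma cosint_continuous N : continuous (cosint h th N).
Proof.
move=> xi; apply/cvgrPdist_le => e e0.
have N0 : 0 <= (N%:R : R) by [].
(* Here |h| <= A, the cosine is Lipschitz in xi with constant |y| <= N, and the interval has length
   2N. *)
pose C := A * N%:R * (2 * N%:R) + 1.
have C0 : 0 < C by rewrite ltr_wpDl// !mulr_ge0.
exists (e / C) => /=; first by rewrite divr_gt0.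
move=> z; rewrite /ball /= ltr_pdivlMr// => hz.
have NN : - (N%:R : R) <= N%:R by lra.
rewrite !cosintE.
have dPP : derives (fun y => P xi y - P z y)
  (fun y => h y * cos (xi * y + th) - h y * cos (z * y + th)).
  by move=> y; have := @dP xi => ?; have := @dP z => ?; derive_rule.
have dl : derives (fun y : R => A * N%:R * `|xi - z| * y) (fun=> A * N%:R * `|xi - z|).
  by move=> y; derive_rule; ring.
have := derive_dist_le NN dPP dl _.
rewrite (_ : P xi N%:R - P z N%:R - (P xi (- N%:R) - P z (- N%:R)) =
   P xi N%:R - P xi (- N%:R) - (P z N%:R - P z (- N%:R))); last by ring.
move=> H; apply: le_trans (H _) _.
  move=> y yN; rewrite -mulrBr normrM -mulrA; apply: ler_pM => //.
    apply: le_trans (hA y) _; rewrite ler_piMr// invf_le1 ?oneDsq_gt0//.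
    by rewrite lerDl sqr_ge0.
  apply: le_trans (cos_lipschitz _ _) _.
  rewrite (_ : xi * y + th - (z * y + th) = y * (xi - z)); last by ring.
  by rewrite normrM ler_wpM2r// ler_norml.
have := normr_ge0 (xi - z); rewrite /C in hz; lra.
Qed.

Lemma cosint_limit : exists chat : R -> R, [/\ measurable_fun setT chat,
  forall xi, cosint h th N xi @[N --> \oo] --> chat xi &
  exists2 B : nat -> R, B N @[N --> \oo] --> (0 : R) &
    forall N xi, (chat xi - cosint h th N xi) ^+ 2 <= B N * (1 + xi ^+ 2)^-1].
Proof.
have [chat hc] := choice cosint_cvg.
exists chat; split => //.
  apply/measurable_EFinP.
  apply: (emeasurable_fun_cvg (fun N xi => (cosint h th N xi)%:E)) => //.
    move=> N; apply/measurable_EFinP; apply: continuous_measurable_fun.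
    exact: cosint_continuous.
  by move=> xi _; apply/fine_cvgP; split; [by apply: nearW|exact: hc].
exists (fun N => 2 * (T N * T N)).
  have -> : (0 : R) = 2 * (0 * 0) by ring.
  by apply: cvgMl_tmp; apply: cvgM; exact: T_cvg.
move=> N xi.
have lim_le (c t : R) : (forall M, (N <= M)%N -> `|c * (cosint h th M xi - cosint h th N xi)| <= t) ->
    `|c * (chat xi - cosint h th N xi)| <= t.
  move=> H; have cv : `|c * (cosint h th M xi - cosint h th N xi)| @[M --> \oo] -->
      `|c * (chat xi - cosint h th N xi)|.
    by apply: cvg_norm; apply: cvgMl_tmp; apply: cvgB; [exact: hc|exact: cvg_cst].
  apply: (@closed_cvg _ _ _ _ (fun x => `|c * (cosint h th x xi - cosint h th N xi)|) [set x | x <= t]) cv.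
    exact: closed_le.
  by exists N => // M /= /H.
have t1 : `|chat xi - cosint h th N xi| <= T N.
  rewrite -[X in `|X|]mul1r; apply: lim_le => M NM.
  by rewrite mul1r; case: (cosint_diff xi NM).
have t2 : `|xi * (chat xi - cosint h th N xi)| <= T N.
  by apply: lim_le => M NM; case: (cosint_diff xi NM).
(* |x| <= T and |xi x| <= T give (1 + xi^2) x^2 <= 2 T^2. *)
rewrite ler_pdivlMr ?oneDsq_gt0//.
have sq (x : R) : `|x| <= T N -> x ^+ 2 <= T N * T N.
  by move=> hx; rewrite -real_normK ?num_real// expr2 ler_pM.
have := sq _ t1; have := sq _ t2; rewrite exprMn; lra.
Qed.

End fourier_tail.

Section fourier.
Context {R : realType}.
Notation mu := (@lebesgue_measure R).
Local Open Scope complex_scope.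

Lemma sin_2pin (n : int) : sin (n%:~R * (2 * pi)) = 0 :> R.
Proof.
wlog [m ->] : n / exists m : nat, n = m.
  move=> H; case: n => n; first by apply: H; exists n.
  by rewrite NegzE mulrNz mulNr sinN H ?oppr0//; exists n.+1.
have := periodicn (@sinD2pi R) m 0; rewrite add0r sin0 => <-; congr sin.
by rewrite -pmulrn -mulrnA -[RHS]mulr_natl natrM; ring.
Qed.

Lemma cos_2pin (n : int) : cos (n%:~R * (2 * pi)) = 1 :> R.
Proof.
wlog [m ->] : n / exists m : nat, n = m.
  move=> H; case: n => n; first by apply: H; exists n.
  by rewrite NegzE mulrNz mulNr cosN H//; exists n.+1.
have := periodicn (@cosD2pi R) m 0; rewrite add0r cos0.
apply: etrans; congr cos.
by rewrite -pmulrn -mulrnA -[RHS]mulr_natl natrM; ring.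
Qed.

Lemma cos_lin_cont (c : R) : continuous (fun x => cos (c * x)).
Proof. by apply: (@derives_continuous _ _ (fun y => - sin (c * y) * c)) => y; derive_rule; ring. Qed.

Lemma sin_lin_cont (c : R) : continuous (fun x => sin (c * x)).
Proof. by apply: (@derives_continuous _ _ (fun y => cos (c * y) * c)) => y; derive_rule; ring. Qed.

Lemma twopi_ge0 : 0 <= 2 * pi :> R. Proof. by rewrite mulr_ge0// pi_ge0. Qed.

Lemma int_cos (n : int) :
  Rintegral mu `[0, 2 * pi] (fun x => cos (n%:~R * x)) = if n == 0 then 2 * pi else 0.
Proof.
case: eqVneq => [->|n0].
  rewrite (@Rintegral_FTC _ (fun x => x) _ _ _ twopi_ge0); [by rewrite subr0| |exact: cos_lin_cont].
  by move=> y; rewrite mul0r cos0; exact: is_derive_fid.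
have n0' : (n%:~R : R) != 0 by rewrite intr_eq0.
rewrite (@Rintegral_FTC _ (fun x => sin (n%:~R * x) / n%:~R) _ _ _ twopi_ge0).
- by rewrite sin_2pin mulr0 sin0 mul0r subrr.
- by move=> y; derive_rule; field.
- exact: cos_lin_cont.
Qed.

Lemma int_sin (n : int) : Rintegral mu `[0, 2 * pi] (fun x => sin (n%:~R * x)) = 0.
Proof.
case: (eqVneq n 0) => [->|n0].
  rewrite (@Rintegral_FTC _ (fun=> 0) _ _ _ twopi_ge0); [by rewrite subr0| |exact: sin_lin_cont].
  by move=> y; rewrite mul0r sin0; exact: is_derive_fcst.
have n0' : (n%:~R : R) != 0 by rewrite intr_eq0.
rewrite (@Rintegral_FTC _ (fun x => - cos (n%:~R * x) / n%:~R) _ _ _ twopi_ge0).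
- by rewrite cos_2pin mulr0 cos0 subrr.
- by move=> y; derive_rule; field.
- exact: sin_lin_cont.
Qed.

Lemma Rintegral_half_sum (f g : R -> R) (a b : R) : continuous f -> continuous g ->
  Rintegral mu `[a, b] (fun x => (f x + g x) / 2) =
  (Rintegral mu `[a, b] f + Rintegral mu `[a, b] g) / 2.
Proof.
move=> cf cg.
rewrite -(@RintegralD _ _ _ mu `[a, b]); [|by []|exact: integrable_seg|exact: integrable_seg].
rewrite -RintegralZr//.
by apply: (@integrable_seg _ a b (fun x => f x + g x)) => x; apply: cvgD; [exact: cf|exact: cg].
Qed.

Lemma int_coscos (k : nat) (j : int) : (0 < k)%N ->
  Rintegral mu `[0, 2 * pi] (fun x => cos (k%:R * x) * cos (j%:~R * x)) =
  if `|j|%N == k then pi else 0.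
Proof.
move=> k0.
have E (x : R) : cos (k%:R * x) * cos (j%:~R * x) =
   (cos ((k%:Z + j)%:~R * x) + cos ((k%:Z - j)%:~R * x)) / 2.
  by rewrite intrD intrB !mulrDl mulNr cosD cosB -!pmulrn; field.
rewrite (funext E) Rintegral_half_sum; [|exact: cos_lin_cont|exact: cos_lin_cont].
rewrite !int_cos.
have [jk|jk] := eqVneq `|j|%N k; last first.
  by rewrite !ifF ?addr0 ?mul0r//; apply/negbTE; lia.
have [j0|j0] := leP 0 j.
  rewrite ifF; last by apply/negbTE; lia.
  by rewrite ifT; [field|lia].
rewrite ifT; last lia.
by rewrite ifF; [field|apply/negbTE; lia].
Qed.

Lemma int_cossin (k : nat) (j : int) :
  Rintegral mu `[0, 2 * pi] (fun x => cos (k%:R * x) * sin (j%:~R * x)) = 0.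
Proof.
have E (x : R) : cos (k%:R * x) * sin (j%:~R * x) =
   (sin ((j + k%:Z)%:~R * x) + sin ((j - k%:Z)%:~R * x)) / 2.
  by rewrite intrD intrB !mulrDl mulNr sinD sinB -!pmulrn; field.
rewrite (funext E) Rintegral_half_sum; [|exact: sin_lin_cont|exact: sin_lin_cont].
by rewrite !int_sin addr0 mul0r.
Qed.

Lemma Rintegral_rectD a b c d (F G : R * R -> R) : continuous F -> continuous G ->
  Rintegral mu2 (rect a b c d) (fun p => F p + G p) =
  Rintegral mu2 (rect a b c d) F + Rintegral mu2 (rect a b c d) G.
Proof.
move=> cF cG; rewrite RintegralD//; first exact: measurable_rect.
- exact: integrable_rect.
- exact: integrable_rect.
Qed.

(** Orthogonality on [0, 2 pi] leaves only j = k and j = -k, each with integral pi; division by 2 pi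
    gives the factor 1/2. *)
Lemma fourier_trunc_cos (k : nat) (h : R -> R) (N : nat) (j : int) (xi : R) : (0 < k)%N ->
  continuous h ->
  fourier_trunc N (fun p => (cos (k%:R * p.1) * h p.2)%:C) j xi =
  if `|j|%N == k then (cosint h 0 N xi / 2) -i* (cosint h (- (pi / 2)) N xi / 2) else 0.
Proof.
move=> k0 ch.
have cc := @cos_lin_cont k%:R.
have c1 : continuous (fun x : R => cos (k%:R * x) * cos (j%:~R * x)).
  by move=> x; apply: cvgM; [exact: cc|exact: cos_lin_cont].
have c2 : continuous (fun x : R => cos (k%:R * x) * sin (j%:~R * x)).
  by move=> x; apply: cvgM; [exact: cc|exact: sin_lin_cont].
have h1 th : continuous (fun y : R => h y * cos (xi * y + th)).
  by move=> y; apply: cvgM; [exact: ch|exact: cos_aff_cont].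
have h1N th : continuous (fun y : R => - (h y * cos (xi * y + th))).
  by move=> y; apply: cvgN; exact: h1.
have tc th : continuous (fun p : R * R => (cos (k%:R * p.1) * cos (j%:~R * p.1)) * (h p.2 * cos (xi * p.2 + th))).
  exact: (continuous_tensor c1 (h1 th)).
have ts th : continuous (fun p : R * R => (cos (k%:R * p.1) * sin (j%:~R * p.1)) * (- (h p.2 * cos (xi * p.2 + th)))).
  exact: (continuous_tensor c2 (h1N th)).
have tcN th : continuous (fun p : R * R => (cos (k%:R * p.1) * cos (j%:~R * p.1)) * (- (h p.2 * cos (xi * p.2 + th)))).
  exact: (continuous_tensor c1 (h1N th)).
have sN th : Rintegral mu `[- N%:R, N%:R] (fun y => - (h y * cos (xi * y + th))) = - cosint h th N xi.
  have -> : (fun y => - (h y * cos (xi * y + th))) = (fun y => -1 * (h y * cos (xi * y + th))).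
    by apply/funext => y; rewrite mulN1r.
  by rewrite RintegralZl ?mulN1r//; exact: integrable_seg.
have Re_eq : Rintegral mu2 (rect 0 (2 * pi) (- N%:R) N%:R)
    (fun p => complex.Re ((cos (k%:R * p.1) * h p.2)%:C * expNi (j%:~R * p.1 + xi * p.2))) =
    (if `|j|%N == k then pi else 0) * cosint h 0 N xi.
  have -> : (fun p => complex.Re ((cos (k%:R * p.1) * h p.2)%:C * expNi (j%:~R * p.1 + xi * p.2))) =
   (fun p : R * R => (cos (k%:R * p.1) * cos (j%:~R * p.1)) * (h p.2 * cos (xi * p.2 + 0)) +
      (cos (k%:R * p.1) * sin (j%:~R * p.1)) * (- (h p.2 * cos (xi * p.2 + (- (pi / 2)))))).
    by apply/funext => p /=; rewrite mul0r subr0 cosBpihalf addr0 cosD; ring.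
  rewrite Rintegral_rectD; [|exact: tc|exact: ts].
  rewrite (Rintegral_tensor _ _ _ _ c1 (h1 0)) (Rintegral_tensor _ _ _ _ c2 (h1N _)).
  by rewrite int_coscos// int_cossin mul0r addr0.
have Im_eq : Rintegral mu2 (rect 0 (2 * pi) (- N%:R) N%:R)
    (fun p => complex.Im ((cos (k%:R * p.1) * h p.2)%:C * expNi (j%:~R * p.1 + xi * p.2))) =
    - ((if `|j|%N == k then pi else 0) * cosint h (- (pi / 2)) N xi).
  have -> : (fun p => complex.Im ((cos (k%:R * p.1) * h p.2)%:C * expNi (j%:~R * p.1 + xi * p.2))) =
   (fun p : R * R => (cos (k%:R * p.1) * cos (j%:~R * p.1)) * (- (h p.2 * cos (xi * p.2 + (- (pi / 2))))) +
      (cos (k%:R * p.1) * sin (j%:~R * p.1)) * (- (h p.2 * cos (xi * p.2 + 0)))).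
    by apply/funext => p /=; rewrite mul0r addr0 cosBpihalf addr0 sinD; ring.
  rewrite Rintegral_rectD; [|exact: tcN|exact: ts].
  rewrite (Rintegral_tensor _ _ _ _ c1 (h1N _)) (Rintegral_tensor _ _ _ _ c2 (h1N _)).
  by rewrite int_coscos// int_cossin mul0r addr0 sN mulrN.
rewrite /fourier_trunc /integral_C -/(rect 0 (2 * pi) (- N%:R) N%:R) Re_eq Im_eq.
have p0 : (pi : R) != 0 by rewrite gt_eqF// pi_gt0.
have X (c : R) : (2 * pi)^-1 * (pi * c) = c / 2.
  by rewrite invfM -mulrA mulKf// mulrC.
case: ifP => _; apply/eqP; rewrite eq_complex /= !mul0r subr0 addr0 mulrN.
  by rewrite !X !eqxx.
by rewrite !mulr0 oppr0 !eqxx.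
Qed.

End fourier.

(** * Fourier transforms of separated functions and the second order equation *)

Section multiplier.
Context {R : realType}.
Notation mu := (@lebesgue_measure R).
Local Open Scope complex_scope.

(** The sum is dominated by two point masses, at k and at -k. *)
Lemma esum_absz_le (k : nat) (a : int -> \bar R) (c : R) : 0 <= c -> (forall j, (0 <= a j)%E) ->
  (forall j : int, (a j <= (if `|j|%N == k then c else 0)%:E)%E) ->
  (esum [set: int] a <= (2 * c)%:E)%E.
Proof.
move=> c0 a0 ac.
have one (z : int) : esum [set: int] (fun j => if j \in [set z] then c%:E else 0%E) = c%:E.
  by rewrite -(esum_mkcond [set z] (fun=> c%:E)) esum_set1// lee_fin.
have i0 (z j : int) : (0 <= if j \in [set z] then c%:E else 0 :> \bar R)%E.
  by case: ifP => _ //; rewrite lee_fin.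
pose b (z j : int) : \bar R := if j \in [set z] then c%:E else 0%E.
apply: (@le_trans _ _ (esum [set: int] (fun j => b k%:Z j + b (- k%:Z)%R j)%E)).
  apply: le_esum => j _; apply: le_trans (ac j) _.
  case: eqP => [jk|_]; last by apply: adde_ge0; exact: i0.
  have [->|->] : j = k%:Z \/ j = - k%:Z by lia.
    by rewrite {1}/b ifT ?inE// leeDl// i0.
  by rewrite {2}/b ifT ?inE// leeDr// i0.
rewrite esumD//; try by move=> j _; exact: i0.
by rewrite !one -EFinD lee_fin; lra.
Qed.

Lemma measurable_normsq (z : R -> R[i]) : measurable_C setT z ->
  measurable_fun setT (fun t => normsq (z t)).
Proof.
by move=> [m1 m2]; apply: measurable_funD; apply: measurable_funX.
Qed.

Lemma sq_norm_dual_le (k : nat) (F : int -> R -> R[i]) (B : R) : 0 <= B ->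
  (forall j, measurable_C setT (F j)) ->
  (forall j xi, normsq (F j xi) <= if `|j|%N == k then B * (1 + xi ^+ 2)^-1 else 0) ->
  (sq_norm_dual F <= (2 * (B * pi))%:E)%E.
Proof.
move=> B0 mF hF; have n0 j xi : 0 <= normsq (F j xi) by rewrite addr_ge0 ?sqr_ge0.
apply: (@esum_absz_le k); first by rewrite mulr_ge0// pi_ge0.
  by move=> j; apply: integral_ge0 => xi _; rewrite lee_fin.
move=> j; have mj := measurable_normsq (mF j).
case: ifPn => jk; last first.
  rewrite integral0_eq// => xi _; congr EFin.
  by apply/eqP; rewrite eq_le n0 andbT; have := hF j xi; rewrite (negbTE jk).
rewrite EFinM -integral_oneDsq -ge0_integralZl//; last 2 first.
- apply/measurable_EFinP; apply: continuous_measurable_fun; exact: continuous_oneDsqrV.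
- by move=> x _; rewrite lee_fin invr_ge0 ltW// oneDsq_gt0.
apply: ge0_le_integral => //.
- by move=> xi _; rewrite lee_fin.
- exact/measurable_EFinP.
- apply/measurable_EFinP; apply: measurable_funM; first exact: measurable_cst.
  by apply: continuous_measurable_fun; exact: continuous_oneDsqrV.
- by move=> xi _; rewrite -EFinM lee_fin; have := hF j xi; rewrite jk.
Qed.

Lemma is_fourier_cos (k : nat) (h h1 : R -> R) (A : R) : (0 < k)%N ->
  derives h h1 ->
  (forall y, `|h y| <= A * (1 + y ^+ 2)^-1) -> (forall y, `|h1 y| <= A * (1 + y ^+ 2)^-1) ->
  exists c0 c1 : R -> R,
   [/\ forall xi, cosint h 0 N xi @[N --> \oo] --> c0 xi,
       forall xi, cosint h (- (pi / 2)) N xi @[N --> \oo] --> c1 xi &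
       is_fourier (fun p => (cos (k%:R * p.1) * h p.2)%:C)
         (fun j xi => if `|j|%N == k then (c0 xi / 2) -i* (c1 xi / 2) else 0)].
Proof.
move=> k0 dh hA h1A.
have ch := derives_continuous dh.
have hL2 : L2 (fun p : R * R => (cos (k%:R * p.1) * h p.2)%:C).
  apply: (@L2_tensor _ (fun x => cos (k%:R * x))) => //; first exact: cos_lin_cont.
    move=> x; rewrite mulrDr cosD (cos_2pin k) (sin_2pin k) mulr1 mulr0 subr0//.
  by exists A.
have [c0 [m0 cv0 [B0 B0c h0]]] := cosint_limit 0 dh hA h1A.
have [c1 [m1 cv1 [B1 B1c h1']]] := cosint_limit (- (pi / 2)) dh hA h1A.
exists c0, c1; split => //.
have pos (B : nat -> R) N (f : R -> R) : (forall xi, (f xi) ^+ 2 <= B N * (1 + xi ^+ 2)^-1) -> 0 <= B N.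
  by move=> /(_ 0); rewrite expr0n /= addr0 invr1 mulr1; apply: le_trans; exact: sqr_ge0.
have B0p N : 0 <= B0 N := pos B0 N _ (h0 N).
have B1p N : 0 <= B1 N := pos B1 N _ (h1' N).
have mc th N : measurable_fun setT (cosint h th N).
  by apply: continuous_measurable_fun; exact: (cosint_continuous dh hA).
pose F (j : int) (xi : R) : R[i] := if `|j|%N == k then (c0 xi / 2) -i* (c1 xi / 2) else 0.
rewrite -/F.
have mF j : measurable_C setT (F j).
  rewrite /F; case: (`|j|%N == k); split => /=; try exact: measurable_cst.
    by apply: measurable_funM => //; exact: measurable_cst.
  by apply: measurable_funN; apply: measurable_funM => //; exact: measurable_cst.
pose D N j xi := F j xi - fourier_trunc N (fun p => (cos (k%:R * p.1) * h p.2)%:C) j xi.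
have DE N j xi : D N j xi = if `|j|%N == k then
    ((c0 xi - cosint h 0 N xi) / 2) -i* ((c1 xi - cosint h (- (pi / 2)) N xi) / 2) else 0.
  rewrite /D fourier_trunc_cos// /F; case: ifP => _; last by rewrite subrr.
  by apply/eqP; rewrite eq_complex /=; apply/andP; split; apply/eqP; ring.
have mD N j : measurable_C setT (D N j).
  rewrite (funext (DE N j)); case: (`|j|%N == k); split => /=; try exact: measurable_cst.
    by apply: measurable_funM; [exact: measurable_funB|exact: measurable_cst].
  by apply: measurable_funN; apply: measurable_funM; [exact: measurable_funB|exact: measurable_cst].
have nD N j xi : normsq (D N j xi) <= if `|j|%N == k then (B0 N + B1 N) * (1 + xi ^+ 2)^-1 else 0.
  rewrite DE; case: ifP => _; last by rewrite /normsq /= expr0n /= addr0.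
  have := h0 N xi; have := h1' N xi; rewrite /normsq /=.
  have := sqr_ge0 (c0 xi - cosint h 0 N xi); have := sqr_ge0 (c1 xi - cosint h (- (pi / 2)) N xi).
  by rewrite sqrrN !expr_div_n; lra.
have Dle N : (sq_norm_dual (D N) <= (2 * ((B0 N + B1 N) * pi))%:E)%E.
  by apply: (@sq_norm_dual_le k) => //; exact: addr_ge0.
split => //.
- split => //.
  (* At N = 0 the truncated transform is an integral over a null set, so the error is [F] itself,
     and the error bound shows that [F] is square integrable. *)
  have E0 : D 0%N = F.
    have z th xi : cosint h th 0 xi = 0.
      by rewrite /cosint oppr0 set_itv1 Rintegral_set1.
    apply/funext => j; apply/funext => xi; rewrite DE /F !z !subr0//.
  by rewrite -E0; apply: le_lt_trans (Dle 0%N) _; rewrite ltry.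
- apply: (@squeeze_cvge _ _ _ _ (fun=> 0%E) _ (fun N => (2 * ((B0 N + B1 N) * pi))%:E)).
  + apply: nearW => N; rewrite Dle andbT; apply: esum_ge0 => j _.
    by apply: integral_ge0 => xi _; rewrite lee_fin addr_ge0 ?sqr_ge0.
  + exact: cvg_cst.
  + apply/fine_cvgP; split; first by apply: nearW.
    have -> : (0 : R) = 2 * ((0 + 0) * pi) by ring.
    by apply: cvgMl_tmp; apply: cvgMr_tmp; apply: cvgD.
Qed.

(* Two integrations by parts turn h = u - u''/k^2 into (1 + xi^2/k^2) on the Fourier side. *)
Lemma cosint_second_order (k : R) (u v s : R -> R) th N xi : k != 0 ->
  derives u v -> derives v s -> continuous s ->
  cosint (fun y => u y - s y / k ^+ 2) th N xi =
  (1 + xi ^+ 2 / k ^+ 2) * cosint u th N xi -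
  ((v N%:R * cos (xi * N%:R + th) + xi * u N%:R * sin (xi * N%:R + th)) -
   (v (- N%:R) * cos (xi * - N%:R + th) + xi * u (- N%:R) * sin (xi * - N%:R + th))) / k ^+ 2.
Proof.
move=> k0 du dv cs.
have cc : continuous (fun y : R => cos (xi * y + th)) by exact: cos_aff_cont.
have cu0 := derives_continuous du.
have cu : continuous (fun y => u y * cos (xi * y + th)).
  by move=> y; apply: cvgM; [exact: cu0|exact: cc].
have [_ dP] := primitive_at0P cu; set P := primitive_at0 _ in dP.
have N0 : 0 <= (N%:R : R) by [].
have NN : - (N%:R : R) <= N%:R by lra.
rewrite /cosint (Rintegral_FTC NN dP cu).
rewrite (@Rintegral_FTC _ (fun y => (1 + xi ^+ 2 / k ^+ 2) * P y -
  (v y * cos (xi * y + th) + xi * u y * sin (xi * y + th)) / k ^+ 2) _ _ _ NN).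
- by ring.
- by move=> y; derive_rule; field.
- move=> y; apply: cvgM; last exact: cc.
  by apply: cvgB; [exact: cu0|apply: cvgMr_tmp; exact: cs].
Qed.

End multiplier.

(** * Eigenfunctions *)

Section eigen.
Context {R : realType}.
Notation mu := (@lebesgue_measure R).
Local Open Scope complex_scope.

Lemma not_ae_zero (k : nat) (h : R -> R) (y0 : R) : (0 < k)%N -> continuous h -> h y0 != 0 ->
  ~ ae_equal (fun p : R * R => (cos (k%:R * p.1) * h p.2)%:C) (fun=> 0).
Proof.
move=> k0 ch h0 [B [mB B0 hB]].
have kp : 0 < (k%:R : R) by rewrite ltr0n.
have nh : 0 < `|h y0| by rewrite normr_gt0.
have /cvgr_dist_lt/(_ _ nh)[d /= d0 hd] := ch y0.
have k1 : 1 <= (k%:R : R) by rewrite ler1n.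
(* On [0, a] one has k x <= 1/2 < pi/2, so the cosine is positive; a <= 1 keeps the interval inside
   [0, 2 pi]. *)
pose a : R := (2 * k%:R)^-1.
have a0 : 0 < a by rewrite invr_gt0 mulr_gt0.
have a1 : a <= 1 by rewrite invf_le1 ?mulr_gt0//; lra.
have pi1 := @pihalf_ge1 R.
have sub : rect 0 a (y0 - d / 2) (y0 + d / 2) `<=` B.
  move=> [x y] [/=]; rewrite !in_itv /= => /andP[x0 xa] /andP[y1 y2].
  apply: hB => /= H.
  have Ox : Omega (x, y) by split => //=; rewrite in_itv /= x0 /=; lra.
  have /= := H Ox => /(congr1 (@complex.Re R)) /= /eqP.
  rewrite mulf_eq0 => /orP[/eqP cx|/eqP hy].
    have : 0 < cos (k%:R * x).
      apply: cos_gt0_pihalf; apply/andP; split.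
        by apply: lt_le_trans (mulr_ge0 (ltW kp) x0); lra.
      suff : k%:R * x <= 2^-1 by lra.
      by rewrite mulrC -ler_pdivlMr//; move: xa; rewrite /a invfM.
    by rewrite cx ltxx.
  have : `|y0 - y| < d by rewrite ltr_norml; apply/andP; split; lra.
  by move=> /hd /=; rewrite hy subr0 ltxx.
have : (0 < mu2 (rect 0 a (y0 - d / 2) (y0 + d / 2)))%E.
  by apply: mu2_rect_gt0 => //; lra.
apply/negP; rewrite -leNgt -B0; apply: le_measure => //; rewrite inE//.
exact: measurable_rect.
Qed.

Lemma cvg_decay0 (f : R -> R) (A : R) : (forall y, `|f y| <= A * (1 + y ^+ 2)^-1) ->
  f N%:R @[N --> \oo] --> (0 : R) /\ f (- N%:R) @[N --> \oo] --> (0 : R).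
Proof.
move=> hf.
have cI : A * (1 + N%:R ^+ 2 : R)^-1 @[N --> \oo] --> (0 : R).
  by rewrite -(mulr0 A); apply: cvgMl_tmp; exact: inv_oneDsq_cvg0.
have cIN : - (A * (1 + N%:R ^+ 2 : R)^-1) @[N --> \oo] --> (0 : R).
  by rewrite -oppr0; apply: cvgN.
split; apply: squeeze_cvgr cIN cI; apply: nearW => N; rewrite -ler_norml.
  exact: hf.
by apply: le_trans (hf _) _; rewrite sqrrN.
Qed.

(** For fixed xi the boundary terms of [cosint_second_order] inherit the decay of [u] and [v], so
    they vanish in the limit. *)
Lemma cvg_cosint_second_order (k : R) (u v s : R -> R) (A th xi cw cu : R) : k != 0 ->
  derives u v -> derives v s -> continuous s ->
  (forall y, `|u y| <= A * (1 + y ^+ 2)^-1) -> (forall y, `|v y| <= A * (1 + y ^+ 2)^-1) ->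
  cosint u th N xi @[N --> \oo] --> cu ->
  cosint (fun y => u y - s y / k ^+ 2) th N xi @[N --> \oo] --> cw ->
  cw = (1 + xi ^+ 2 / k ^+ 2) * cu.
Proof.
move=> k0 du dv cs uA vA hu hw.
pose b y := v y * cos (xi * y + th) + xi * u y * sin (xi * y + th).
have bA y : `|b y| <= (A + `|xi| * A) * (1 + y ^+ 2)^-1.
  have q0 : 0 <= (1 + y ^+ 2)^-1 by rewrite invr_ge0 ltW// oneDsq_gt0.
  rewrite mulrDl -mulrA; apply: le_trans (ler_normD _ _) _; apply: lerD.
    apply: le_trans (vA y); rewrite normrM ler_piMr//.
    by rewrite ler_norml cos_geN1 cos_le1.
  rewrite -mulrA normrM ler_wpM2l//; apply: le_trans (uA y); rewrite normrM ler_piMr//.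
  by rewrite ler_norml sin_geN1 sin_le1.
have [b1 b2] := cvg_decay0 bA.
apply: (@cvg_unique _ _ (cosint (fun y => u y - s y / k ^+ 2) th N xi @[N --> \oo])) => //.
have -> : (fun N => cosint (fun y => u y - s y / k ^+ 2) th N xi) =
    (fun N => (1 + xi ^+ 2 / k ^+ 2) * cosint u th N xi - (b N%:R - b (- N%:R)) / k ^+ 2).
  by apply/funext => N; rewrite (cosint_second_order _ _ _ k0 du dv cs).
have -> : (1 + xi ^+ 2 / k ^+ 2) * cu = (1 + xi ^+ 2 / k ^+ 2) * cu - (0 - 0) / k ^+ 2.
  by rewrite subrr mul0r subr0.
apply: cvgB; first exact: cvgMl_tmp.
by apply: cvgMr_tmp; apply: cvgB.
Qed.

(** The equation turns u - u''/k^2 into m g u, a form in which decay is visible without a second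
    derivative. On the Fourier side 1 + xi^2/k^2 is the inverse of the symbol at j = k and j = -k,
    so the multiplier yields cos(kx) u, and g times this is w / m. *)
Lemma eigenfunction_cos (k : nat) (g g1 u v : R -> R) (m G A y0 : R) : (0 < k)%N -> 0 < m ->
  derives g g1 -> continuous g1 -> (forall y, `|g y| <= G) -> (forall y, `|g1 y| <= G) ->
  solves (hill (k%:R ^+ 2) g m) u v ->
  (forall y, `|u y| <= A * (1 + y ^+ 2)^-1) -> (forall y, `|v y| <= A * (1 + y ^+ 2)^-1) ->
  g y0 != 0 -> u y0 != 0 ->
  eigenfunction g (m^-1)%:C (fun p => (cos (k%:R * p.1) * (m * g p.2 * u p.2))%:C).
Proof.
move=> k0 m0 dg cg1 gG g1G s uA vA gy0 uy0; have [cu cv] := solves_cont s.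
have cg := derives_continuous dg.
case: s => du dv.
have kn : (k%:R : R) != 0 by rewrite pnatr_eq0 -lt0n.
pose wt y := m * g y * u y.
pose wt1 y := m * (g1 y * u y + g y * v y).
have dw : derives wt wt1 by move=> y; rewrite /wt /wt1; derive_rule; ring.
have cw := derives_continuous dw.
have G0 : 0 <= G := le_trans (normr_ge0 _) (gG 0).
have A0 : 0 <= A by have := le_trans (normr_ge0 _) (uA 0); rewrite expr0n /= addr0 invr1 mulr1.
have q0 y : 0 <= (1 + y ^+ 2 : R)^-1 by rewrite invr_ge0 ltW// oneDsq_gt0.
have gu y : `|g y * u y| <= G * (A * (1 + y ^+ 2)^-1) by rewrite normrM ler_pM.
have g1u y : `|g1 y * u y| <= G * (A * (1 + y ^+ 2)^-1) by rewrite normrM ler_pM.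
have gv y : `|g y * v y| <= G * (A * (1 + y ^+ 2)^-1) by rewrite normrM ler_pM.
have X y : 0 <= m * (G * (A * (1 + y ^+ 2)^-1)) by rewrite !mulr_ge0// ltW.
have wA y : `|wt y| <= (2 * (m * (G * A))) * (1 + y ^+ 2)^-1.
  rewrite /wt -mulrA normrM gtr0_norm//.
  have := gu y; rewrite -(ler_pM2l m0); have := X y; lra.
have w1A y : `|wt1 y| <= (2 * (m * (G * A))) * (1 + y ^+ 2)^-1.
  rewrite /wt1 normrM gtr0_norm//.
  have h : `|g1 y * u y + g y * v y| <= 2 * (G * (A * (1 + y ^+ 2)^-1)).
    by apply: le_trans (ler_normD _ _) _; have := g1u y; have := gv y; lra.
  by move: h; rewrite -(ler_pM2l m0); lra.
have [cu0 [cu1 [hu0 hu1 Fu]]] := is_fourier_cos k0 du uA vA.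
have [cw0 [cw1 [hw0 hw1 Fw]]] := is_fourier_cos k0 dw wA w1A.
have cs : continuous (fun y => hill (k%:R ^+ 2) g m y * u y).
  by move=> y; apply: cvgM; [exact: hill_cont|exact: cu].
have wE : (fun y => u y - hill (k%:R ^+ 2) g m y * u y / k%:R ^+ 2) = wt.
  by apply/funext => y; rewrite /hill /wt; field.
have E0 xi : cw0 xi = (1 + xi ^+ 2 / k%:R ^+ 2) * cu0 xi.
  by apply: (cvg_cosint_second_order kn du dv cs uA vA (hu0 xi)); rewrite wE; exact: hw0.
have E1 xi : cw1 xi = (1 + xi ^+ 2 / k%:R ^+ 2) * cu1 xi.
  by apply: (cvg_cosint_second_order kn du dv cs uA vA (hu1 xi)); rewrite wE; exact: hw1.
have L2w : L2 (fun p : R * R => (cos (k%:R * p.1) * wt p.2)%:C) by case: Fw.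
split => //.
  apply: (@not_ae_zero k wt y0) => //.
  by rewrite /wt !mulf_neq0// gt_eqF.
exists (fun p => (cos (k%:R * p.1) * u p.2)%:C); split.
  exists (fun j xi => if `|j|%N == k then (cw0 xi / 2) -i* (cw1 xi / 2) else 0); split; first exact: Fw.
  rewrite (_ : (fun j xi => _) = (fun j xi => if `|j|%N == k then (cu0 xi / 2) -i* (cu1 xi / 2) else 0)).
    exact: Fu.
  apply/funext => j; apply/funext => xi; case: eqP => [jk|_]; last by rewrite mulr0.
  have j0 : j != 0 by apply: contraTneq k0 => j0; rewrite -jk j0.
  have j2 : (j%:~R : R) ^+ 2 = k%:R ^+ 2.
    have [->|->] : j = k%:Z \/ j = - k%:Z by lia.
      by [].
    by rewrite mulrNz sqrrN.
  have S : symbol j xi * (1 + xi ^+ 2 / k%:R ^+ 2) = 1.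
    rewrite /symbol (negbTE j0) j2; field; rewrite kn /=.
    by rewrite gt_eqF// ltr_pwDl ?sqr_ge0// exprn_gt0// ltr0n.
  apply/eqP; rewrite eq_complex /= !mul0r subr0 addr0 E0 E1 mulrN.
  by rewrite !mulrA S !mul1r !eqxx.
exists set0; split; [exact: measurable0|exact: measure0|].
move=> p /= H; exfalso; apply: H => _.
apply/eqP; rewrite eq_complex /= !mul0r !mulr0 !subr0 !addr0 eqxx andbT.
by apply/eqP; field; rewrite gt_eqF.
Qed.

End eigen.

(** * Weak derivatives *)

Section weak.
Context {R : realType}.
Notation mu := (@lebesgue_measure R).
Local Open Scope complex_scope.

Lemma Rintegral_parts (F f G g : R -> R) (a b : R) : a <= b -> derives F f -> derives G g ->
  continuous f -> continuous g -> F b * G b = F a * G a ->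
  Rintegral mu `[a, b] (fun x => F x * g x) = Rintegral mu `[a, b] (fun x => - (f x * G x)).
Proof.
move=> ab dF dG cf cg e.
have cF := derives_continuous dF; have cG := derives_continuous dG.
have c1 : continuous (fun x => F x * g x) by move=> x; apply: cvgM; [exact: cF|exact: cg].
have c2 : continuous (fun x => - (f x * G x)).
  by move=> x; apply: cvgN; apply: cvgM; [exact: cf|exact: cG].
have dFG : derives (fun x => F x * G x) (fun x => F x * g x - - (f x * G x)).
  by move=> x; derive_rule; ring.
apply/eqP; rewrite -subr_eq0 -(@RintegralB _ _ _ mu `[a, b]); last 3 first.
- exact: measurable_itv.
- exact: integrable_seg.
- exact: integrable_seg.
rewrite (@Rintegral_FTC _ (fun x => F x * G x) _ _ _ ab dFG) ?e ?subrr//.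
by move=> x; apply: cvgB; [exact: c1|exact: c2].
Qed.

Lemma is_derive_unique (f : R -> R) (x a b : R) : is_derive x 1 f a -> is_derive x 1 f b -> a = b.
Proof. by move=> [_ <-] [_ <-]. Qed.

Section test.
Variable phi : R * R -> R.
Hypothesis tphi : test_function phi.

Lemma dxy_dx a b (y : R) : derives (fun x => dxy a b phi (x, y)) (fun x => dxy a.+1 b phi (x, y)).
Proof.
case: tphi => _ [_ h] _ x; have [d _] := h a b.
by rewrite /dxy iterS {2}/dx derive1E; exact/derivableP/d.
Qed.

Lemma dxy_dy b (x : R) : derives (fun y => dxy 0 b phi (x, y)) (fun y => dxy 0 b.+1 phi (x, y)).
Proof.
case: tphi => _ [d _] _ y.
by rewrite /dxy /= {2}/dy derive1E; exact/derivableP/d.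
Qed.

Lemma dxy_cont a b : continuous (dxy a b phi).
Proof. by case: tphi => _ [_ h] _; case: (h a b). Qed.

Lemma dxy_periodic a b (x y : R) : dxy a b phi (x + 2 * pi, y) = dxy a b phi (x, y).
Proof.
elim: a x y => [|a IH] x y.
  elim: b x y => [|b IH] x y; first by case: tphi => + _ _; exact.
  apply: (is_derive_unique (@dxy_dy b (x + 2 * pi) y)).
  by rewrite (_ : (fun y => _) = (fun y => dxy 0 b phi (x, y))); [exact: dxy_dy|exact/funext].
apply: (@is_derive_unique (fun t => dxy a b phi (t + 2 * pi, y)) x).
  have := @is_derive_fcomp _ (fun t => dxy a b phi (t, y)) (fun t => t + 2 * pi) x _ 1 _ (@dxy_dx a b y (x + 2 * pi)).
  by rewrite mulr1; apply; derive_rule; rewrite addr0.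
rewrite (_ : (fun t => _) = (fun t => dxy a b phi (t, y))); first exact: dxy_dx.
by apply/funext => t; exact: IH.
Qed.

Lemma dxy_support : exists2 M : R, 0 <= M & forall a b x y, M < `|y| -> dxy a b phi (x, y) = 0.
Proof.
case: (tphi) => _ _ [M hM]; exists (Num.max M 0); first by rewrite le_max lexx orbT.
move=> a b x y My.
have {}My : M < `|y| by apply: le_lt_trans My; rewrite le_max lexx.
elim: a x => [|a IH] x.
  elim: b x y My => [|b IH] x y My; first exact: hM.
  apply: (is_derive_unique (@dxy_dy b x y)).
  (* M < |y| is an open condition, so the function vanishes near [y] and so does its y-derivative at
     [y]. *)
  apply: (near_eq_is_derive _ (is_derive_fcst 0 y)).
  have cn : continuous (fun y : R => `|y|) by exact: norm_continuous.
  have /cvgrPdist_lt/(_ (`|y| - M)) := cn y.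
  rewrite subr_gt0 => /(_ My); apply: filterS => z hz; apply/esym/IH.
  by move: hz; rewrite ltr_norml; lra.
apply: (is_derive_unique (@dxy_dx a b y x)).
by rewrite (_ : (fun t => _) = (fun=> 0)); [exact: is_derive_fcst|apply/funext => t; exact: IH].
Qed.

Lemma Rintegral_Omega_rect (M : R) (F : R * R -> R) : (forall x y, M < `|y| -> F (x, y) = 0) ->
  Rintegral mu2 Omega F = Rintegral mu2 (rect 0 (2 * pi) (- M) M) F.
Proof.
move=> hF; rewrite Rintegral_mkcond [RHS]Rintegral_mkcond; congr Rintegral.
apply/funext => -[x y]; rewrite !patchE.
have [yM|yM] := leP `|y| M.
  congr (if _ then _ else _); apply/idP/idP => /set_mem[/= h1 h2]; apply/mem_set; split => //=.
  by rewrite in_itv /= -ler_norml.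
by rewrite hF//; do 2 case: ifP => //.
Qed.

Lemma continuous_tensor3 (f h : R -> R) (psi : R * R -> R) : continuous f -> continuous h ->
  continuous psi -> continuous (fun p : R * R => f p.1 * h p.2 * psi p).
Proof.
by move=> cf ch cp p; apply: cvgM; [exact: (continuous_tensor cf ch)|exact: cp].
Qed.

Lemma Rintegral_rectN a b c d (F : R * R -> R) : continuous F ->
  Rintegral mu2 (rect a b c d) (fun p => - F p) = - Rintegral mu2 (rect a b c d) F.
Proof.
move=> cF; rewrite -mulN1r -RintegralZl//; [|exact: measurable_rect|exact: integrable_rect].
by apply: eq_Rintegral => p _; rewrite mulN1r.
Qed.

Lemma weak_dx a b (f f1 h : R -> R) : derives f f1 -> continuous f1 ->
  (forall x, f (x + 2 * pi) = f x) -> continuous h ->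
  Rintegral mu2 Omega (fun p => f p.1 * h p.2 * dxy a.+1 b phi p) =
  - Rintegral mu2 Omega (fun p => f1 p.1 * h p.2 * dxy a b phi p).
Proof.
move=> df cf1 pf ch; have [M M0 hM] := dxy_support.
have cf := derives_continuous df.
rewrite !(@Rintegral_Omega_rect M); [|by move=> x y My; rewrite hM ?mulr0..].
have c1 := continuous_tensor3 cf ch (@dxy_cont a.+1 b).
have c2 := continuous_tensor3 cf1 ch (@dxy_cont a b).
have c3 : continuous (fun p : R * R => - (f1 p.1 * h p.2 * dxy a b phi p)).
  by move=> p; apply: cvgN; exact: c2.
rewrite -Rintegral_rectN//.
have [_ ->] := Fubini_rect 0 (2 * pi) (- M) M c1.
have [_ ->] := Fubini_rect 0 (2 * pi) (- M) M c3.
apply: eq_Rintegral => y _ /=.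
apply: (@Rintegral_parts (fun x => f x * h y) (fun x => f1 x * h y) (fun x => dxy a b phi (x, y))
  (fun x => dxy a.+1 b phi (x, y))).
- exact: twopi_ge0.
- by move=> x; derive_rule; ring.
- exact: dxy_dx.
- by move=> x; apply: cvgMr_tmp; exact: cf1.
- exact: (@continuous_section1 _ (dxy a.+1 b phi) y (@dxy_cont _ _)).
- by rewrite -[2 * pi]add0r pf dxy_periodic.
Qed.

Lemma weak_dy b (f h h1 : R -> R) : continuous f -> derives h h1 -> continuous h1 ->
  Rintegral mu2 Omega (fun p => f p.1 * h p.2 * dxy 0 b.+1 phi p) =
  - Rintegral mu2 Omega (fun p => f p.1 * h1 p.2 * dxy 0 b phi p).
Proof.
move=> cf dh ch1; have [M M0 hM] := dxy_support.
have ch := derives_continuous dh.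
have M1 (c : R -> R -> R) n x y : M + 1 < `|y| -> c x y * dxy 0 n phi (x, y) = 0.
  move=> My; have My' : M < `|y| by lra.
  by rewrite (hM 0%N n x y My') mulr0.
(* At |y| = M + 1 the test function is known to vanish, which removes the boundary terms. In
   [weak_dx] periodicity does this instead. *)
rewrite !(@Rintegral_Omega_rect (M + 1)); last 2 first.
- by move=> x y My; exact: (M1 (fun x y => f x * h1 y) b x y).
- by move=> x y My; exact: (M1 (fun x y => f x * h y) b.+1 x y).
have c1 := continuous_tensor3 cf ch (@dxy_cont 0 b.+1).
have c2 := continuous_tensor3 cf ch1 (@dxy_cont 0 b).
have c3 : continuous (fun p : R * R => - (f p.1 * h1 p.2 * dxy 0 b phi p)).
  by move=> p; apply: cvgN; exact: c2.
rewrite -Rintegral_rectN//.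
have [-> _] := Fubini_rect 0 (2 * pi) (- (M + 1)) (M + 1) c1.
have [-> _] := Fubini_rect 0 (2 * pi) (- (M + 1)) (M + 1) c3.
apply: eq_Rintegral => x _ /=.
apply: (@Rintegral_parts (fun y => f x * h y) (fun y => f x * h1 y) (fun y => dxy 0 b phi (x, y))
  (fun y => dxy 0 b.+1 phi (x, y))).
- by lra.
- by move=> y; derive_rule; ring.
- exact: dxy_dy.
- by move=> y; apply: cvgMl_tmp; exact: ch1.
- exact: (@continuous_section2 _ (dxy 0 b.+1 phi) x (@dxy_cont _ _)).
- by rewrite !hM ?mulr0// ?normrN ger0_norm; lra.
Qed.

(** [dxy] applies the x-derivatives last, so they are removed first. Only when none is left is a
    y-derivative outermost, which is why [weak_dy] is stated with a = 0. *)
Lemma weak_dxy a b (f h : nat -> R -> R) (i j : nat) : (forall n, derives (f n) (f n.+1)) ->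
  (forall n x, f n (x + 2 * pi) = f n x) -> (forall n, derives (h n) (h n.+1)) ->
  Rintegral mu2 Omega (fun p => f i p.1 * h j p.2 * dxy a b phi p) =
  (-1) ^+ (a + b) * Rintegral mu2 Omega (fun p => f (i + a)%N p.1 * h (j + b)%N p.2 * phi p).
Proof.
move=> df pf dh.
have cf n : continuous (f n) := derives_continuous (df n).
have ch n : continuous (h n) := derives_continuous (dh n).
elim: a i => [|a IH] i.
  rewrite addn0; elim: b j => [|b IH] j; first by rewrite !addn0 expr0 mul1r.
  by rewrite (weak_dy _ (cf i) (dh j) (ch _)) IH addSn -addnS exprS mulN1r mulNr.
by rewrite (weak_dx _ _ (df i) (cf _) (pf i) (ch j)) IH !addSn -addnS exprS mulN1r mulNr.
Qed.

End test.

Lemma integral_C_real (D : set (R * R)) (F : R * R -> R) :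
  integral_C D (fun p => (F p)%:C) = (Rintegral mu2 D F)%:C.
Proof.
rewrite /integral_C /=; congr (_ +i* _).
by rewrite /Rintegral integral0_eq.
Qed.

(** The n-th derivative of cos(kx), with a phase shift in place of four cases. *)
Definition dcos (k : nat) (n : nat) (x : R) : R := k%:R ^+ n * cos (k%:R * x + n%:R * (pi / 2)).

Lemma dcos_derives k n : derives (dcos k n) (dcos k n.+1).
Proof.
move=> x; rewrite /dcos; derive_rule.
by rewrite -[n.+1%:R]natr1 [(n%:R + 1) * _]mulrDl mul1r addrA cosDpihalf exprS; ring.
Qed.

Lemma dcos_periodic k n (x : R) : dcos k n (x + 2 * pi) = dcos k n x.
Proof.
rewrite /dcos mulrDr addrAC cosD (cos_2pin k) (sin_2pin k) mulr1 mulr0 subr0//.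
Qed.

Lemma sobolev_cos (k : nat) (h : nat -> R -> R) : (forall n, derives (h n) (h n.+1)) ->
  (forall n, decays (h n)) ->
  sobolev_H_infty (fun p => (cos (k%:R * p.1) * h 0%N p.2)%:C).
Proof.
move=> dh hd n.
have ch m : continuous (h m) := derives_continuous (dh m).
have L2ab a b : L2 (fun p : R * R => (dcos k a p.1 * h b p.2)%:C).
  apply: L2_tensor => //; first exact: (derives_continuous (@dcos_derives k a)).
  exact: dcos_periodic.
have E : (fun p : R * R => (cos (k%:R * p.1) * h 0%N p.2)%:C) = (fun p : R * R => (dcos k 0 p.1 * h 0%N p.2)%:C).
  by apply/funext => p; rewrite /dcos expr0 mul1r mul0r addr0.
rewrite E; split => // a b _.
exists (fun p => (dcos k a p.1 * h b p.2)%:C); split => // phi tphi.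
have R1 (F G : R * R -> R) : (fun p => (F p)%:C * (G p)%:C) = (fun p => (F p * G p)%:C).
  by apply/funext => p; rewrite rmorphM.
rewrite (R1 (fun p => dcos k 0 p.1 * h 0%N p.2)) (R1 (fun p => dcos k a p.1 * h b p.2)).
rewrite !integral_C_real (weak_dxy tphi a b 0 0 (@dcos_derives k) (@dcos_periodic k) dh).
by rewrite !add0n rmorphM rmorphXn rmorphN rmorph1.
Qed.

End weak.

(** * The spectrum *)

Section regularity.
Context {R : realType}.
Implicit Types (f g q u v a b : R -> R).

(** Finite height allows induction in the sum and product rules. Uniqueness of derivatives then lets
    [deriv_upto_derive1n] join the towers of all heights into one sequence. *)
Fixpoint deriv_upto (P : (R -> R) -> Prop) (n : nat) f : Prop :=
  P f /\ if n is n'.+1 then exists2 f', derives f f' & deriv_upto P n' f' else True.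

Lemma deriv_uptoW P n f : deriv_upto P n.+1 f -> deriv_upto P n f.
Proof.
elim: n f => [|n IH] f; first by case.
by move=> [Pf [f' df /IH h]]; split => //; exists f'.
Qed.

Lemma deriv_upto_derive1 P f : (forall n, deriv_upto P n f) ->
  derives f (derive1 f) /\ forall n, deriv_upto P n (derive1 f).
Proof.
move=> h.
have E f' : derives f f' -> derive1 f = f'.
  by move=> df; apply/funext => y; rewrite derive1E; case: (df y).
split; first by have [_ [f' df _]] := h 1%N; rewrite (E f').
by move=> n; have [_ [f' df hn]] := h n.+1; rewrite (E f').
Qed.

Lemma deriv_upto_derive1n P f : (forall n, deriv_upto P n f) -> forall m,
  P (derive1n m f) /\ derives (derive1n m f) (derive1n m.+1 f).
Proof.
move=> h m; have {}h n : deriv_upto P n (derive1n m f).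
  by elim: m n => [|m IH] n //; rewrite derive1nS; have [_] := deriv_upto_derive1 IH.
rewrite derive1nS; split; first by case: (h 0%N).
by case: (deriv_upto_derive1 h).
Qed.

Definition is_bounded f := exists M, forall y, `|f y| <= M.

Lemma bounded_deriv_add n f g : deriv_upto is_bounded n f -> deriv_upto is_bounded n g ->
  deriv_upto is_bounded n (fun y => f y + g y).
Proof.
elim: n f g => [|n IH] f g [[M hM] hf] [[N hN] hg].
  split => //; exists (M + N) => y; apply: le_trans (ler_normD _ _) _; exact: lerD.
split; first by exists (M + N) => y; apply: le_trans (ler_normD _ _) _; exact: lerD.
case: hf => f' df hf; case: hg => g' dg hg.
by exists (fun y => f' y + g' y); [move=> y; derive_rule|exact: IH].
Qed.

Lemma bounded_deriv_mul n f g : deriv_upto is_bounded n f -> deriv_upto is_bounded n g ->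
  deriv_upto is_bounded n (fun y => f y * g y).
Proof.
elim: n f g => [|n IH] f g hf hg.
  case: hf hg => [[M hM] _] [[N hN] _]; split => //.
  by exists (M * N) => y; rewrite normrM ler_pM.
have := deriv_uptoW hf; have := deriv_uptoW hg => hg' hf'.
case: hf hg => [[M hM] [f' df hf]] [[N hN] [g' dg hg]].
split; first by exists (M * N) => y; rewrite normrM ler_pM.
exists (fun y => f' y * g y + f y * g' y); first by move=> y; derive_rule.
by apply: bounded_deriv_add; exact: IH.
Qed.

Lemma bounded_deriv_cst n (c : R) : deriv_upto is_bounded n (fun=> c).
Proof.
elim: n c => [|n IH] c; split => //; first by exists `|c|.
  by exists `|c|.
by exists (fun=> 0) => // y; exact: is_derive_fcst.
Qed.

Lemma W_infty_bounded_deriv g : W_infty_infty g -> forall n, deriv_upto is_bounded n g.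
Proof.
move=> hg n; suff H m : deriv_upto is_bounded n (derive1n m g) by exact: (H 0%N).
elim: n m => [|n IH] m; have [dg [M hM]] := hg m; split => //; try by exists M.
exists (derive1n m.+1 g) => //.
by move=> y; rewrite derive1nS derive1E; exact/derivableP/dg.
Qed.

(** Since v' = q u, combinations a u + b v with bounded smooth coefficients are closed under
    differentiation; the form a u alone would not be. *)
Lemma decay_deriv q u v n a b : solves q u v -> decays u -> decays v ->
  deriv_upto is_bounded n q -> deriv_upto is_bounded n a -> deriv_upto is_bounded n b ->
  deriv_upto decays n (fun y => a y * u y + b y * v y).
Proof.
move=> s [A hA] [B hB]; have [du dv] := s.
have dec (a0 b0 : R -> R) : is_bounded a0 -> is_bounded b0 ->
    decays (fun y => a0 y * u y + b0 y * v y).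
  move=> [M hM] [N hN]; exists (M * A + N * B) => y.
  apply: le_trans (ler_normD _ _) _; rewrite mulrDl -!mulrA.
  by apply: lerD; rewrite normrM ler_pM.
elim: n a b => [|n IH] a b hq ha hb.
  by split => //; case: ha hb => [? _] [? _]; exact: dec.
have hq' := deriv_uptoW hq; have ha' := deriv_uptoW ha; have hb' := deriv_uptoW hb.
case: ha hb => [Ba [a' da ha]] [Bb [b' db hb]].
split; first exact: dec.
exists (fun y => (a' y + b y * q y) * u y + (a y + b' y) * v y).
  by move=> y; derive_rule; ring.
apply: IH => //; first by apply: bounded_deriv_add => //; exact: bounded_deriv_mul.
exact: bounded_deriv_add.
Qed.

(** For t = c |y| the square of exp(t/2) >= 1 + t/2 gives exp(t) >= 1 + t^2/4, and (1 + 4/c^2)(1 +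
    c^2 y^2/4) dominates 1 + y^2. *)
Lemma decays_exp f (c A : R) : 0 < c -> (forall y, `|f y| <= A * expR (- c * `|y|)) -> decays f.
Proof.
move=> c0 hf; exists (A * (1 + 4 / c ^+ 2)) => y; apply: le_trans (hf y) _.
have A0 : 0 <= A.
  by have := le_trans (normr_ge0 _) (hf 0); rewrite normr0 mulr0 expR0 mulr1.
rewrite -mulrA ler_wpM2l// mulNr expRN.
have e0 : 0 < expR (c * `|y|) by exact: expR_gt0.
rewrite ler_pdivlMr ?oneDsq_gt0// mulrC ler_pdivrMr//.
have c2 : 0 < c ^+ 2 by rewrite exprn_gt0.
have h : 1 + c ^+ 2 * y ^+ 2 / 4 <= expR (c * `|y|).
  have -> : expR (c * `|y|) = expR (c * `|y| / 2) ^+ 2.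
    by rewrite expr2 -expRD; congr expR; field.
  have p : 0 <= c * `|y| / 2 by rewrite divr_ge0// mulr_ge0// ltW.
  apply: (@le_trans _ _ ((1 + c * `|y| / 2) ^+ 2)).
    rewrite -[y ^+ 2]real_normK ?num_real//.
    rewrite (_ : (1 + c * `|y| / 2) ^+ 2 = 1 + c ^+ 2 * `|y| ^+ 2 / 4 + 2 * (c * `|y| / 2)); last by field.
    by rewrite lerDl mulr_ge0.
  by rewrite ler_sqr ?nnegrE ?expR_ge0 ?addr_ge0// expR_ge1Dx.
have d0 : 0 < 1 + 4 / c ^+ 2 by rewrite addr_gt0// divr_gt0.
apply: (@le_trans _ _ ((1 + 4 / c ^+ 2) * (1 + c ^+ 2 * y ^+ 2 / 4))); last by rewrite ler_pM2l.
rewrite [leRHS](_ : _ = 1 + y ^+ 2 + (4 / c ^+ 2 + c ^+ 2 * y ^+ 2 / 4)); last first.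
  by field; rewrite gt_eqF.
rewrite lerDl; apply: addr_ge0; first by rewrite divr_ge0 ?(ltW c2).
by rewrite divr_ge0// mulr_ge0 ?sqr_ge0.
Qed.

End regularity.

(** * The eigenvalues: existence, bounds, monotonicity and convergence *)

Section spectrum.
Context {R : realType}.
Local Open Scope complex_scope.
Variables (g : R -> R) (G S L1 L0 Y0 : R).
Hypotheses (Wg : W_infty_infty g) (gG : forall y, `|g y| <= G) (gS : forall y, g y <= S)
  (Sadh : forall e, 0 < e -> exists y, S - e < g y)
  (L1_ge0 : 0 <= L1) (L10 : L1 < L0) (L0S : L0 < S) (Y0_ge0 : 0 <= Y0)
  (gL1 : forall y, Y0 <= `|y| -> g y <= L1).

Let L0_gt0 : 0 < L0. Proof. exact: le_lt_trans L1_ge0 L10. Qed.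

Let S_gt0 : 0 < S. Proof. exact: lt_trans L0_gt0 L0S. Qed.

Let dg : derives g (derive1 g).
Proof. by have [] := deriv_upto_derive1 (W_infty_bounded_deriv Wg). Qed.

Let cg : continuous g. Proof. exact: derives_continuous dg. Qed.

Let G_ge0 : 0 <= G. Proof. exact: le_trans (gG 0). Qed.

(** [m] is the reciprocal of the eigenvalue. The bounds come from the shooting window, and
    positivity inside [bound_state] makes [m] unique. *)
Definition principal (k : nat) (m : R) := [/\ (S + 1)^-1 <= m, m <= L0^-1 &
  exists u v, bound_state (k%:R ^+ 2) g m u v].

(** L = L0 gives existence; L close to [S] gives, for larger k, the lower bound on the eigenvalue
    behind the convergence. *)
Lemma principal_exists (L : R) : L0 <= L -> L < S ->
  exists K0 : nat, forall k, (K0 <= k)%N -> exists2 m, principal k m & m <= L^-1.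
Proof.
move=> L0L LS; have L_gt0 : 0 < L by exact: lt_le_trans L0L.
have [y0 hy0] := Sadh (e := S - L) ltac:(by rewrite subr_gt0).
pose eta := (g y0 - L) / 2.
have eta0 : 0 < eta by rewrite /eta divr_gt0//; lra.
have /cvgr_dist_lt/(_ _ eta0)[d /= d0 hd] := @cg y0.
(* Where g >= L + eta, the coefficient at mu = 1 / L is at most -k^2 eta / L = -(k w1)^2. *)
pose w1 := Num.sqrt (eta / L).
have w10 : 0 < w1 by rewrite sqrtr_gt0 divr_gt0.
have w1E : w1 ^+ 2 = eta / L by rewrite sqr_sqrtr// divr_ge0// ltW.
(* This makes the half period pi / (k w1) fit into the length d/2, over which [g] stays above L +
   eta. *)
exists (Num.trunc (pi / (w1 * (d / 2)))).+1 => k kK.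
have k0 : (0 < k)%N by apply: leq_trans kK.
have kp : 0 < (k%:R : R) by rewrite ltr0n.
have kbig : pi / (w1 * (d / 2)) < k%:R.
  by apply: lt_le_trans (truncnS_gt _) _; rewrite ler_nat.
have K2 : 0 < (k%:R : R) ^+ 2 by rewrite exprn_gt0.
have S1 : 0 < S + 1 by lra.
have short : pi / (k%:R * w1) <= d / 2.
  rewrite ler_pdivrMr ?mulr_gt0//; move: kbig; rewrite ltr_pdivrMr ?mulr_gt0 ?divr_gt0//.
  by rewrite (_ : d / 2 * (k%:R * w1) = k%:R * (w1 * (d / 2))); [exact: ltW|ring].
have hJ y : y0 <= y <= y0 + pi / (k%:R * w1) -> L + eta <= g y.
  move=> /andP[y1 y2].
  have : `|y0 - y| < d by rewrite ltr_norml; apply/andP; split; lra.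
  by move=> /hd /=; rewrite ltr_norml /eta; lra.
have [||||| m [u [v [/andP[m1 m2] s up vr vl]]]] :=
   @ground_exists R g G (k%:R ^+ 2) cg gG (S + 1)^-1 L^-1 Y0 (`|y0| + d).
- by rewrite lef_pV2 ?posrE //; move: LS; lra.
- exact: Y0_ge0.
- move=> y; rewrite /hill mulr_gt0// subr_gt0 mulrC ltr_pdivrMr// mul1r.
  by apply: le_lt_trans (gS y) _; lra.
- move=> m y /andP[m1 m2] Yy; rewrite /hill mulr_ge0 ?(ltW K2)// subr_ge0.
  have m0 : 0 <= m by apply: le_trans m1; rewrite invr_ge0 ltW.
  apply: (@le_trans _ _ (m * L1)); first by rewrite ler_wpM2l// gL1.
  apply: (@le_trans _ _ (L^-1 * L1)); first by rewrite ler_wpM2r.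
  by rewrite mulrC ler_pdivrMr// mul1r; apply: le_trans L0L; exact: ltW.
- move=> u v s up.
  apply: (@sturm_zero R (hill (k%:R ^+ 2) g L^-1) u v y0 (k%:R * w1) s).
  + by rewrite mulr_gt0.
  + move=> y /hJ hy; have -> : - (k%:R * w1) ^+ 2 = k%:R ^+ 2 * (- w1 ^+ 2) by ring.
    rewrite /hill ler_pM2l// w1E.
    rewrite (_ : 1 - L^-1 * g y = (L - g y) / L); last by field; rewrite gt_eqF.
    by rewrite -mulNr ler_pM2r ?invr_gt0//; lra.
  + move=> y /andP[y1 y2]; apply: up.
    have := ler_norm y0; have := ler_norm (- y0); rewrite normrN => n1 n2.
    by rewrite ler_norml; apply/andP; split; lra.
have m0 : 0 < m by apply: lt_le_trans m1; rewrite invr_gt0.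
exists m => //; split => //.
  by apply: le_trans m2 _; rewrite lef_pV2.
exists u, v.
(* For m <= 1 / L the values c^2 and C^2 enclose the coefficient where g <= L1; c > 0 because L1 <
   L. *)
pose c := Num.sqrt (k%:R ^+ 2 * (1 - L1 / L)).
pose C := Num.sqrt (k%:R ^+ 2 * (1 + G / L)).
have cpos : 0 < k%:R ^+ 2 * (1 - L1 / L).
  by rewrite mulr_gt0// subr_gt0 ltr_pdivrMr// mul1r; exact: lt_le_trans L10 L0L.
have Cpos : 0 < k%:R ^+ 2 * (1 + G / L).
  by rewrite mulr_gt0// ltr_pwDl// divr_ge0// ltW.
apply: (@bound_state_decay _ _ _ _ _ _ c C Y0) => //; try by rewrite sqrtr_gt0.
move=> y Yy; rewrite !sqr_sqrtr ?(ltW cpos) ?(ltW Cpos)// /hill !ler_pM2l//.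
have mL : m * L1 <= L1 / L by rewrite mulrC ler_wpM2l.
have mG : m * G <= G / L by rewrite mulrC ler_wpM2l.
have h1 : m * g y <= m * L1 by rewrite ler_pM2l// gL1.
have h2 : m * - g y <= m * G by rewrite ler_pM2l//; have := gG y; rewrite ler_norml; lra.
by apply/andP; split; lra.
Qed.

Lemma principal_gt0 k m : principal k m -> 0 < m.
Proof. by case=> m1 _ _; apply: lt_le_trans m1; rewrite invr_gt0 addr_gt0. Qed.

(** If 1 / m exceeded [S], the coefficient would be positive everywhere and u v strictly increasing,
    although it decays at both ends. *)
Lemma principal_le_sup k m : (0 < k)%N -> principal k m -> m^-1 <= S.
Proof.
move=> k0 pm; have m0 := principal_gt0 pm; case: pm => _ _ [u [v [s up [Y [c [C [A [c0 hY hA]]]]]]]].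
rewrite leNgt; apply/negP => Sm; case: s => du dv.
have q0 y : 0 < hill (k%:R ^+ 2) g m y.
  rewrite mulr_gt0 ?exprn_gt0 ?ltr0n// subr_gt0.
  by rewrite mulrC -ltr_pdivlMr// div1r; apply: le_lt_trans (gS y) Sm.
have duv : derives (fun y => u y * v y) (fun y => v y ^+ 2 + hill (k%:R ^+ 2) g m y * u y ^+ 2).
  by move=> y; derive_rule; ring.
have pos y : 0 < v y ^+ 2 + hill (k%:R ^+ 2) g m y * u y ^+ 2.
  by rewrite ltr_wpDl ?sqr_ge0// mulr_gt0// exprn_gt0.
have uv0 : forall y, u y * v y = 0.
  apply: (@monotone_decay_eq0 _ _ _ 0 c (A ^+ 2) duv) => // [y|y _]; first exact: ltW.
  have [h1 h2] := hA y; rewrite normrM.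
  apply: (@le_trans _ _ (A * expR (- c * `|y|) * (A * expR (- c * `|y|)))).
    by apply: ler_pM.
  have E1 : expR (- c * `|y|) <= 1 by rewrite -expR0 ler_expR mulNr oppr_le0 mulr_ge0// ltW.
  rewrite -expr2 exprMn ler_wpM2l ?sqr_ge0// expr2 ler_piMl// expR_ge0//.
have [_] := duv 0; rewrite (_ : (fun y => u y * v y) = cst 0); last by apply/funext => y; rewrite uv0.
by rewrite derive_cst => e; have := pos 0; rewrite -e ltxx.
Qed.

(** For j = k this yields uniqueness, for j < k strict monotonicity. *)
Lemma principal_anti j k mj mk : (0 < j)%N -> (j <= k)%N -> principal j mj -> principal k mk ->
  mj <= mk -> j = k /\ mj = mk.
Proof.
move=> j0 jk pj pk mjk; have mj0 := principal_gt0 pj.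
case: pj => _ _ [u1 [v1 b1]]; case: pk => _ _ [u2 [v2 b2]].
have [||/eqP h ->] := picone _ _ mj0 mjk b1 b2.
- by rewrite exprn_gt0 ?ltr0n.
- by rewrite ler_sqr ?nnegrE// ler_nat.
by split=> //; move: h; rewrite -!natrX eqr_nat eqn_exp2r// => /eqP.
Qed.

Lemma principal_uniq k m1 m2 : (0 < k)%N -> principal k m1 -> principal k m2 -> m1 = m2.
Proof.
move=> k0 p1 p2; have [h|/ltW h] := leP m1 m2.
  by case: (principal_anti k0 (leqnn k) p1 p2 h).
by case: (principal_anti k0 (leqnn k) p2 p1 h).
Qed.

Lemma principal_eigen k m : (0 < k)%N -> principal k m ->
  exists wt : R -> R, let w := fun p : R * R => (cos (k%:R * p.1) * wt p.2)%:C in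
    eigenfunction g (m^-1)%:C w /\ sobolev_H_infty w.
Proof.
move=> k0 pm; have m0 := principal_gt0 pm.
case: pm => _ _ [u [v [s up [Y [c [C [A [c0 hY hA]]]]]]]].
have [Au hu] : decays u by apply: (@decays_exp _ u c A c0) => y; case: (hA y).
have [Av hv] : decays v by apply: (@decays_exp _ v c A c0) => y; case: (hA y).
have Wb := W_infty_bounded_deriv Wg.
have [G1 hG1] : is_bounded (derive1 g).
  by have [_ h] := deriv_upto_derive1 Wb; case: (h 0%N).
(* A point where g > 0, so that the profile m g u is not identically zero. *)
have [y0 hy0] := Sadh S_gt0; rewrite subrr in hy0.
exists (fun y => m * g y * u y); split.
  apply: (@eigenfunction_cos _ k g (derive1 g) u v m (Num.max G G1) (Num.max Au Av) y0) => //.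
  - by have [d1 _] := deriv_upto_derive1 (deriv_upto_derive1 Wb).2; exact: derives_continuous d1.
  - by move=> y; apply: le_trans (gG y) _; rewrite le_max lexx.
  - by move=> y; apply: le_trans (hG1 y) _; rewrite le_max lexx orbT.
  - move=> y; apply: le_trans (hu y) _; rewrite ler_wpM2r ?le_max ?lexx//.
    by rewrite invr_ge0 ltW// oneDsq_gt0.
  - move=> y; apply: le_trans (hv y) _; rewrite ler_wpM2r ?le_max ?lexx ?orbT//.
    by rewrite invr_ge0 ltW// oneDsq_gt0.
  - by rewrite gt_eqF.
  - by rewrite gt_eqF.
pose h := fun y => m * g y * u y.
have hn n : deriv_upto decays n h.
  rewrite (_ : h = (fun y => (m * g y) * u y + 0 * v y)); last first.
    by apply/funext => y; rewrite /h mul0r addr0.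
  apply: (decay_deriv s); [by exists Au|by exists Av| | |exact: bounded_deriv_cst].
    rewrite (_ : hill _ _ _ = (fun y => k%:R ^+ 2 * (1 + (- m) * g y))); last first.
      by apply/funext => y; rewrite /hill mulNr.
    apply: bounded_deriv_mul; first exact: bounded_deriv_cst.
    apply: bounded_deriv_add; first exact: bounded_deriv_cst.
    by apply: bounded_deriv_mul; [exact: bounded_deriv_cst|exact: Wb].
  by apply: bounded_deriv_mul; [exact: bounded_deriv_cst|exact: Wb].
have := deriv_upto_derive1n hn => dh.
by apply: (@sobolev_cos _ k (fun n => derive1n n h)) => n; case: (dh n).
Qed.

Lemma spectrum : exists kstar : nat, exists lam : nat -> R,
  [/\ forall k, (kstar <= k)%N -> 0 < lam k /\ eigenvalue_L g (lam k)%:C,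
      forall j k, (kstar <= j)%N -> (j < k)%N -> lam j < lam k,
      lam k @[k --> \oo] --> S &
      forall k, (kstar <= k)%N -> exists wt : R -> R,
        let w := fun p : R * R => (cos (k%:R * p.1) * wt p.2)%:C in
        eigenfunction g (lam k)%:C w /\ sobolev_H_infty w].
Proof.
have [K0 hK0] := principal_exists (lexx L0) L0S.
pose M k := xget 0 [set m | principal k m].
have MP k : (K0 <= k)%N -> principal k (M k).
  by move=> /hK0[m pm _]; rewrite /M; case: xgetP => [x _|/(_ m)].
have pos k : (K0.+1 <= k)%N -> (0 < k)%N by apply: leq_trans.
(* The successor ensures k > 0, as the symbol vanishes on the mode 0. *)
exists K0.+1, (fun k => (M k)^-1); split.
- move=> k kK; have pk := MP k (ltnW kK).
  split; first by rewrite invr_gt0 (principal_gt0 pk).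
  by have [wt [e _]] := principal_eigen (pos k kK) pk; eexists; exact: e.
- move=> j k jK jk; have pj := MP j (ltnW jK).
  have kK : (K0 <= k)%N by apply: leq_trans (ltnW jK) (ltnW jk).
  have pk := MP k kK.
  rewrite ltf_pV2 ?posrE ?(principal_gt0 pj) ?(principal_gt0 pk)// ltNge; apply/negP => h.
  have [e _] := principal_anti (pos j jK) (ltnW jk) pj pk h.
  by move: jk; rewrite e ltnn.
- apply/cvgrPdist_le => e e0.
  pose L := Num.max L0 (S - e).
  have L0L : L0 <= L by rewrite le_max lexx.
  have Le : S - e <= L by rewrite le_max lexx orbT.
  have LS : L < S by rewrite gt_max L0S /=; lra.
  have [K hK] := principal_exists L0L LS.
  exists (maxn K K0.+1) => // k /=; rewrite geq_max => /andP[kK kK0].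
  have pk := MP k (ltnW kK0); have [m pm mL] := hK k kK.
  (* Uniqueness transfers the sharper bound from the window with right end 1 / L to the value [M k]
     chosen beforehand. *)
  have mE := principal_uniq (pos k kK0) pk pm.
  have hS := principal_le_sup (pos k kK0) pk.
  have hL : L <= (M k)^-1.
    have Lp : 0 < L := lt_le_trans L0_gt0 L0L.
    by rewrite mE -[L]invrK lef_pV2 ?posrE ?invr_gt0// (principal_gt0 pm).
  by rewrite ger0_norm ?subr_ge0//; lra.
- by move=> k kK; exact: principal_eigen (pos k kK) (MP k (ltnW kK)).
Qed.

End spectrum.

Local Open Scope complex_scope.

Theorem theorem2p4 (R : realType) (drho : R -> R)
    (hreg : W_infty_infty drho)
    (hsup : (maxe 0 (limf_esup (fun y => (drho y)%:E) abs_infty)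
             < (sup (range drho))%:E)%E) :
  exists kstar : nat,
    forall rho_s : R -> R,
      (forall y : R, is_derive y 1 rho_s (drho y)) ->
      exists lam : nat -> R,
        [/\ forall k, (kstar <= k)%N ->
              0 < lam k /\ eigenvalue_L (derive1 rho_s) (lam k)%:C,
            forall j k, (kstar <= j)%N -> (j < k)%N -> lam j < lam k,
            lam k @[k --> \oo] --> sup (range drho) &
            forall k, (kstar <= k)%N ->
              exists wt : R -> R,
                let w := fun p : R * R => (cos (k%:R * p.1) * wt p.2)%:C in
                eigenfunction (derive1 rho_s) (lam k)%:C w /\
                sobolev_H_infty w].
Proof.
have [_ [G gG]] := hreg 0%N; rewrite derive1n0 in gG.
set S := sup (range drho) in hsup *.
have hS : has_sup (range drho).
  split; first by exists (drho 0), 0.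
  by exists G => _ [y _ <-]; apply: le_trans (ler_norm _) (gG y).
have gS y : drho y <= S by apply: (ub_le_sup hS.2); exists y.
have Sadh e : 0 < e -> exists y, S - e < drho y.
  by move=> e0; have [_ [y _ <-]] := sup_adherent e0 hS; exists y.
move: hsup; rewrite gt_max => /andP[]; rewrite lte_fin => S0.
(* The limsup is an infimum of suprema over the filter, so the strict inequality yields one set [V],
   containing all |y| > M, on which the supremum is below [S]. *)
move=> /ereal_inf_lt[_ [V [M _ MV] <-] VS].
(* The supremum over [V] may be negative or even -oo, hence the cut at 0. *)
have [L1 [L1_ge0 L1S gL1]] : exists L1, [/\ 0 <= L1, L1 < S & forall y, V y -> drho y <= L1].
  have le_sup y : V y -> ((drho y)%:E <= ereal_sup [set (drho y)%:E | y in V])%E.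
    by move=> Vy; apply: ereal_sup_ubound; exists y.
  case: (ereal_sup _) VS le_sup => [l| |] //.
    rewrite lte_fin => lS le_sup; exists (Num.max l 0); split.
    - by rewrite le_max lexx orbT.
    - by rewrite gt_max lS.
    - by move=> y /le_sup; rewrite lee_fin le_max => ->.
  by move=> _ le_sup; exists 0; split => // y /le_sup.
(* [M] may be negative and the neighbourhood is given by a strict inequality, hence |M| + 1. *)
have gL1' y : `|M| + 1 <= `|y| -> drho y <= L1.
  by move=> My; apply/gL1/MV => /=; have := ler_norm M; lra.
have L10 : L1 < (L1 + S) / 2 by lra.
have L0S : (L1 + S) / 2 < S by lra.
have Y0 : 0 <= `|M| + 1 by rewrite addr_ge0.
(* [kstar] is obtained before [rho_s] is introduced, so it depends on [drho] only. *)
have [kstar [lam H]] := spectrum hreg gG gS Sadh L1_ge0 L10 L0S Y0 gL1'.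
exists kstar => rho_s hrho; exists lam.
suff -> : derive1 rho_s = drho by [].
by apply/funext => y; rewrite derive1E; case: (hrho y).
Qed.
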